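(* Let $A$ be a regular ring containing a field of characteristic $p>0$, let $m\ge 1$, and let $R=A[X_1,\ldots,X_m]$ be standard graded with $\deg A=0$ and $\deg X_i=1$ for all $i$. Let $\mathcal{T}$ be a graded Lyubeznik functor on the category of graded $R$-modules and set $\mathcal{M}=\mathcal{T}(R)=\bigoplus_{n\in\mathbb{Z}}\mathcal{M}_n$. Then: (a) The following assertions are equivalent: (i) $\mathcal{M}_n\neq 0$ for infinitely many $n\ll 0$ (i.e. for infinitely many negative $n$); (ii) there exists $r$ such that $\mathcal{M}_n\neq 0$ for all $n\le r$; (iii) $\mathcal{M}_n\neq 0$ for all $n\le -m$; (iv) $\mathcal{M}_r\neq 0$ for some $r\le -m$. (b) The following assertions are equivalent: (i) $\mathcal{M}_n\neq 0$ for infinitely many $n\gg 0$ (i.e. for infinitely many positive $n$); (ii) there exists $r$ such that $\mathcal{M}_n\neq 0$ for all $n\ge r$; (iii) $\mathcal{M}_n\neq 0$ for all $n\ge 0$; (iv) $\mathcal{M}_n\neq 0$ for some $n\ge 0$. (c) When $m\ge 2$, the following assertions are equivalent: (i) $\mathcal{M}_t\neq 0$ for some $t$ with $-m<t<0$; (ii) $\mathcal{M}_n\neq 0$ for all $n\in\mathbb{Z}$.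
   Context: A homogeneous closed subset of $\operatorname{Spec}(R)$ is one of the form $V(f_1,\ldots,f_s)$ with all $f_i\in R$ homogeneous; a homogeneous locally closed subset is $Y=Y''\setminus Y'$ with $Y',Y''$ homogeneous closed. $H^i_Y(-)$ denotes local cohomology with support in $Y$. For homogeneous closed $Y'\subseteq Y''$ and $Y=Y''\setminus Y'$ there is an exact sequence of functors on graded $R$-modules $$H^i_{Y'}(-)\to H^i_{Y''}(-)\to H^i_Y(-)\to H^{i+1}_{Y'}(-).\qquad( * )$$ A graded Lyubeznik functor is a composite $\mathcal{T}=\mathcal{T}_1\circ\cdots\circ\mathcal{T}_s$ where each $\mathcal{T}_j$ is either $H^i_{Y_j}(-)$ for a homogeneous locally closed subset $Y_j$ (and some $i$), or the kernel of some arrow in a sequence $( * )$ for homogeneous closed subsets $Y'_j\subset Y''_j$. (For example $\mathcal{T}=H^i_I(-)$ for a homogeneous ideal $I$.) *)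

(* Defs.v *)
From HB Require Import structures.
From mathcomp Require Import all_boot all_order all_algebra.
From mathcomp Require Export mpoly.

Set Implicit Arguments.
Unset Strict Implicit.
Unset Printing Implicit Defensive.

Import GRing.Theory.
Local Open Scope ring_scope.

(* Ideals are arbitrary (not necessarily decidable) subsets, hence Prop-valued
   rather than the boolean predicates of [ring_quotient]. *)
Definition ideal (B : comNzRingType) (I : B -> Prop) : Prop :=
  [/\ I 0, forall x y, I x -> I y -> I (x + y) & forall a x, I x -> I (a * x)].

Definition prime_ideal (B : comNzRingType) (I : B -> Prop) : Prop :=
  [/\ ideal I, ~ I 1 & forall a b, I (a * b) -> I a \/ I b].

Definition maximal_ideal (B : comNzRingType) (I : B -> Prop) : Prop :=
  [/\ ideal I, ~ I 1
    & forall J : B -> Prop, ideal J -> ~ J 1 ->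
        (forall x, I x -> J x) -> forall x, J x -> I x].

Definition span (B : comNzRingType) (d : nat) (g : 'I_d -> B) (x : B) : Prop :=
  exists c : 'I_d -> B, x = \sum_(i < d) c i * g i.

Definition noetherian (B : comNzRingType) : Prop :=
  forall I : B -> Prop, ideal I ->
    exists (d : nat) (g : 'I_d -> B), forall x, I x <-> span g x.

Record spec (B : comNzRingType) := Spec {
  spec_ideal :> B -> Prop;
  spec_prime : prime_ideal spec_ideal
}.

Definition has_prime_chain (B : comNzRingType) (d : nat) : Prop :=
  exists P : nat -> spec B, forall i, (i < d)%N ->
    (forall x, P i x -> P i.+1 x) /\ (exists x, P i.+1 x /\ ~ P i x).

Definition krull_dim (B : comNzRingType) (d : nat) : Prop :=
  has_prime_chain B d /\ ~ has_prime_chain B d.+1.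

Definition local_ring (B : comNzRingType) (mm : B -> Prop) : Prop :=
  maximal_ideal mm /\
  forall J, maximal_ideal J -> forall x, J x <-> mm x.

Definition regular_local_ring (B : comNzRingType) : Prop :=
  noetherian B /\
  exists mm : B -> Prop, local_ring mm /\
  exists d : nat, krull_dim B d /\
  exists g : 'I_d -> B, forall x, mm x <-> span g x.

(* [phi] exhibits [L] as the localization of [B] at the prime [P]; such an [L]
   exists and is unique up to isomorphism. *)
Definition is_localization (B L : comNzRingType) (P : spec B)
    (phi : {rmorphism B -> L}) : Prop :=
  [/\ forall s, ~ P s -> exists u, u * phi s = 1,
      forall x, exists a s, ~ P s /\ x * phi s = phi a
    & forall a, phi a = 0 <-> exists s, ~ P s /\ s * a = 0].

Definition regular_ring (B : comNzRingType) : Prop :=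
  noetherian B /\
  forall P : spec B, exists (L : comNzRingType) (phi : {rmorphism B -> L}),
    is_localization P phi /\ regular_local_ring L.

Section GradedModules.
Variables (A : comNzRingType) (m : nat).
Local Notation R := {mpoly A[m]}.

(* [gr_comp M n] is the component M_n; the last two axioms say that M is the
   (internal) direct sum of its components. *)
Record grmod := GrMod {
  gr_mod :> lmodType R;
  gr_comp : int -> gr_mod -> Prop;
  gr_comp0 : forall n, gr_comp n 0;
  gr_compB : forall n x y, gr_comp n x -> gr_comp n y -> gr_comp n (x - y);
  gr_compZ : forall (d : nat) n (a : R) x,
    a \is d.-homog -> gr_comp n x -> gr_comp (d%:Z + n) (a *: x);
  gr_decomp : forall x, exists (s : seq int) (c : int -> gr_mod),
    (forall n, gr_comp n (c n)) /\ x = \sum_(n <- s) c n;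
  gr_indep : forall (s : seq int) (c : int -> gr_mod),
    uniq s -> (forall n, gr_comp n (c n)) -> \sum_(n <- s) c n = 0 ->
    forall n, n \in s -> c n = 0
}.

Definition comp_neq0 (M : grmod) (n : int) : Prop :=
  exists x : M, gr_comp n x /\ x <> 0.

(* Morphisms of graded modules are homogeneous of degree 0. *)
Record grhom (M N : grmod) := GrHom {
  gr_fun :> {linear M -> N};
  gr_funP : forall n x, gr_comp n x -> gr_comp n (gr_fun x)
}.

Definition gr_injective (E : grmod) : Prop :=
  forall (N N' : grmod) (u : grhom N N') (f : grhom N E), injective u ->
    exists g : grhom N' E, forall x, g (u x) = f x.

Record gr_resolution (M : grmod) := GrResolution {
  res_obj :> nat -> grmod;
  res_aug : grhom M (res_obj 0);
  res_d : forall j, grhom (res_obj j) (res_obj j.+1);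
  res_injective : forall j, gr_injective (res_obj j);
  res_aug_inj : injective res_aug;
  res_exact0 : forall x, res_d 0 x = 0 <-> exists y, x = res_aug y;
  res_exactS : forall j x, res_d j.+1 x = 0 <-> exists y, x = res_d j y
}.

Definition R_comp (n : int) (x : R) : Prop :=
  if n is Posz d then x \is d.-homog else x = 0.

Lemma R_comp0 n : R_comp n 0.
Proof. by case: n => n //=; exact: dhomog0. Qed.

Lemma R_compB n x y : R_comp n x -> R_comp n y -> R_comp n (x - y).
Proof.
case: n => n /=; last by move=> -> ->; rewrite subr0.
by move=> hx hy; apply: rpredB.
Qed.

Lemma R_compZ (d : nat) n (a x : R) :
  a \is d.-homog -> R_comp n x -> R_comp (d%:Z + n) (a * x).
Proof.
case: n => n /= ha hx; first exact: dhomogM.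
by rewrite hx mulr0; exact: R_comp0.
Qed.

Lemma R_decomp (x : R) : exists (s : seq int) (c : int -> R),
  (forall n, R_comp n (c n)) /\ x = \sum_(n <- s) c n.
Proof.
exists [seq Posz i | i <- iota 0 (mmeasure mdeg x)].
exists (fun n => if n is Posz d then pihomog mdeg d x else 0).
split=> [[n|n] //=|]; first exact: pihomogP.
rewrite big_map {1}(@pihomog_partitionE _ _ mdeg _ x (leqnn _)).
by rewrite -(big_mkord xpredT (fun d => pihomog mdeg d x)) /index_iota subn0.
Qed.

Lemma R_indep (s : seq int) (c : int -> R) :
  uniq s -> (forall n, R_comp n (c n)) -> \sum_(n <- s) c n = 0 ->
  forall n, n \in s -> c n = 0.
Proof.
move=> us hc s0 [d|d] ns; last exact: (hc (Negz d)).
have := congr1 (pihomog mdeg d) s0.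
rewrite raddf0 raddf_sum (bigD1_seq (Posz d)) //= big1_seq ?addr0.
  by rewrite pihomog_dE //; exact: (hc (Posz d)).
case=> e /andP[ne _]; last by rewrite (hc (Negz e)) raddf0.
by apply: (@pihomog_ne0 _ _ _ e); [move: ne | exact: (hc (Posz e))].
Qed.

Definition gr_R : grmod :=
  @GrMod R^o R_comp R_comp0 R_compB R_compZ R_decomp R_indep.

Definition homog_closed (Y : spec R -> Prop) : Prop :=
  exists s : seq R, (forall f, f \in s -> exists d : nat, f \is d.-homog) /\
    forall P : spec R, Y P <-> (forall f, f \in s -> P f).

Definition nested_homog_closed (Y' Y'' : spec R -> Prop) : Prop :=
  [/\ homog_closed Y', homog_closed Y'' & forall P, Y' P -> Y'' P].

(* Y = Y'' \ Y'; the inclusion of Y' in Y'' is no restriction, since Y' may be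
   replaced by its intersection with Y''. *)
Definition homog_lc_presentation (Y Y' Y'' : spec R -> Prop) : Prop :=
  nested_homog_closed Y' Y'' /\ forall P, Y P <-> Y'' P /\ ~ Y' P.

Definition homog_locally_closed (Y : spec R -> Prop) : Prop :=
  exists Y' Y'', homog_lc_presentation Y Y' Y''.

(* P lies in the support of the section x of the sheaf of M, i.e. x/1 <> 0 in
   the localization M_P. *)
Definition in_supp (M : grmod) (x : M) (P : spec R) : Prop :=
  forall s : R, s *: x = 0 -> P s.

Definition Gam (Z : spec R -> Prop) (M : grmod) (x : M) : Prop :=
  forall P, in_supp x P -> Z P.

Definition Zero (M : grmod) (x : M) : Prop := x = 0.

(* Numerator and denominator of H^i(G''(E) / G'(E)), for a complex E and
   subfunctors G' <= G'' of the identity. *)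
Section Cohomology.
Variables (M : grmod) (E : gr_resolution M).
Variables (G'' G' : forall N : grmod, N -> Prop).

Definition cocycle (i : nat) (x : E i) : Prop :=
  G'' x /\ G' (res_d E i x).

Definition boundary_from (i : nat) : E i -> Prop :=
  match i with
  | 0 => fun x => x = 0
  | j.+1 => fun x => exists y : E j, G'' y /\ x = res_d E j y
  end.

Definition coboundary (i : nat) (x : E i) : Prop :=
  exists a b, [/\ G' a, boundary_from b & x = a + b].

End Cohomology.

(* N is isomorphic, as a graded module, to Z / B, where B <= Z are graded
   submodules of M. *)
Definition is_subquotient (M N : grmod) (Z B : M -> Prop) : Prop :=
  exists q : M -> N,
    [/\ forall (a : R) x y, Z x -> Z y -> q (a *: x + y) = a *: q x + q y,
        forall z, exists x, Z x /\ q x = z,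
        forall x, Z x -> (q x = 0 <-> B x)
      & forall n x, Z x -> gr_comp n x -> gr_comp n (q x)].

(* For closed subsets Y' of Y'' and an injective resolution E, the complex
   Gam Y'' E / Gam Y' E consists of the sections of E over the complement of Y'
   with support in Y'' \ Y', so its cohomology is H^i_{Y'' \ Y'}; Y' empty
   gives H^i_{Y''}, as then Gam Y' E = 0.  The short exact sequence
     0 -> Gam Y' E -> Gam Y'' E -> Gam Y'' E / Gam Y' E -> 0
   induces the long exact sequence
     H^i_{Y'} -> H^i_{Y''} -> H^i_{Y'' \ Y'} -> H^{i+1}_{Y'},
   and the last three constructors are the kernels of its three arrows. *)
Inductive lyubeznik_step :=
  | LocCoh (Y : spec R -> Prop) (i : nat)
  | KerClosedClosed (Y' Y'' : spec R -> Prop) (i : nat)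
  | KerClosedLc (Y' Y'' : spec R -> Prop) (i : nat)
  | KerConnecting (Y' Y'' : spec R -> Prop) (i : nat).

Definition lyubeznik_step_ok (t : lyubeznik_step) : Prop :=
  match t with
  | LocCoh Y _ => homog_locally_closed Y
  | KerClosedClosed Y' Y'' _ | KerClosedLc Y' Y'' _
  | KerConnecting Y' Y'' _ => nested_homog_closed Y' Y''
  end.

(* N is (isomorphic to) the value at M of the functor t.  As for any right
   derived functor, the value does not depend on the resolution; nor does
   H^i_Y depend on the presentation Y = Y'' \ Y'. *)
Definition step_value (t : lyubeznik_step) (M N : grmod) : Prop :=
  exists E : gr_resolution M,
  match t with
  | LocCoh Y i =>
      exists Y' Y'', homog_lc_presentation Y Y' Y'' /\
      @is_subquotient (E i) N
        (@cocycle M E (Gam Y'') (Gam Y') i)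
        (@coboundary M E (Gam Y'') (Gam Y') i)
  | KerClosedClosed Y' Y'' i =>
      @is_subquotient (E i) N
        (fun x => @cocycle M E (Gam Y') Zero i x /\
                  @coboundary M E (Gam Y'') Zero i x)
        (@coboundary M E (Gam Y') Zero i)
  | KerClosedLc Y' Y'' i =>
      @is_subquotient (E i) N
        (fun x => @cocycle M E (Gam Y'') Zero i x /\
                  @coboundary M E (Gam Y'') (Gam Y') i x)
        (@coboundary M E (Gam Y'') Zero i)
  | KerConnecting Y' Y'' i =>
      @is_subquotient (E i) N
        (fun x => @cocycle M E (Gam Y'') (Gam Y') i x /\
                  @coboundary M E (Gam Y') Zero i.+1 (res_d E i x))
        (@coboundary M E (Gam Y'') (Gam Y') i)
  end.

(* [:: T_1; ...; T_s] stands for the composite T_1 o ... o T_s, s >= 1. *)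
Definition graded_lyubeznik_functor (T : seq lyubeznik_step) : Prop :=
  T <> [::] /\ foldr (fun t Q => lyubeznik_step_ok t /\ Q) True T.

Fixpoint functor_value (T : seq lyubeznik_step) (M N : grmod) : Prop :=
  match T with
  | [::] => N = M
  | t :: T' => exists K, functor_value T' M K /\ step_value t K N
  end.

End GradedModules.

Definition infinitely_many (Q : int -> Prop) : Prop :=
  forall s : seq int, exists n, n \notin s /\ Q n.

(* Main.v *)
Require Import Defs.
From HB Require Import structures.
From mathcomp Require Import all_boot all_order all_algebra.
From mathcomp Require Import generic_quotient freeg.
From mathcomp Require Import boolp ring zify.

Set Implicit Arguments.
Unset Strict Implicit.
Unset Printing Implicit Defensive.

Import Order.TTheory GRing.Theory Num.Theory.
Local Open Scope ring_scope.

(** The module [M = T(R)] is isomorphic to its own Frobenius pullback [F(M)],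
    compatibly with the grading in which [phi : M -> F(M)] multiplies degrees by
    [p].  Since [A[X]] is free over [A[X^p]] on the monomials with exponents
    below [p], whose degrees fill the interval from 0 to [m (p - 1)], this says
    that
      [M_n <> 0] if and only if [M_j <> 0] for some [j] with
      [p j <= n <= p j + m (p - 1)]
    ([comp_neq0_pullback]).  All the assertions of the theorem are consequences
    of this equivalence about sets of integers: it expands [{-m}] to all
    [n <= -m], expands [{0}] to all [n >= 0], and expands any [j] strictly
    between [-m] and 0 to all integers; conversely, dividing by [p] repeatedly
    moves any degree of a nonzero component to one of these starting points
    ([degrees_low], [degrees_high], [degrees_all]).

    The isomorphism [F(M) = M] holds for [M = R] and propagates through each
    factor of the composite [T] ([step_pullback]).  Let [K] be its own pullback
    and [E] a graded injective resolution of [K].  As Frobenius is flat on [R],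
    [F(E)] is a resolution of [F(K) = K], and [F] commutes with kernels, images,
    intersections and sections with support, hence with every subquotient by
    which the factors of [T] are defined.  Injectivity of [E] gives a map
    [F(E) -> E] of resolutions of [K]; its cone is exact.  The terms of the cone
    are flasque: injective graded modules over a Noetherian ring are flasque, and
    [F] preserves this.  So the cone stays exact after taking sections with
    support ([flasque_exact], [resolution_pullback]), and [F(E) -> E] induces an
    isomorphism on each of the subquotients ([natural_subquotient_pullback]).

    Flatness of Frobenius on [R] reduces to [A], by comparing coefficients
    ([frob_flat_mpoly]), then to the regular local rings of [A]
    ([frob_flat_regular]), where it is the theorem of Kunz
    ([frob_flat_regular_local]).  A regular system of parameters and its powers
    are regular sequences, because the quotients of a regular local ring by part
    of such a system are domains ([gen_prime]), which follows from Krull's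
    principal ideal theorem; the local criterion of flatness applies along this
    sequence.

    Flatness and pullbacks are expressed by equations: a relation
    [sum r_i a_i^p = 0] must be a combination of [p]-th powers of relations
    between the [a_i] ([frob_flat], [frob_pullback]). *)

(** * Ideals and primes in Noetherian rings *)

Section Ideals.
Variable B : comNzRingType.
Implicit Types (I J : B -> Prop) (a b c x y z : B).

Lemma ideal0 I : ideal I -> I 0. Proof. by case. Qed.
Lemma idealD I x y : ideal I -> I x -> I y -> I (x + y).
Proof. by case=> _ h _; apply: h. Qed.
Lemma idealM I a x : ideal I -> I x -> I (a * x).
Proof. by case=> _ _ h; apply: h. Qed.
Lemma idealMr I a x : ideal I -> I x -> I (x * a).
Proof. by rewrite mulrC; apply: idealM. Qed.
Lemma idealN I x : ideal I -> I x -> I (- x).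
Proof. by move=> hI hx; rewrite -mulN1r; apply: idealM. Qed.
Lemma idealB I x y : ideal I -> I x -> I y -> I (x - y).
Proof. by move=> hI hx hy; apply: idealD => //; apply: idealN. Qed.
Lemma idealBl I x y : ideal I -> I (x - y) -> I y -> I x.
Proof. by move=> hI h hy; rewrite -(subrK y x); apply: idealD. Qed.
Lemma idealBr I x y : ideal I -> I (x - y) -> I x -> I y.
Proof. by move=> hI h hx; rewrite -(subKr x y); apply: idealB. Qed.
Lemma ideal_sum I (K : Type) (s : seq K) (P : pred K) (F : K -> B) :
  ideal I -> (forall k, P k -> I (F k)) -> I (\sum_(k <- s | P k) F k).
Proof.
move=> hI hF; elim/big_ind: _ => //; first exact: ideal0.
by move=> x y; apply: idealD.
Qed.

Definition zero_ideal : B -> Prop := fun x => x = 0.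

Lemma zero_idealP : ideal zero_ideal.
Proof.
by split=> // [x y -> ->|a x ->]; rewrite /zero_ideal ?addr0 ?mulr0.
Qed.

Definition adjoin I b : B -> Prop := fun z => exists c, I (z - c * b).

Lemma adjoin_ideal I b : ideal I -> ideal (adjoin I b).
Proof.
move=> hI; split.
- by exists 0; rewrite mul0r subr0; apply: ideal0.
- move=> x y [c hc] [d hd]; exists (c + d).
  have -> : x + y - (c + d) * b = (x - c * b) + (y - d * b) by ring.
     by apply: idealD.
- move=> a x [c hc]; exists (a * c).
  by rewrite -mulrA -mulrBr; apply: idealM.
Qed.

Lemma adjoin_sub I b x : I x -> adjoin I b x.
Proof. by move=> hx; exists 0; rewrite mul0r subr0. Qed.

Lemma adjoin_gen I b : ideal I -> adjoin I b b.
Proof. by move=> hI; exists 1; rewrite mul1r subrr; apply: ideal0. Qed.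

Lemma adjoin_min I J b : ideal J -> (forall x, I x -> J x) -> J b ->
  forall x, adjoin I b x -> J x.
Proof.
move=> hJ hIJ hb x [c /hIJ hc]; apply: (idealBl hJ hc).
exact: idealM.
Qed.

Definition colon I b : B -> Prop := fun a => I (a * b).

Lemma colon_ideal I b : ideal I -> ideal (colon I b).
Proof.
move=> hI; split; rewrite /colon.
- by rewrite mul0r; apply: ideal0.
- by move=> x y hx hy; rewrite mulrDl; apply: idealD.
- by move=> a x hx; rewrite -mulrA; apply: idealM.
Qed.

Lemma prime_exp P x n : prime_ideal P -> P (x ^+ n) -> P x.
Proof.
move=> [_ P1 hP]; elim: n => [|n IH]; first by rewrite expr0 => /P1.
by rewrite exprS => /hP[].
Qed.

Lemma primeM P x y : prime_ideal P -> ~ P x -> ~ P y -> ~ P (x * y).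
Proof. by move=> [_ _ hP] hx hy /hP[]. Qed.

Hypothesis noethB : noetherian B.

Lemma acc (I : nat -> B -> Prop) : (forall n, ideal (I n)) ->
  (forall n x, I n x -> I n.+1 x) ->
  exists N, forall n x, I n x -> I N x.
Proof.
move=> hI hS.
have hm n k x : I n x -> I (n + k)%N x.
  by elim: k => [|k IH]; rewrite ?addn0 // addnS => /IH /hS.
pose U x := exists n, I n x.
have hU : ideal U.
  split; first by exists 0%N; apply: ideal0.
    move=> x y [n hx] [k hy]; exists (n + k)%N; apply: idealD => //.
      exact: hm.
    by rewrite addnC; apply: hm.
  by move=> a x [n hx]; exists n; apply: idealM.
have [d [g hg]] := noethB hU.
have hgi i : U (g i).
  apply/hg; exists (fun j => (j == i)%:R).
  rewrite (bigD1 i) //= eqxx mul1r big1 ?addr0 // => j /negPf->.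
  by rewrite mul0r.
have [f hf] := choice hgi.
exists (\sum_i f i)%N => n x hx.
have /hg [c ->] : U x by exists n.
apply: ideal_sum => // i _; apply: idealM => //.
by rewrite (bigD1 i) //=; apply: hm.
Qed.

Lemma noeth_ind (Q : (B -> Prop) -> Prop) :
  (forall I, ideal I ->
     (forall J, ideal J -> (forall x, I x -> J x) ->
        (exists x, J x /\ ~ I x) -> Q J) -> Q I) ->
  forall I, ideal I -> Q I.
Proof.
move=> step I0 hI0; apply: contrapT => nQ0.
pose bad := {I : B -> Prop | ideal I /\ ~ Q I}.
have next (b : bad) : exists b' : bad,
    (forall x, sval b x -> sval b' x) /\ (exists x, sval b' x /\ ~ sval b x).
  case: b => I [hI nQ] /=; apply: contrapT => h; apply: nQ; apply: step => //.
  move=> J hJ hIJ hx; apply: contrapT => nQJ; apply: h.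
  by exists (exist _ J (conj hJ nQJ)).
have [f hf] := choice next.
pose b0 : bad := exist _ I0 (conj hI0 nQ0).
pose ch n := sval (iter n f b0).
have [N hN] : exists N, forall n x, ch n x -> ch N x.
  apply: acc => [n|n x]; rewrite /ch; first by case: (svalP (iter n f b0)).
  by rewrite iterS; case: (hf (iter n f b0)) => + _; apply.
have [_ [x [hx nx]]] := hf (iter N f b0).
by apply: nx; apply: (hN N.+1).
Qed.

Lemma noeth_max (Q : (B -> Prop) -> Prop) I0 : ideal I0 -> Q I0 ->
  exists I, [/\ ideal I, Q I, forall x, I0 x -> I x &
    forall J, ideal J -> Q J -> (forall x, I x -> J x) ->
      forall x, J x -> I x].
Proof.
move=> hI0; move: I0 hI0; apply: noeth_ind => I hI IH QI.
case: (pselect (exists J, [/\ ideal J, Q J, forall x, I x -> J x &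
    exists x, J x /\ ~ I x])) => [[J [hJ QJ hIJ hx]]|nJ].
  have [K [hK QK hJK mK]] := IH J hJ hIJ hx QJ.
  by exists K; split=> // x /hIJ /hJK.
exists I; split=> // J hJ QJ hIJ x hx; apply: contrapT => nx.
by apply: nJ; exists J; split=> //; exists x.
Qed.

(** Take an ideal [P] maximal among those avoiding the multiplicative set: if
    neither [a] nor [b] is in [P], then [P + (a)] and [P + (b)] meet the set, and
    so does [P + (a b)]. *)
Lemma prime_avoid I (Sm : B -> Prop) : ideal I -> Sm 1 ->
  (forall x y, Sm x -> Sm y -> Sm (x * y)) -> (forall x, I x -> ~ Sm x) ->
  exists P, [/\ prime_ideal P, forall x, I x -> P x & forall x, P x -> ~ Sm x].
Proof.
move=> hI S1 SM hS.
have [P [hP QP hIP mP]] := noeth_max (Q := fun J => forall x, J x -> ~ Sm x) hI hS.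
exists P; split=> //; split=> //; first by move=> /QP.
move=> a b hab; apply: contrapT => /not_orP[na nb].
have meets c : ~ P c -> exists x d, Sm x /\ P (x - d * c).
  move=> nc; apply: contrapT => h; apply: nc.
  apply: (mP _ (adjoin_ideal c hP)) => [x [d hd] hx|x|].
  - by apply: h; exists x, d.
  - exact: adjoin_sub.
  - exact: adjoin_gen.
have [x [d [hx hd]]] := meets _ na; have [y [e [hy he]]] := meets _ nb.
apply: (QP (x * y)); last exact: SM.
have -> : x * y = (x - d * a) * y + d * a * (y - e * b) + d * e * (a * b) by ring.
apply: idealD => //; last exact: idealM.
by apply: idealD => //; [apply: idealMr | apply: idealM].
Qed.

Lemma maximal_above I : ideal I -> ~ I 1 ->
  exists P, maximal_ideal P /\ forall x, I x -> P x.
Proof.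
move=> hI nI1.
have [P [hP QP hIP mP]] := noeth_max (Q := fun J => ~ J 1) hI nI1.
by exists P; split=> //; split=> // J hJ nJ1 hPJ x; apply: mP.
Qed.

Lemma prime_above I : ideal I -> ~ I 1 ->
  exists P, prime_ideal P /\ forall x, I x -> P x.
Proof.
move=> hI nI1.
have [||P [hP hIP _]] := @prime_avoid I (fun x => x = 1) hI erefl.
- by move=> x y -> ->; rewrite mulr1.
- by move=> x hx xE; rewrite xE in hx.
by exists P.
Qed.

(** The chain of ideals [J : g ^ n] is stationary; past that point, an element of
    [J + (g ^ n)] that some power of [g] carries into [J] already lies in [J].
    This plays the part of the Artin-Rees lemma throughout. *)
Lemma torsion_separation J g b N : ideal J -> J (g ^+ N * b) ->
  exists n, forall c w, J (c * b - w * g ^+ n) -> J (c * b).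
Proof.
move=> hJ hb.
have [||n hn] := acc (I := fun n => colon J (g ^+ n)).
- by move=> n; apply: colon_ideal.
- by move=> n x; rewrite /colon exprS mulrCA; apply: idealM.
exists n => c w h; apply: (idealBl hJ h); apply: (hn (N + n)%N).
(* [g ^ N] kills [c * b] modulo [J], so [g ^ (N + n)] kills [w] *)
have : J (c * (g ^+ N * b) - g ^+ N * (c * b - w * g ^+ n)).
  by apply: idealB => //; apply: idealM.
by rewrite /colon exprD; congr J; ring.
Qed.

(** Krull's intersection theorem for [B_P / W]: an element [z] divisible by all
    powers of [x] vanishes.  Separating [z] from the powers of [x] modulo
    [J = W + P z] gives [s z] in [J] with [s] outside [P], and [s - d] is then a
    unit at [P] for each [d] in [P]. *)
Lemma krull_intersection (P W : B -> Prop) x z : prime_ideal P -> ideal W ->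
  (forall s a, ~ P s -> W (s * a) -> W a) -> P x ->
  (forall n, exists s u, ~ P s /\ W (s * z - x ^+ n * u)) -> W z.
Proof.
move=> hP hW satW hx h; have [hPi P1 hPp] := hP.
pose J a := exists d, P d /\ W (a - d * z).
have hJ : ideal J.
  split.
  - by exists 0; split; [exact: ideal0 | rewrite mul0r subr0; apply: ideal0].
  - move=> a b [d [hd ha]] [e [he hb]]; exists (d + e); split; first exact: idealD.
    have -> : a + b - (d + e) * z = (a - d * z) + (b - e * z) by ring.
       by apply: idealD.
  - move=> a b [d [hd ha]]; exists (a * d); split; first exact: idealM.
    by rewrite -mulrA -mulrBr; apply: idealM.
have WJ a : W a -> J a.
  by move=> ha; exists 0; split; [exact: ideal0 | rewrite mul0r subr0].
have [|n hn] := @torsion_separation J x z 1 hJ.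
  by rewrite expr1; exists x; split=> //; rewrite subrr; apply: ideal0.
have [s [u [ns hs]]] := h n.
have [|d [hd hsd]] := hn s u; first by rewrite [u * _]mulrC; apply: WJ.
apply: (satW (s - d)); last by rewrite mulrBl.
by move=> hsd'; apply: ns; apply: (idealBl hPi hsd').
Qed.

End Ideals.

(** * Krull's principal ideal theorem *)

Section PrincipalIdealTheorem.
Variable B : comNzRingType.
Hypothesis noethB : noetherian B.
Implicit Types (I J P Q W : B -> Prop) (a b c x y z : B).

(** The ideals saturated with respect to [P] correspond to those of the
    localization at [P]. *)
Definition saturated P J := forall s a, ~ P s -> J (s * a) -> J a.

Definition saturation P J : B -> Prop := fun a => exists s, ~ P s /\ J (s * a).

Lemma saturation_ideal P J : prime_ideal P -> ideal J -> ideal (saturation P J).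
Proof.
move=> hP hJ; have [_ P1 _] := hP; split.
- by exists 1; rewrite mulr0; split=> //; apply: ideal0.
- move=> x y [s [hs hx]] [t [ht hy]]; exists (s * t); split; first exact: primeM.
  have -> : s * t * (x + y) = t * (s * x) + s * (t * y) by ring.
  by apply: idealD => //; apply: idealM.
- move=> a x [s [hs hx]]; exists s; split=> //.
  by rewrite mulrCA; apply: idealM.
Qed.

Lemma saturation_saturated P J : prime_ideal P -> saturated P (saturation P J).
Proof.
move=> hP s a hs [t [ht h]]; exists (t * s); split; first exact: primeM.
by rewrite -mulrA.
Qed.

Lemma saturation_sub P J x : prime_ideal P -> J x -> saturation P J x.
Proof. by move=> [_ P1 _] hx; exists 1; rewrite mul1r. Qed.

(** [B_P / I0 B_P] is Artinian when [P] is minimal over [I0]: every nonzero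
    module over it has a socle, so the descending chain condition follows by
    Noetherian induction, adjoining one socle element at a time. *)
Lemma dcc_above_minimal P I0 : prime_ideal P ->
  (forall P', prime_ideal P' -> (forall x, I0 x -> P' x) ->
     (forall x, P' x -> P x) -> forall x, P x -> P' x) ->
  forall J, ideal J -> saturated P J -> (forall x, I0 x -> J x) ->
  forall D : nat -> B -> Prop, (forall n, ideal (D n)) ->
    (forall n, saturated P (D n)) -> (forall n x, D n.+1 x -> D n x) ->
    (forall n x, J x -> D n x) ->
  exists n0, forall n, (n0 <= n)%N -> forall x, D n x -> D n.+1 x.
Proof.
move=> hP hmin; have [hPi P1 _] := hP; apply: noeth_ind => // J hJ IH satJ IJ D hD satD decD JD.
case: (pselect (J 1)) => [J1|nJ1].
  exists 0%N => n _ x _; apply: JD; rewrite -(mulr1 x); exact: idealM.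
have Q0 : exists b, ~ J b /\ forall a, J a <-> J (a * b).
  by exists 1; split=> // a; rewrite mulr1.
have [I' [hI' [b [nb hb]] _ maxI']] := noeth_max noethB
  (Q := fun I => exists b, ~ J b /\ forall a, I a <-> J (a * b)) hJ Q0.
have Pb a : P a -> J (a * b).
  move=> ha; apply/hb; apply: hmin ha.
  - split=> //; first by move/hb; rewrite mul1r.
    move=> a1 a2 /hb h12; case: (pselect (J (a1 * b))) => [/hb|n1]; first by left.
    right; apply: (maxI' (colon J (a1 * b))).
    + exact: colon_ideal.
    + by exists (a1 * b).
    + by move=> y /hb hy; rewrite /colon mulrCA; apply: idealM.
    + by rewrite /colon mulrCA mulrA.
  - move=> y /IJ hy; apply/hb; exact: idealMr.
  - move=> y /hb hy; apply: contrapT => ny; apply: nb; exact: satJ hy.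
pose E n := saturation P (adjoin (D n) b).
have hE n : ideal (E n) by apply: saturation_ideal => //; apply: adjoin_ideal.
pose J2 := saturation P (adjoin J b).
have hJ2 : ideal J2 by apply: saturation_ideal => //; apply: adjoin_ideal.
have JJ2 x : J x -> J2 x.
  by move=> hx; apply: saturation_sub => //; apply: adjoin_sub.
have adjS (I1 I2 : B -> Prop) : (forall x, I1 x -> I2 x) ->
    forall x, saturation P (adjoin I1 b) x -> saturation P (adjoin I2 b) x.
  by move=> h12 x [s [hs [c hc]]]; exists s; split=> //; exists c; apply: h12.
have [|n1 hn1] := IH J2 hJ2 JJ2 _ (@saturation_saturated P _ hP)
    (fun x hx => JJ2 x (IJ x hx)) E hE (fun n => @saturation_saturated P _ hP)
    (fun n => adjS _ _ (decD n)) (fun n => adjS _ _ (JD n)).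
  by exists b; split=> //; apply: saturation_sub => //; apply: adjoin_gen.
have key n x : (n1 <= n)%N -> D n x -> D n b \/ D n.+1 x.
  move=> hn hx.
  have [|s [hs [c hc]]] := hn1 n hn x.
    by apply: saturation_sub => //; apply: adjoin_sub.
  have hcb : D n (c * b).
    by apply: (idealBr (hD n) (decD n _ hc)); apply: idealM.
  case: (pselect (P c)) => [/Pb Jcb|nc]; last by left; apply: satD hcb.
  right; apply: (satD _ s) => //; apply: (idealBl (hD _) hc).
  exact: JD.
have mono n k x : D (n + k)%N x -> D n x.
  by elim: k => [|k IHk]; rewrite ?addn0 // addnS => /decD.
case: (pselect (exists n2, ~ D n2 b)) => [[n2 nDb]|/forallNP allb].
  exists (n1 + n2)%N => n hn x hx; case: (key n x _ hx) => //.
    by apply: leq_trans hn; apply: leq_addr.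
  move=> hb'; case: nDb; apply: (mono _ (n - n2)%N); rewrite subnKC //.
  by apply: leq_trans hn; apply: leq_addl.
exists n1 => n hn x hx.
have [|s [hs [c hc]]] := hn1 n hn x.
  by apply: saturation_sub => //; apply: adjoin_sub.
apply: (satD _ s) => //; apply: (idealBl (hD _) hc).
by apply: idealM => //; apply: contrapT; apply: allb.
Qed.

(** Krull's principal ideal theorem: a prime [P] minimal over [Q0 + (x)] has
    no prime strictly between [Q0] and itself.  The descending chain is that
    of the symbolic powers of a single element [y] of [Q]. *)
Lemma principal_ideal_theorem Q0 Q P x y :
  prime_ideal Q0 -> prime_ideal Q -> prime_ideal P ->
  (forall z, Q0 z -> Q z) -> (forall z, Q z -> P z) -> P x -> ~ Q x ->
  Q y -> ~ Q0 y ->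
  exists P', [/\ prime_ideal P', forall z, Q0 z -> P' z, P' x,
    forall z, P' z -> P z & exists z, P z /\ ~ P' z].
Proof.
move=> hQ0 hQ hP Q0Q QP Px nQx Qy nQ0y; apply: contrapT => nex.
have [Q0i Q01 _] := hQ0; have [Qi Q1 _] := hQ; have [Pi P1 _] := hP.
have nPQ s : ~ P s -> ~ Q s by move=> h /QP.
pose I0 := adjoin Q0 x.
have hmin P' : prime_ideal P' -> (forall z, I0 z -> P' z) ->
     (forall z, P' z -> P z) -> forall z, P z -> P' z.
  move=> hP' I0P' P'P z Pz; apply: contrapT => nz; apply: nex; exists P'.
  split=> //; [|by apply: I0P'; apply: adjoin_gen|by exists z].
  by move=> t ht; apply: I0P'; apply: adjoin_sub.
(* the analogue of the symbolic powers of [Q], for the single element [y] *)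
pose J n := saturation Q (adjoin Q0 (y ^+ n)).
have hJ n : ideal (J n) by apply: saturation_ideal => //; apply: adjoin_ideal.
have satJ n : saturated Q (J n) by apply: saturation_saturated.
have decJ n z : J n.+1 z -> J n z.
  by move=> [s [hs [c hc]]]; exists s; split=> //; exists (c * y);
     rewrite -mulrA -exprS.
pose D n := saturation P (adjoin (J n) x).
have hD n : ideal (D n) by apply: saturation_ideal => //; apply: adjoin_ideal.
pose S := saturation P I0.
have hS : ideal S by apply: saturation_ideal => //; apply: adjoin_ideal.
have [|||n0 /(_ n0 (leqnn _)) stab] := dcc_above_minimal hP hmin hS
    (@saturation_saturated P _ hP) (fun z => @saturation_sub P I0 z hP) hD.
- by move=> n; apply: saturation_saturated.
- by move=> n z [s [hs [c hc]]]; exists s; split=> //; exists c; apply: decJ.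
- move=> n z [s [hs [c hc]]]; exists s; split=> //; exists c.
  by apply: saturation_sub => //; apply: adjoin_sub.
have stepJ z : J n0 z -> exists s u, [/\ ~ P s, J n0 u & J n0.+1 (s * z - x * u)].
  move=> hz; have [|s [hs [c hc]]] := stab z.
    by apply: saturation_sub => //; apply: adjoin_sub.
  exists s, c; split=> //; last by rewrite [x * _]mulrC.
  apply: (satJ _ x) => //; rewrite mulrC.
  by apply: (idealBr (hJ _) (decJ _ _ hc)); apply: idealM.
have iterJ z n : J n0 z ->
    exists s u, [/\ ~ P s, J n0 u & J n0.+1 (s * z - x ^+ n * u)].
  move=> hz; elim: n => [|n [s [u [hs hu h]]]].
    by exists 1, z; split=> //; rewrite expr0 subrr; apply: ideal0.
  have [t [v [ht hv h']]] := stepJ u hu.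
  exists (t * s), v; split=> //; first exact: primeM.
  have -> : t * s * z - x ^+ n.+1 * v =
      t * (s * z - x ^+ n * u) + x ^+ n * (t * u - x * v) by rewrite exprS; ring.
  by apply: idealD => //; apply: idealM.
(* Nakayama's lemma at [P] now collapses the chain at [n0] *)
have : J n0.+1 (y ^+ n0).
  apply: (krull_intersection noethB hP (hJ _) _ Px) => [s a hs|n].
    by apply: satJ; apply: nPQ.
  have [|s [u [hs _ h]]] := iterJ (y ^+ n0) n; last by exists s, u.
  by apply: saturation_sub => //; apply: adjoin_gen.
move=> [s [hs [c]]].
have -> : s * y ^+ n0 - c * y ^+ n0.+1 = (s - c * y) * y ^+ n0.
  by rewrite exprS; ring.
have [_ _ pQ0] := hQ0; case/pQ0 => [/Q0Q h|/(prime_exp hQ0) //].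
by apply: hs; apply: (idealBl Qi h); apply: idealM.
Qed.

Fixpoint prime_chain n (Q P : B -> Prop) : Prop :=
  match n with
  | 0 => forall x, Q x <-> P x
  | n'.+1 => exists P1, [/\ prime_ideal P1, forall x, P1 x -> P x,
      exists x, P x /\ ~ P1 x & prime_chain n' Q P1]
  end.

Lemma prime_chain_sub n Q P x : prime_chain n Q P -> Q x -> P x.
Proof.
elim: n P => [|n IH] P /=; first by move=> h /h.
by move=> [P1 [_ h _ /IH h']] /h' /h.
Qed.

(** Descending from the top, the principal ideal theorem replaces each prime of
    the chain that misses [x] by another one that contains it. *)
Lemma prime_chain_through n Q P x : prime_ideal Q -> prime_ideal P ->
  prime_chain n.+1 Q P -> P x ->
  exists Q', [/\ prime_ideal Q', Q' x, forall z, Q z -> Q' z,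
    exists z, Q' z /\ ~ Q z & prime_chain n Q' P].
Proof.
move=> hQ; elim: n P => [|n IH] P hP.
  move=> [P1 [hP1 P1P [z [hz nz]] h]] Px; exists P; split=> //.
    by move=> t /h /P1P.
  by exists z; split=> // /h.
move=> [P1 [hP1 P1P ex1 ch1]] Px.
case: (pselect (P1 x)) => [P1x|nP1x].
  have [Q' [hQ' Q'x QQ' exQ ch]] := IH P1 hP1 ch1 P1x.
  by exists Q'; split=> //; exists P1.
have [P2 [hP2 P2P1 [y [P1y nP2y]] ch2]] := ch1.
have [P' [hP' P2P' P'x P'P exP]] :=
  principal_ideal_theorem hP2 hP1 hP P2P1 P1P Px nP1x P1y nP2y.
have [|Q' [hQ' Q'x QQ' exQ ch]] := IH P' hP' _ P'x.
  by exists P2; split=> //; exists x; split=> // /P2P1.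
by exists Q'; split=> //; exists P'.
Qed.

End PrincipalIdealTheorem.

(** * Regular systems of parameters *)

Section RegularParameters.
Variables (L : comNzRingType) (mm : L -> Prop) (d : nat) (g : 'I_d -> L).
Hypotheses (noethL : noetherian L) (locL : local_ring mm).
Hypotheses (chainL : has_prime_chain L d) (mmE : forall x, mm x <-> Defs.span g x).
Implicit Types (I J P Q W : L -> Prop) (a b c x y z : L) (S : {set 'I_d}).
Implicit Types (e : 'I_d -> nat).

Lemma ideal_ext I J : (forall x, I x <-> J x) -> I = J.
Proof. by move=> h; apply/funext => x; apply/propext. Qed.

Lemma mm_ideal : ideal mm. Proof. by case: locL => -[]. Qed.

Lemma mm_neq1 : ~ mm 1. Proof. by case: locL => -[]. Qed.

Lemma mm_proper I x : ideal I -> ~ I 1 -> I x -> mm x.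
Proof.
move=> hI nI1 hx; have [P [hP IP]] := maximal_above noethL hI nI1.
by case: locL => _ /(_ P hP x) [] + _; apply; apply: IP.
Qed.

Lemma local_unit u : ~ mm u -> exists v, v * u = 1.
Proof.
move=> nu; apply: contrapT => h; apply: nu.
apply: (@mm_proper (adjoin (@zero_ideal L) u)).
- by apply: adjoin_ideal; apply: zero_idealP.
- by move=> [c /eqP]; rewrite subr_eq0 => /eqP hc; apply: h; exists c.
- by apply: adjoin_gen; apply: zero_idealP.
Qed.

Lemma mm_prime : prime_ideal mm.
Proof.
split; [exact: mm_ideal|exact: mm_neq1|] => a b hab.
case: (pselect (mm a)) => [|/local_unit[v hv]]; [by left|right].
by rewrite -[b]mul1r -hv -mulrA; apply: idealM hab; apply: mm_ideal.
Qed.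

Lemma mm_saturated W : ideal W -> saturated mm W.
Proof.
move=> hW s a /local_unit[v hv] h; rewrite -[a]mul1r -hv -mulrA.
exact: idealM.
Qed.

Lemma krull_local W x z : ideal W -> mm x ->
  (forall n, exists u, W (z - x ^+ n * u)) -> W z.
Proof.
move=> hW hx h; apply: (krull_intersection noethL mm_prime hW _ hx).
  by move=> s a; apply: mm_saturated.
by move=> n; have [u hu] := h n; exists 1, u; rewrite mul1r; split=> //; apply: mm_neq1.
Qed.

Lemma prime_sub_mm P x : prime_ideal P -> P x -> mm x.
Proof. by move=> [hP P1 _]; apply: mm_proper. Qed.

Definition pow_span e S : L -> Prop :=
  fun z => exists c : 'I_d -> L, z = \sum_(i in S) c i * g i ^+ e i.

Notation gen := (pow_span (fun=> 1%N)).

Lemma pow_span_ideal e S : ideal (pow_span e S).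
Proof.
split.
- by exists (fun=> 0); rewrite big1 // => i _; rewrite mul0r.
- move=> x y [c ->] [c' ->]; exists (fun i => c i + c' i).
  by rewrite -big_split; apply: eq_bigr => i _; rewrite mulrDl.
- move=> a x [c ->]; exists (fun i => a * c i).
  by rewrite mulr_sumr; apply: eq_bigr => i _; rewrite mulrA.
Qed.

Lemma pow_span_min e S J x : ideal J -> (forall i, i \in S -> J (g i ^+ e i)) ->
  pow_span e S x -> J x.
Proof.
move=> hJ h [c ->]; apply: ideal_sum => // i hi.
by apply: idealM => //; apply: h.
Qed.

Lemma pow_span_gen e S i : i \in S -> pow_span e S (g i ^+ e i).
Proof.
move=> hi; exists (fun j => (j == i)%:R); rewrite (bigD1 i) //= eqxx mul1r.
by rewrite big1 ?addr0 // => j /andP[_ /negPf->]; rewrite mul0r.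
Qed.

Lemma pow_spanU1 e S i : i \notin S ->
  pow_span e (i |: S) = adjoin (pow_span e S) (g i ^+ e i).
Proof.
move=> hi; apply: ideal_ext => x; split.
  move=> [c ->]; exists (c i); exists c; rewrite big_setU1 //=.
  by rewrite addrC addrK.
apply: adjoin_min; first exact: pow_span_ideal.
  move=> y [c ->]; apply: ideal_sum; first exact: pow_span_ideal.
  move=> j hj; apply: idealM; first exact: pow_span_ideal.
  by apply: pow_span_gen; rewrite in_setU1 hj orbT.
by apply: pow_span_gen; rewrite setU11.
Qed.

Lemma eq_pow_span e e' S : {in S, e =1 e'} -> pow_span e S = pow_span e' S.
Proof.
move=> h; apply: ideal_ext => x; split=> -[c ->]; exists c;
  by apply: eq_bigr => i hi; rewrite h.
Qed.

Lemma pow_span0 e : pow_span e set0 = @zero_ideal L.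
Proof.
apply: ideal_ext => x; split=> [[c ->]|->]; first by rewrite /zero_ideal big_set0.
by apply: ideal0; apply: pow_span_ideal.
Qed.

Lemma genT : gen setT = mm.
Proof.
apply: ideal_ext => x; split.
  move=> [c ->]; apply/mmE; exists c.
  by rewrite big_mkcond; apply: eq_bigr => i _; rewrite in_setT expr1.
move/mmE => [c ->]; exists c.
by rewrite [RHS]big_mkcond; apply: eq_bigr => i _; rewrite in_setT expr1.
Qed.

Lemma mm_gen i : mm (g i).
Proof. by rewrite -genT -[g i]expr1; apply: pow_span_gen; rewrite in_setT. Qed.

(** The dimension of [L / I] is at least [n]; chains are taken up to [mm], which
    costs nothing in a local ring. *)
Definition dim_ge I n : Prop :=
  exists Q, [/\ prime_ideal Q, forall x, I x -> Q x & prime_chain n Q mm].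

Lemma dim_ge_adjoin I x n : ideal I -> dim_ge I n.+1 -> mm x -> dim_ge (adjoin I x) n.
Proof.
move=> hI [Q [hQ IQ ch]] hx.
have [Q' [hQ' Q'x QQ' _ ch']] := prime_chain_through noethL hQ mm_prime ch hx.
exists Q'; split=> //; apply: adjoin_min => //; first by case: hQ'.
by move=> z /IQ /QQ'.
Qed.

Lemma dim_ge0 : dim_ge (@zero_ideal L) d.
Proof.
have [P hP] := chainL; case: d hP => [|n] hP.
  exists mm; split=> //; first exact: mm_prime.
  by move=> x ->; apply: ideal0; apply: mm_ideal.
exists (P 0%N); split; first exact: spec_prime.
  by move=> x ->; apply: ideal0; case: (spec_prime (P 0%N)).
exists (P n); split; first exact: spec_prime.
- by move=> x; apply: prime_sub_mm; apply: spec_prime.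
- have [_ [x [hx nx]]] := hP n (leqnn _); exists x; split=> //.
  by apply: prime_sub_mm hx; apply: spec_prime.
- have : forall i, (i < n)%N -> (forall x, P i x -> P i.+1 x) /\
    (exists x, P i.+1 x /\ ~ P i x) by move=> i hi; apply: hP; rewrite ltnS ltnW.
  elim: n {hP} => [|n IH] hP //=; exists (P n).
  have [h1 h2] := hP n (leqnn _).
  split=> //; first exact: spec_prime.
  by apply: IH => i hi; apply: hP; rewrite ltnS ltnW.
Qed.

Lemma dim_ge_gen S : dim_ge (gen S) (d - #|S|).
Proof.
move: {2}#|S| (erefl #|S|) => n; elim: n S => [|n IH] S hS.
  rewrite hS subn0; move/cards0_eq: hS => ->; rewrite pow_span0; exact: dim_ge0.
have [i hi] : exists i, i \in S by apply/set0Pn; rewrite -card_gt0 hS.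
have nS : i \notin S :\ i by rewrite setD11.
rewrite -(setD1K hi) pow_spanU1 // expr1 cardsU1 nS add1n.
have hc : #|S :\ i| = n by move: hS; rewrite (cardsD1 i) hi => -[].
apply: dim_ge_adjoin; [exact: pow_span_ideal| |exact: mm_gen].
have hd : (n < d)%N by rewrite -hS -[X in (_ <= X)%N](card_ord d); apply: max_card.
by have := IH _ hc; rewrite hc subnS prednK // subn_gt0.
Qed.

Lemma dim_ge_le S n : dim_ge (gen S) n -> (n <= d - #|S|)%N.
Proof.
move: {2}(d - #|S|)%N (erefl (d - #|S|)%N) => k; elim: k S n => [|k IH] S n hk.
  have ST : S = setT.
    apply/eqP; rewrite eqEcard subsetT cardsT card_ord.
    by rewrite -subn_eq0 hk.
  rewrite ST genT => -[Q [hQ mQ ch]]; case: n ch => // n [P1 [_ _ [x [hx nx]] ch]].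
  by case: nx; apply: (prime_chain_sub ch); apply: mQ.
case: n => [//|n] h.
have [i hi] : exists i, i \notin S.
  apply/existsP; rewrite -negb_forall; apply/negP => /forallP hS.
  move: hk; suff -> : S = setT by rewrite cardsT card_ord subnn.
  by apply/setP => i; rewrite hS in_setT.
have hk' : (d - #|i |: S|)%N = k by rewrite cardsU1 hi add1n subnS hk.
rewrite hk ltnS -hk'; apply: IH => //; rewrite pow_spanU1 // expr1.
by apply: dim_ge_adjoin => //; [exact: pow_span_ideal|exact: mm_gen].
Qed.

Lemma gen_notin S i : i \notin S -> ~ gen S (g i).
Proof.
move=> hi hg; have lt : (d - #|i |: S| < d - #|S|)%N.
  by have := max_card (mem (i |: S)); rewrite card_ord cardsU1 hi; lia.
have [Q [hQ SQ ch]] := dim_ge_gen S.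
suff : dim_ge (gen (i |: S)) (d - #|S|) by move/dim_ge_le; rewrite leqNgt lt.
exists Q; split=> // x; rewrite pow_spanU1 //; apply: adjoin_min => //.
  by case: hQ.
by rewrite expr1; apply: SQ.
Qed.

Lemma prime_chain_cons n P0 Q P : prime_ideal P0 -> (forall x, P0 x -> Q x) ->
  (exists x, Q x /\ ~ P0 x) -> prime_chain n Q P -> prime_chain n.+1 P0 P.
Proof.
move=> hP0 P0Q exQ; elim: n P => [|n IH] P.
  move=> h; exists P0; split=> //; first by move=> x /P0Q /h.
  by have [x [/h hx nx]] := exQ; exists x.
by move=> [P1 [hP1 P1P exP /IH ch]]; exists P1.
Qed.

(** A regular local ring modulo part of a regular system of parameters is a
    domain.  Descending induction: modulo [gen S], the element [g i] generates
    a prime that is not minimal, because the dimension drops; a prime [Q]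
    strictly below satisfies [Q = g i * Q], and so vanishes. *)
Lemma gen_prime S : prime_ideal (gen S).
Proof.
move: {2}(d - #|S|)%N (erefl (d - #|S|)%N) => k; elim: k S => [|k IH] S hk.
  suff -> : S = setT by rewrite genT; apply: mm_prime.
  by apply/eqP; rewrite eqEcard subsetT cardsT card_ord -subn_eq0 hk.
have [i hi] : exists i, i \notin S.
  apply/existsP; rewrite -negb_forall; apply/negP => /forallP hS.
  move: hk; suff -> : S = setT by rewrite cardsT card_ord subnn.
  by apply/setP => i; rewrite hS in_setT.
have hk' : (d - #|i |: S|)%N = k by rewrite cardsU1 hi add1n subnS hk.
have hPi := IH _ hk'.
have [Q [hQ SQ]] := dim_ge_gen S; rewrite hk => ch.
have [Qi Q1 Qp] := hQ.
have iS_min J : ideal J -> (forall x, gen S x -> J x) -> J (g i) ->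
    forall x, gen (i |: S) x -> J x.
  by move=> hJ SJ Jx; rewrite pow_spanU1 // expr1; apply: adjoin_min.
have nQx : ~ Q (g i).
  move=> Qx; have : dim_ge (gen (i |: S)) k.+1.
    by exists Q; split=> //; apply: iS_min.
  by move/dim_ge_le; rewrite hk' ltnn.
have [Q' [hQ' Q'x QQ' exQ ch']] := prime_chain_through noethL hQ mm_prime ch (mm_gen i).
have iSQ' : forall x, gen (i |: S) x -> Q' x.
  by apply: iS_min => //; [case: hQ'|move=> x /SQ /QQ'].
have Q'iS x : Q' x -> gen (i |: S) x.
  move=> hx; apply: contrapT => nx.
  have : dim_ge (gen (i |: S)) k.+1.
    exists (gen (i |: S)); split=> //; apply: prime_chain_cons ch' => //.
    by exists x.
  by move/dim_ge_le; rewrite hk' ltnn.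
suff -> : gen S = Q by [].
apply: ideal_ext => x; split; first exact: SQ.
move=> Qx; apply: (krull_local (pow_span_ideal _ _) (mm_gen i)) => n.
suff [u [_ h]] : exists u, Q u /\ gen S (x - g i ^+ n * u) by exists u.
elim: n => [|n [u [Qu h]]].
  exists x; rewrite expr0 mul1r subrr; split=> //; apply: ideal0; apply: pow_span_ideal.
have := Q'iS u (QQ' u Qu); rewrite pow_spanU1 // expr1 => -[c hc].
exists c; split.
  case: (Qp c (g i)) => //; exact: (idealBr Qi (SQ _ hc)).
have -> : x - g i ^+ n.+1 * c = (x - g i ^+ n * u) + g i ^+ n * (u - c * g i).
  by rewrite exprSr; ring.
by apply: idealD => //; [exact: pow_span_ideal|apply: idealM => //; apply: pow_span_ideal].
Qed.

(** Powers of regular parameters form regular sequences in any order.  Lower one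
    exponent at a time, down to the exponents 1 of [gen_prime]: if
    [g i * u = t * g j ^ k.+2] modulo the other generators, then [u] is a
    multiple [v * g j ^ k.+1], and cancelling [g j ^ k.+1] leaves a relation in
    which [g j] has exponent 1. *)
Lemma pow_span_regular e S i u : (forall j, (0 < e j)%N) -> i \notin S ->
  pow_span e S (g i * u) -> pow_span e S u.
Proof.
move: {2}(\sum_(j in S) (e j).-1)%N (leqnn (\sum_(j in S) (e j).-1)%N) => N.
elim: N e S i u => [|N IH] e S i u.
  rewrite leqn0 sum_nat_eq0 => /forallP hS he hi.
  rewrite (@eq_pow_span e (fun=> 1%N)).
    by have [_ _ hp] := gen_prime S; move/hp => [/(gen_notin hi)|].
  move=> j hj; have := hS j; rewrite hj; have := he j.
  by case: (e j) => // n _ /eqP /= ->.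
move=> hN he hi.
case: (boolP [forall j in S, e j == 1%N]) => [/forallP h1|].
  rewrite (@eq_pow_span e (fun=> 1%N)).
    by have [_ _ hp] := gen_prime S; move/hp => [/(gen_notin hi)|].
  by move=> j hj; have := h1 j; rewrite hj => /eqP.
rewrite negb_forall => /existsP[j]; rewrite negb_imply => /andP[hj e1].
have nS : j \notin S :\ j by rewrite setD11.
have hiS : i \notin S :\ j by rewrite in_setD1 (negPf hi) andbF.
have [k ek] : exists k, e j = k.+2.
  by move: e1 (he j); case: (e j) => [|[|k]] // _ _; exists k.
pose ee q := fun l => if l == j then q else e l.
have eeS q : pow_span (ee q) (S :\ j) = pow_span e (S :\ j).
  by apply: eq_pow_span => l; rewrite in_setD1 /ee => /andP[/negPf->].
have eeE q : pow_span (ee q) S = adjoin (pow_span e (S :\ j)) (g j ^+ q).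
  by rewrite -{1}(setD1K hj) pow_spanU1 // eeS /ee eqxx.
have eE : pow_span e S = adjoin (pow_span e (S :\ j)) (g j ^+ k.+2).
  by rewrite -{1}(setD1K hj) pow_spanU1 // ek.
have sumE q : (\sum_(l in S) (ee q l).-1 =
    q.-1 + \sum_(l in S :\ j) (e l).-1)%N.
  rewrite (big_setD1 j) //= {1}/ee eqxx; congr addn.
  by apply: eq_bigr => l; rewrite in_setD1 /ee => /andP[/negPf->].
have hN' : (k.+1 + \sum_(l in S :\ j) (e l).-1 <= N.+1)%N.
  by move: hN; rewrite (big_setD1 j) //= ek.
have eepos q : (0 < q)%N -> forall l, (0 < ee q l)%N.
  by move=> hq l; rewrite /ee; case: eqP.
have IHq q v : (0 < q <= k.+1)%N -> pow_span (ee q) S (g i * v) -> pow_span (ee q) S v.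
  move=> /andP[q0 qk]; apply: IH hi; last exact: eepos.
  by rewrite sumE; move: hN' qk q0; case: q => // q; lia.
set W := pow_span e (S :\ j) in eE eeE.
have hW : ideal W by apply: pow_span_ideal.
have regj n v : W (g j ^+ n * v) -> W v.
  elim: n => [|n IHn]; first by rewrite expr0 mul1r.
  rewrite exprS -mulrA => h; apply: IHn; apply: IH h => //.
  by move: hN'; lia.
rewrite eE => -[t ht].
have : pow_span (ee k.+1) S u.
  apply: IHq; first by rewrite /= leqnn.
  rewrite eeE; exists (t * g j); move: ht.
  by rewrite [g j ^+ k.+2]exprS mulrA.
rewrite eeE => -[v hv].
have : W (g i * v - g j * t).
  apply: (regj k.+1).
  have -> : g j ^+ k.+1 * (g i * v - g j * t) =
      (g i * u - t * g j ^+ k.+2) - g i * (u - v * g j ^+ k.+1).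
    by rewrite !exprS; ring.
  by apply: idealB => //; apply: idealM.
move=> h1; have : pow_span (ee 1%N) S v.
  apply: IHq => //; rewrite eeE; exists t; rewrite expr1.
  by rewrite [t * _]mulrC.
rewrite eeE expr1 => -[w hw]; exists w.
have -> : u - w * g j ^+ k.+2 =
    (u - v * g j ^+ k.+1) + g j ^+ k.+1 * (v - w * g j) by rewrite !exprS; ring.
by apply: idealD => //; apply: idealM.
Qed.

Lemma pow_span_regular_exp e S i n u : (forall j, (0 < e j)%N) -> i \notin S ->
  pow_span e S (g i ^+ n * u) -> pow_span e S u.
Proof.
move=> he hi; elim: n u => [|n IH] u; first by rewrite expr0 mul1r.
by rewrite exprSr -mulrA => /IH; apply: pow_span_regular.
Qed.

End RegularParameters.

(** * Flatness of Frobenius on regular local rings *)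

Section Frobenius.
Variables (B : comNzRingType) (p : nat).
Hypothesis charB : p \in [pchar B].
Implicit Types (I J : B -> Prop) (a b c r x y z : B).

Lemma p_gt0 : (0 < p)%N.
Proof. exact: prime_gt0 (pcharf_prime charB). Qed.

Lemma frobD x y : (x + y) ^+ p = x ^+ p + y ^+ p.
Proof. by rewrite -!(pFrobenius_autE charB) rmorphD. Qed.

Lemma frobB x y : (x - y) ^+ p = x ^+ p - y ^+ p.
Proof. by rewrite -!(pFrobenius_autE charB) rmorphB. Qed.

Lemma frobN x : (- x) ^+ p = - x ^+ p.
Proof. by rewrite -!(pFrobenius_autE charB) rmorphN. Qed.

Lemma frob0 : 0 ^+ p = 0 :> B.
Proof. by rewrite expr0n; case: p p_gt0. Qed.

Lemma frob_sum (K : Type) (s : seq K) (P : pred K) (F : K -> B) :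
  (\sum_(k <- s | P k) F k) ^+ p = \sum_(k <- s | P k) F k ^+ p.
Proof.
rewrite -(pFrobenius_autE charB) rmorph_sum; apply: eq_bigr => k _.
by rewrite /= pFrobenius_autE.
Qed.

(** The Frobenius power [I^[p]], generated by the [p]-th powers of elements
    of [I]. *)
Definition frob_power I : B -> Prop := fun z =>
  exists (K : finType) (s c : K -> B),
    (forall k, I (c k)) /\ z = \sum_k s k * c k ^+ p.

Lemma frob_power_ideal I : ideal (frob_power I).
Proof.
split.
- by exists void, (fun=> 0), (fun=> 0); split; [case|rewrite big_pred0 //; case].
- move=> x y [K [s [c [hc ->]]]] [K' [s' [c' [hc' ->]]]].
  exists (K + K')%type, (fun k => match k with inl k => s k | inr k => s' k end),
    (fun k => match k with inl k => c k | inr k => c' k end).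
  by split; [case|rewrite big_sumType].
- move=> a x [K [s [c [hc ->]]]]; exists K, (fun k => a * s k), c; split=> //.
  by rewrite mulr_sumr; apply: eq_bigr => k _; rewrite mulrA.
Qed.

Lemma frob_power_gen I x : I x -> frob_power I (x ^+ p).
Proof. by exists 'I_1, (fun=> 1), (fun=> x); split=> //; rewrite big_ord1 mul1r. Qed.

Lemma frob_power_min I J z : ideal J -> (forall x, I x -> J (x ^+ p)) ->
  frob_power I z -> J z.
Proof.
move=> hJ h [K [s [c [hc ->]]]]; apply: ideal_sum => // k _.
by apply: idealM => //; apply: h.
Qed.

Lemma frob_power_sub I J z : (forall x, I x -> J x) -> frob_power I z -> frob_power J z.
Proof.
move=> h; apply: frob_power_min; first exact: frob_power_ideal.
by move=> x /h; apply: frob_power_gen.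
Qed.

(** The inclusion of [I^[p] : b^p] in [(I : b)^[p]] is the form that flatness of
    Frobenius takes on the cyclic module [B / I]. *)
Definition frob_colon I := forall b r,
  frob_power I (r * b ^+ p) -> frob_power (colon I b) r.

(** Every relation modulo [I^[p]] between [p]-th powers is a combination of
    Frobenius powers of relations modulo [I]. *)
Definition frob_relations I := forall (K : finType) (r b : K -> B),
  frob_power I (\sum_k r k * b k ^+ p) ->
  exists (H : finType) (s : H -> B) (c : H -> K -> B),
    (forall k, r k = \sum_h s h * c h k ^+ p) /\
    forall h, I (\sum_k c h k * b k).

(** Eliminate the elements [b k] one at a time, adding the remaining ones to
    the ideal. *)
Lemma frob_relations_of_colon I : ideal I ->
  (forall J, ideal J -> (forall x, I x -> J x) -> frob_colon J) ->
  frob_relations I.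
Proof.
move=> hI hC K r b.
have [D hD] : exists D : {set K}, forall k, k \notin D -> r k = 0.
  by exists setT => k; rewrite in_setT.
move: {2}#|D| (erefl #|D|) => n; elim: n D r hD => [|n IH] D r hD cD h.
  exists void, (fun=> 0), (fun _ _ => 0); split; last by case.
  move=> k; have kD : k \notin D by move/cards0_eq: cD => ->; rewrite in_set0.
  by rewrite hD // big_pred0 //; case.
have [k0 k0D] : exists k0, k0 \in D by apply/set0Pn; rewrite -card_gt0 cD.
pose J z := exists c : K -> B, (forall k, k \notin D :\ k0 -> c k = 0) /\
  I (z - \sum_k c k * b k).
have hJ : ideal J.
  split.
  - exists (fun=> 0); split=> //; rewrite big1 ?subr0; first exact: ideal0.
    by move=> k _; rewrite mul0r.
  - move=> x y [c [hc hx]] [c' [hc' hy]]; exists (fun k => c k + c' k); split.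
      by move=> k hk; rewrite hc // hc' // addr0.
    have -> : \sum_k (c k + c' k) * b k = \sum_k c k * b k + \sum_k c' k * b k.
      by rewrite -big_split; apply: eq_bigr => k _; rewrite mulrDl.
    by rewrite opprD addrACA; apply: idealD.
  - move=> a x [c [hc hx]]; exists (fun k => a * c k); split.
      by move=> k hk; rewrite hc // mulr0.
    have -> : \sum_k a * c k * b k = a * \sum_k c k * b k.
      by rewrite mulr_sumr; apply: eq_bigr => k _; rewrite mulrA.
    by rewrite -mulrBr; apply: idealM.
have IJ x : I x -> J x.
  move=> hx; exists (fun=> 0); split=> //; rewrite big1 ?subr0 // => k _.
  by rewrite mul0r.
have Jb k : k \in D :\ k0 -> J (b k).
  move=> hk; exists (fun l => (l == k)%:R); split.
    by move=> l hl; case: eqP => // lk; rewrite lk hk in hl.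
  rewrite (bigD1 k) //= eqxx mul1r big1 ?addr0 ?subrr; first exact: ideal0.
  by move=> l /negPf->; rewrite mul0r.
have hr0 : frob_power J (r k0 * b k0 ^+ p).
  have := frob_power_sub IJ h; rewrite (bigD1 k0) //= => h'.
  have -> : r k0 * b k0 ^+ p = (r k0 * b k0 ^+ p + \sum_(i | i != k0) r i * b i ^+ p)
      - \sum_(i | i != k0) r i * b i ^+ p by rewrite addrK.
  apply: idealB h' _; first exact: frob_power_ideal.
  apply: ideal_sum; first exact: frob_power_ideal.
  move=> k kk0; case: (boolP (k \in D)) => hk; last first.
    by rewrite hD // mul0r; apply: ideal0; apply: frob_power_ideal.
  apply: idealM; first exact: frob_power_ideal.
  by apply: frob_power_gen; apply: Jb; rewrite in_setD1 kk0.
have [H [s [c [hc rE]]]] := hC J hJ IJ _ _ hr0.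
have [e he] := choice hc.
pose f h k := if k == k0 then c h else - e h k.
have fI h' : I (\sum_k f h' k * b k).
  have [he1 he2] := he h'; rewrite (bigD1 k0) //= {1}/f eqxx.
  rewrite (eq_bigr (fun k => - (e h' k * b k))); last first.
    by move=> k /negPf kk0; rewrite /f kk0 mulNr.
  rewrite sumrN; move: he2; rewrite (bigD1 k0) //= he1 ?mul0r ?add0r //.
  by rewrite setD11.
pose r' k := r k - \sum_h s h * f h k ^+ p.
have [||| H' [s' [c' [r'E c'I]]]] := IH (D :\ k0) r'.
- move=> k; rewrite in_setD1 negb_and negbK /r' /f.
  case: eqP => [-> _|_ /= hk]; first by rewrite rE subrr.
  rewrite hD // sub0r big1 ?oppr0 // => h' _.
  by rewrite (he h').1 ?oppr0 ?frob0 ?mulr0 // in_setD1 negb_and hk orbT.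
- by move: cD; rewrite (cardsD1 k0) k0D => -[].
- have -> : \sum_k r' k * b k ^+ p =
     \sum_k r k * b k ^+ p - \sum_h s h * (\sum_k f h k * b k) ^+ p.
    rewrite [X in _ = _ - X](eq_bigr (fun h => \sum_k s h * f h k ^+ p * b k ^+ p)).
      rewrite exchange_big -sumrB; apply: eq_bigr => k _.
      by rewrite /r' mulrBl mulr_suml.
    by move=> h' _; rewrite frob_sum mulr_sumr; apply: eq_bigr => k _;
       rewrite exprMn mulrA.
  apply: idealB => //; first exact: frob_power_ideal.
  apply: ideal_sum => [|h' _]; first exact: frob_power_ideal.
  by apply: idealM; [exact: frob_power_ideal|exact: frob_power_gen].
exists (H + H')%type, (fun k => match k with inl k => s k | inr k => s' k end),
    (fun k => match k with inl k => f k | inr k => c' k end).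
split; last by case.
by move=> k; rewrite big_sumType /= -r'E /r' addrC subrK.
Qed.

End Frobenius.

Section LocalCriterion.
Variables (L : comNzRingType) (p : nat) (mm : L -> Prop).
Hypotheses (charL : p \in [pchar L]) (noethL : noetherian L) (locL : local_ring mm).
Variables (x : L) (G : L -> Prop).
Hypotheses (mmx : mm x) (idG : ideal G).
Hypothesis regx : forall u, frob_power p G (x ^+ p * u) -> frob_power p G u.
Hypothesis colonx : forall I, ideal I -> (forall z, G z -> I z) -> I x ->
  frob_colon p I.
Implicit Types (I J : L -> Prop).

Lemma relationsx I : ideal I -> (forall z, G z -> I z) -> I x ->
  frob_relations p I.
Proof.
move=> hI GI Ix; apply: frob_relations_of_colon => // J hJ IJ.
by apply: colonx => // [z /GI /IJ|]; last exact: IJ.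
Qed.

(** The case [b = x].  Writing [x^p * u] as a combination of [a k ^ p] with [a k]
    in [I] gives a relation modulo [x], hence relations
    [sum_k c h k * a k = w h * x] modulo [G]; the factor [x^p] then cancels. *)
Lemma frob_colon_param I u : ideal I -> (forall z, G z -> I z) ->
  frob_power p I (u * x ^+ p) -> frob_power p (colon I x) u.
Proof.
move=> hI GI [K [r [a [aI uE]]]].
have hGx : ideal (adjoin G x) by apply: adjoin_ideal.
have [||| H [s [c [rE hc]]]] := @relationsx (adjoin G x) hGx _ _ K r a.
- exact: adjoin_sub.
- exact: adjoin_gen.
- rewrite -uE; apply: idealM; first exact: frob_power_ideal.
  by apply: frob_power_gen; apply: adjoin_gen.
have [w hw] := choice hc.
have hid := @frob_power_ideal L p.
have : frob_power p G (u - \sum_h s h * w h ^+ p).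
  apply: regx.
  have -> : x ^+ p * (u - \sum_h s h * w h ^+ p) =
      \sum_h s h * (\sum_k c h k * a k - w h * x) ^+ p.
    rewrite mulrBr mulrC uE mulr_sumr.
    rewrite (eq_bigr (fun k => \sum_h s h * c h k ^+ p * a k ^+ p)); last first.
      by move=> k _; rewrite rE mulr_suml.
    rewrite exchange_big -sumrB; apply: eq_bigr => h _.
    rewrite (frobB charL) (frob_sum charL) mulrBr mulr_sumr exprMn; congr (_ - _).
      by apply: eq_bigr => k _; rewrite exprMn mulrA.
    by ring.
  by apply: ideal_sum => // h _; apply: idealM => //; apply: frob_power_gen.
move=> h; apply: (idealBl (hid _)).
  apply: frob_power_sub h => z /GI hz; rewrite /colon; exact: idealMr.
apply: ideal_sum => // k _; apply: idealM => //; apply: frob_power_gen.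
apply: (idealBr hI (GI _ (hw k))); apply: ideal_sum => // l _; exact: idealM.
Qed.

(** Induction on [n], along the exact sequence
    [0 -> L / (I : x) -> L / I -> L / (I + (x)) -> 0]. *)
Lemma frob_colon_power n I : ideal I -> (forall z, G z -> I z) -> I (x ^+ n) ->
  frob_colon p I.
Proof.
elim: n I => [|n IH] I hI GI Ix b r hr.
  rewrite expr0 in Ix; rewrite -[r]mulr1 -(expr1n _ p).
  apply: idealM; first exact: frob_power_ideal.
  by apply: frob_power_gen; rewrite /colon mul1r -[b]mulr1; apply: idealM.
have hIx : ideal (adjoin I x) by apply: adjoin_ideal.
have [|||H [s [c [cI rE]]]] := @colonx (adjoin I x) hIx _ _ b r.
- by move=> z /GI; apply: adjoin_sub.
- exact: adjoin_gen.
- by apply: frob_power_sub hr => z; apply: adjoin_sub.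
have [w hw] := choice cI.
have hid := @frob_power_ideal L p.
have hcol := colon_ideal x hI.
have Icol z : I z -> colon I x z by move=> hz; apply: idealMr.
have : frob_power p (colon I x) (\sum_h s h * w h ^+ p).
  apply: frob_colon_param => //; rewrite mulr_suml.
  rewrite (eq_bigr (fun h => s h * (c h * b) ^+ p - s h * (c h * b - w h * x) ^+ p)).
    rewrite sumrB; apply: idealB => //.
      suff -> : \sum_h s h * (c h * b) ^+ p = r * b ^+ p by [].
      by rewrite rE mulr_suml; apply: eq_bigr => h _; rewrite exprMn mulrA.
    by apply: ideal_sum => // h _; apply: idealM => //; apply: frob_power_gen.
  by move=> h _; rewrite (frobB charL) !exprMn; ring.
move=> hsw; have : frob_relations p (colon I x).
  apply: frob_relations_of_colon => // J hJ cJ; apply: IH => //.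
    by move=> z /GI /Icol /cJ.
  by apply: cJ; rewrite /colon -exprSr.
move=> /(_ H s w hsw) [E [t [f [sE fI]]]].
have -> : r = \sum_e t e * (\sum_h f e h * c h) ^+ p.
  rewrite rE (eq_bigr (fun h => \sum_e t e * f e h ^+ p * c h ^+ p)); last first.
    by move=> h _; rewrite sE mulr_suml.
  rewrite exchange_big; apply: eq_bigr => e _.
  by rewrite (frob_sum charL) mulr_sumr; apply: eq_bigr => h _; rewrite exprMn mulrA.
apply: ideal_sum => // e _; apply: idealM => //; apply: frob_power_gen.
have -> : colon I b (\sum_h f e h * c h) =
    I (\sum_h f e h * (c h * b - w h * x) + (\sum_h f e h * w h) * x).
  rewrite /colon; congr I; rewrite !mulr_suml -big_split /=.
  by apply: eq_bigr => h _; ring.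
apply: idealD => //; last exact: fI.
by apply: ideal_sum => // h _; apply: idealM.
Qed.

(** The local criterion of flatness for Frobenius: flatness modulo [x]
    together with regularity of [x ^ p] gives flatness.  A general ideal [I] is
    approximated by ideals containing a power of [x], and Krull's intersection
    theorem concludes. *)
Lemma frob_local_criterion I : ideal I -> (forall z, G z -> I z) -> frob_colon p I.
Proof.
move=> hI GI b r hr; have hid := @frob_power_ideal L p.
apply: (krull_local noethL locL (hid _) mmx) => N.
pose J := adjoin I (x ^+ N * b).
have hJ : ideal J by apply: adjoin_ideal.
have [|n hn] := @torsion_separation L noethL J x b N hJ.
  exact: adjoin_gen.
pose J' := adjoin J (x ^+ n).
have hJ' : ideal J' by apply: adjoin_ideal.
have IJ' z : I z -> J' z by move=> hz; apply: adjoin_sub; apply: adjoin_sub.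
have [|||H [s [c [cJ rE]]]] := @frob_colon_power n J' hJ' _ _ b r.
- by move=> z /GI /IJ'.
- exact: adjoin_gen.
- exact: frob_power_sub hr.
have cJ' h : exists w, colon I b (c h - w * x ^+ N).
  have [w /hn [v hv]] := cJ h; exists v.
  by move: hv; rewrite /colon mulrBl mulrA.
have [w hw] := choice cJ'.
have hxp : (x ^+ N) ^+ p = x ^+ N * x ^+ (N * p.-1).
  by rewrite -exprM -exprD -mulnS prednK // (p_gt0 charL).
exists (\sum_h s h * w h ^+ p * x ^+ (N * p.-1)).
have -> : r - x ^+ N * (\sum_h s h * w h ^+ p * x ^+ (N * p.-1)) =
    \sum_h s h * (c h - w h * x ^+ N) ^+ p.
  rewrite rE mulr_sumr -sumrB; apply: eq_bigr => h _.
  by rewrite (frobB charL) exprMn hxp; ring.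
by apply: ideal_sum => // h _; apply: idealM => //; apply: frob_power_gen.
Qed.

End LocalCriterion.

(** Flatness of Frobenius on a ring, by the equational criterion. *)
Definition frob_flat (B : comNzRingType) (p : nat) := forall (K : finType) (r a : K -> B),
  \sum_k r k * a k ^+ p = 0 ->
  exists (H : finType) (s : H -> B) (c : H -> K -> B),
    (forall k, r k = \sum_h s h * c h k ^+ p) /\
    forall h, \sum_k c h k * a k = 0.

(** Kunz: Frobenius is flat on a regular local ring.  Apply the local criterion
    along a regular system of parameters [g], whose [p]-th powers again form a
    regular sequence; modulo all of [g] the ring is a field. *)
Lemma frob_flat_regular_local (L : comNzRingType) (p : nat) :
  p \in [pchar L] -> regular_local_ring L -> frob_flat L p.
Proof.
move=> charL [noethL [mm [locL [d [[chainL _] [g mmE]]]]]].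
pose gen := pow_span g (fun=> 1%N).
have hid := @frob_power_ideal L p.
have genI S : ideal (gen S) by apply: pow_span_ideal.
have genp S z : frob_power p (gen S) z <-> pow_span g (fun=> p) S z.
  split.
    apply: frob_power_min; first exact: pow_span_ideal.
    move=> y [c ->]; rewrite (frob_sum charL); apply: ideal_sum.
      exact: pow_span_ideal.
    move=> i hi; rewrite exprMn expr1; apply: idealM; first exact: pow_span_ideal.
    exact: (pow_span_gen g (fun=> p)).
  apply: pow_span_min => // i hi; apply: frob_power_gen.
  by rewrite -[g i]expr1; apply: (pow_span_gen g (fun=> 1%N)).
suff main S I : ideal I -> (forall z, gen S z -> I z) -> frob_colon p I.
  move=> K r a h; apply: (@frob_relations_of_colon L p charL (@zero_ideal L)).
  - exact: zero_idealP.
  - move=> J hJ _; apply: (main set0) => // z.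
    by rewrite /gen pow_span0 => ->; apply: ideal0.
  - by rewrite h; apply: ideal0.
move: {2}(d - #|S|)%N (leqnn (d - #|S|)) => n.
elim: n S I => [|n IH] S I.
  move=> hS hI SI b r hr.
  have mI z : mm z -> I z.
    rewrite -(genT mmE) => hz; apply: SI.
    suff -> : S = setT by [].
    by apply/eqP; rewrite eqEcard subsetT cardsT card_ord -subn_eq0 -leqn0.
  case: (pselect (I b)) => [Ib|nIb].
    rewrite -[r]mulr1 -(expr1n _ p).
    by apply: idealM => //; apply: frob_power_gen; rewrite /colon mul1r.
  have [v hv] : exists v, v * b = 1.
    by apply: (local_unit noethL locL) => /mI.
  apply: (@frob_power_sub _ _ I); first by move=> z hz; apply: idealMr.
  suff -> : r = v ^+ p * (r * b ^+ p) by apply: idealM.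
  by rewrite mulrCA -exprMn hv expr1n mulr1.
move=> hS hI SI.
case: (boolP (S == setT)) => [/eqP ST|].
  by apply: (IH S) => //; rewrite ST cardsT card_ord subnn.
rewrite -subTset => /subsetPn[i _ iS].
apply: (@frob_local_criterion L p mm charL noethL locL (g i) (gen S)) => //.
- exact: (mm_gen mmE).
- move=> u /genp h; apply/genp.
  apply: (pow_span_regular_exp noethL locL chainL mmE (fun _ => p_gt0 charL) iS h).
- move=> J hJ SJ Jx; apply: (IH (i |: S)) => //.
    by rewrite cardsU1 iS; move: hS; lia.
  by move=> z; rewrite /gen pow_spanU1 // expr1; apply: adjoin_min.
Qed.

(** * Flatness of Frobenius on regular rings and on polynomial rings *)

Section Localize.
Variables (B L : comNzRingType) (P : spec B) (phi : {rmorphism B -> L}).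
Hypothesis hloc : is_localization P phi.

Let nPM x y : ~ P x -> ~ P y -> ~ P (x * y).
Proof. exact: primeM (spec_prime P). Qed.

Let nP1 : ~ P 1. Proof. by case: (spec_prime P). Qed.

Lemma notin_prod (F : finType) (t : F -> B) (Q : pred F) :
  (forall i, ~ P (t i)) -> ~ P (\prod_(i | Q i) t i).
Proof. by move=> h; elim/big_ind: _ => // x y; apply: nPM. Qed.

Lemma common_denominator (F : finType) (X : F -> L) :
  exists t (Y : F -> B), ~ P t /\ forall i, X i * phi t = phi (Y i).
Proof.
have [_ surj _] := hloc.
have [a ha] := choice (fun i => surj (X i)).
have [s hs] := choice ha.
exists (\prod_i s i), (fun i => a i * \prod_(j | j != i) s j); split.
  by apply: notin_prod => i; case: (hs i).
move=> i; rewrite (bigD1 i) //= !rmorphM mulrA; congr (_ * _).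
by case: (hs i).
Qed.

Lemma common_annihilator (F : finType) (Z : F -> B) : (forall i, phi (Z i) = 0) ->
  exists t, ~ P t /\ forall i, t * Z i = 0.
Proof.
have [_ _ ker] := hloc => hZ.
have [t ht] := choice (fun i => iffLR (ker (Z i)) (hZ i)).
exists (\prod_i t i); split; first by apply: notin_prod => i; case: (ht i).
move=> i; rewrite (bigD1 i) //= mulrAC.
by case: (ht i) => _ ->; rewrite mul0r.
Qed.

End Localize.

(** Flatness is local: the ring elements that bring [r] into the span of the
    Frobenius powers of relations form an ideal contained in no prime. *)
Lemma frob_flat_regular (B : comNzRingType) (p : nat) :
  p \in [pchar B] -> regular_ring B -> frob_flat B p.
Proof.
move=> charB [noethB reg] K r a ra.
pose D u := exists (H : finType) (s : H -> B) (c : H -> K -> B),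
    (forall k, u * r k = \sum_h s h * c h k ^+ p) /\
    forall h, \sum_k c h k * a k = 0.
suff : D 1.
  by move=> [H [s [c [h1 h2]]]]; exists H, s, c; split=> // k; rewrite -h1 mul1r.
have hD : ideal D.
  split.
  - exists void, (fun=> 0), (fun _ _ => 0); split; last by case.
    by move=> k; rewrite mul0r big_pred0 //; case.
  - move=> x y [H [s [c [h1 h2]]]] [H' [s' [c' [h1' h2']]]].
    exists (H + H')%type, (fun k => match k with inl k => s k | inr k => s' k end),
      (fun k => match k with inl k => c k | inr k => c' k end).
    split; last by case.
    by move=> k; rewrite big_sumType /= mulrDl h1 h1'.
  - move=> x y [H [s [c [h1 h2]]]]; exists H, (fun h => x * s h), c; split=> // k.
    by rewrite -mulrA h1 mulr_sumr; apply: eq_bigr => h _; rewrite mulrA.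
apply: contrapT => nD1; have [P [hP DP]] := prime_above noethB hD nD1.
have [L [phi [hloc regL]]] := reg (Spec hP).
have [surj frac ker] := hloc.
have charL : p \in [pchar L] by apply: (rmorph_pchar phi).
have [|H [s [c [rE cE]]]] := @frob_flat_regular_local L p charL regL K (phi \o r) (phi \o a).
  transitivity (phi (\sum_k r k * a k ^+ p)); last by rewrite ra rmorph0.
  by rewrite rmorph_sum; apply: eq_bigr => k _; rewrite rmorphM rmorphXn.
have [t [Y [nt hY]]] := common_denominator hloc (fun hk : H * K => c hk.1 hk.2).
have [t2 [nt2 ht2]] : exists t2, ~ P t2 /\ forall h, t2 * \sum_k Y (h, k) * a k = 0.
  apply: (common_annihilator hloc) => h; rewrite rmorph_sum /=.
  rewrite (eq_bigr (fun k => c h k * phi (a k) * phi t)); last first.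
    by move=> k _; rewrite rmorphM /= -hY mulrAC.
  by rewrite -mulr_suml cE mul0r.
have [t3 [S [nt3 hS]]] := common_denominator hloc s.
pose c2 h k := t2 * Y (h, k).
have phi2 h k : phi (c2 h k) = c h k * phi (t * t2).
  by rewrite /c2 !rmorphM /= -hY /=; ring.
have [t4 [nt4 ht4]] : exists t4, ~ P t4 /\ forall k,
    t4 * (t3 * (t * t2) ^+ p * r k - \sum_h S h * c2 h k ^+ p) = 0.
  apply: (common_annihilator hloc) => k; apply/eqP.
  rewrite rmorphB subr_eq0 rmorph_sum !rmorphM rmorphXn; apply/eqP.
  rewrite -[phi (r k)]/((phi \o r) k) rE mulr_sumr; apply: eq_bigr => h _.
  by rewrite /= [phi (S h * _)]rmorphM rmorphXn /= -hS phi2 exprMn; ring.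
have : P (t4 * (t3 * (t * t2) ^+ p)).
  apply: DP; exists H, (fun h => t4 * S h), c2; split.
    move=> k; rewrite -mulrA; have := ht4 k; rewrite mulrBr => /eqP.
    rewrite subr_eq0 => /eqP ->; rewrite mulr_sumr.
    by apply: eq_bigr => h _; rewrite mulrA.
  move=> h; rewrite -[RHS](ht2 h) mulr_sumr; apply: eq_bigr => k _.
  by rewrite /c2 mulrA.
have nM := primeM hP; apply: (nM) => //; apply: (nM) => //.
by move/(prime_exp hP); apply: nM.
Qed.

(** Solve the equations one after the other: the solutions of the first ones
    are the coefficients of the relation to which the next one is applied. *)
Lemma frob_flat_system (B : comNzRingType) (p : nat) : p \in [pchar B] ->
  frob_flat B p ->
  forall (J : eqType) (js : seq J) (K : finType) (r : K -> B) (a : K -> J -> B),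
  (forall j, j \in js -> \sum_k r k * a k j ^+ p = 0) ->
  exists (H : finType) (s : H -> B) (c : H -> K -> B),
    (forall k, r k = \sum_h s h * c h k ^+ p) /\
    forall h j, j \in js -> \sum_k c h k * a k j = 0.
Proof.
move=> charB flatB J js K r a; elim: js => [|j js IH] hr.
  exists K, r, (fun h k => (h == k)%:R); split=> // k.
  rewrite (bigD1 k) //= eqxx expr1n mulr1 big1 ?addr0 // => h /negPf->.
  by rewrite (frob0 charB) mulr0.
have [|H [s [c [rE cE]]]] := IH.
  by move=> j' hj'; apply: hr; rewrite in_cons hj' orbT.
have [|G [t [e [sE eE]]]] := flatB H s (fun h => \sum_k c h k * a k j).
  rewrite -[RHS](hr j) ?mem_head //.
  rewrite [RHS](eq_bigr (fun k => \sum_h s h * c h k ^+ p * a k j ^+ p)); last first.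
    by move=> k _; rewrite rE mulr_suml.
  rewrite exchange_big; apply: eq_bigr => h _.
  by rewrite (frob_sum charB) mulr_sumr; apply: eq_bigr => k _; rewrite exprMn mulrA.
have swap (v : K -> B) g : \sum_k (\sum_h e g h * c h k) * v k =
    \sum_h e g h * \sum_k c h k * v k.
  rewrite (eq_bigr (fun k => \sum_h e g h * (c h k * v k))); last first.
    by move=> k _; rewrite mulr_suml; apply: eq_bigr => h _; rewrite mulrA.
  by rewrite exchange_big; apply: eq_bigr => h _; rewrite mulr_sumr.
exists G, t, (fun g k => \sum_h e g h * c h k); split.
  move=> k; rewrite rE (eq_bigr (fun h => \sum_g t g * e g h ^+ p * c h k ^+ p)).
    rewrite exchange_big; apply: eq_bigr => g _.
    by rewrite (frob_sum charB) mulr_sumr; apply: eq_bigr => h _;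
       rewrite exprMn mulrA.
  by move=> h _; rewrite sE mulr_suml.
move=> g j'; rewrite in_cons swap => /orP[/eqP->|hj']; first exact: eE.
by rewrite big1 // => h _; rewrite cE // mulr0.
Qed.

Lemma sum_triple (V : nmodType) (I J K : finType) (F : I * J * K -> V) :
  \sum_x F x = \sum_i \sum_j \sum_k F (i, j, k).
Proof.
rewrite (pair_bigA _ (fun i j => \sum_k F (i, j, k))).
rewrite (pair_bigA _ (fun x k => F (x.1, x.2, k))).
by apply: eq_bigr => -[[i j] k].
Qed.

Section MPolyFrobenius.
Variables (A : comNzRingType) (m p : nat).
Hypothesis charA : p \in [pchar A].
Local Notation R := {mpoly A[m]}.

Lemma pchar_mpoly : p \in [pchar R].
Proof. exact: (rmorph_pchar (mpolyC m (R := A)) charA). Qed.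

Let p0 : (0 < p)%N. Proof. exact: p_gt0 charA. Qed.

Lemma mcoeffXM (n k : 'X_{1..m}) (q : R) :
  ('X_[n] * q)@_k = if (n <= k)%MM then q@_(k - n) else 0.
Proof.
rewrite mulrC; case: ifP => [nk|nk]; first by rewrite -{1}(submK nk) addmC mcoeffMX.
apply: memN_msupp_eq0; rewrite (perm_mem (msuppMX _ _)); apply/negP => /mapP[k' _ kE].
by move: nk; rewrite kE lem_addr.
Qed.

Lemma mpoly_frobE (a : R) :
  a ^+ p = \sum_(n <- msupp a) (a@_n ^+ p *: 'X_[n *+ p]).
Proof.
rewrite {1}(mpolyE a) (frob_sum pchar_mpoly); apply: eq_bigr => n _.
by rewrite exprZn mpolyXn.
Qed.

Lemma mulmn_inj (n k : 'X_{1..m}) : (n *+ p)%MM = (k *+ p)%MM -> n = k.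
Proof.
move/mnmP => h; apply/mnmP => i; have := h i; rewrite !mulmnE => /eqP.
by rewrite eqn_pmul2r // => /eqP.
Qed.

Lemma mcoeff_frob (a : R) n : (a ^+ p)@_(n *+ p) = a@_n ^+ p.
Proof.
rewrite mpoly_frobE raddf_sum /=.
rewrite (eq_bigr (fun k => a@_k ^+ p * (k == n)%:R)); last first.
  move=> k _; rewrite mcoeffZ mcoeffX; congr (_ * _%:R).
  by case: eqP => [/mulmn_inj -> | h]; [rewrite eqxx|case: eqP => // kn; rewrite kn in h].
case: (boolP (n \in msupp a)) => hn.
  rewrite (bigD1_seq n) //= eqxx mulr1 big1 ?addr0 // => k /negPf->.
  by rewrite mulr0.
rewrite (memN_msupp_eq0 hn) (frob0 charA) big_seq big1 // => k hk.
by case: eqP => [kn|]; [rewrite kn (negPf hn) in hk|rewrite mulr0].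
Qed.

Lemma mcoeff_frob_neq (a : R) n : (forall k, n <> (k *+ p)%MM) -> (a ^+ p)@_n = 0.
Proof.
move=> h; rewrite mpoly_frobE raddf_sum big1 //= => k _.
by rewrite mcoeffZ mcoeffX; case: eqP => [kn|]; rewrite ?mulr0 //; case: (h k).
Qed.

(** Exponent vectors with all entries below [p]: the monomials they define are
    a basis of [A[X]] over [A[X^p]]. *)
Definition small_mnm (al : {ffun 'I_m -> 'I_p}) : 'X_{1..m} :=
  [multinom (al i : nat) | i < m].

Definition mnm_mod (n : 'X_{1..m}) : {ffun 'I_m -> 'I_p} :=
  [ffun i => Ordinal (ltn_pmod (n i) p0)].

Definition mnm_div (n : 'X_{1..m}) : 'X_{1..m} := [multinom (n i %/ p)%N | i < m].

Lemma mnm_divE n : (small_mnm (mnm_mod n) + mnm_div n *+ p)%MM = n.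
Proof.
apply/mnmP => i; rewrite mnmDE mulmnE !mnmE ffunE /=.
by rewrite addnC -divn_eq.
Qed.

Lemma small_mnm_div al be (ga de : 'X_{1..m}) :
  (small_mnm al + ga *+ p)%MM = (small_mnm be + de *+ p)%MM -> al = be /\ ga = de.
Proof.
move/mnmP => h; have hi i : al i = be i /\ ga i = de i.
  have := h i; rewrite !mnmDE !mulmnE !mnmE => hE.
  split; first apply: val_inj.
    have := congr1 (modn^~ p) hE.
    by rewrite /= ![(_ + _ * p)%N]addnC !modnMDl !modn_small.
  have := congr1 (divn^~ p) hE.
  by rewrite /= ![(_ + _ * p)%N]addnC !divnMDl // !divn_small // !addn0.
split; first by apply/ffunP => i; case: (hi i).
by apply/mnmP => i; case: (hi i).
Qed.

Lemma small_mnmP al (ga n : 'X_{1..m}) : (small_mnm al + ga *+ p)%MM = n ->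
  al = mnm_mod n /\ ga = mnm_div n.
Proof. by move=> h; apply: small_mnm_div; rewrite mnm_divE. Qed.

Lemma mnm_div_mdeg n : (mdeg (mnm_div n) <= mdeg n)%N.
Proof.
rewrite !mdegE; apply: leq_sum => i _; rewrite mnmE; exact: leq_div.
Qed.

Lemma mpoly_small_expand N (r : R) : (msize r <= N)%N ->
  r = \sum_(al : {ffun 'I_m -> 'I_p}) \sum_(ga : 'X_{1..m < N})
        r@_(small_mnm al + ga *+ p) *: 'X_[small_mnm al + ga *+ p].
Proof.
move=> hN; apply/mpolyP => n; rewrite raddf_sum /= (bigD1 (mnm_mod n)) //=.
rewrite [X in _ + X]big1 ?addr0; last first.
  move=> al hal; rewrite raddf_sum big1 //= => ga _; rewrite mcoeffZ mcoeffX.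
  case: eqP => [|_]; last by rewrite mulr0.
  by move/small_mnmP => [aE]; rewrite aE eqxx in hal.
rewrite raddf_sum /=.
case: (ltnP (mdeg (mnm_div n)) N) => hd.
  rewrite (bigD1 (BMultinom hd)) //= [X in _ + X]big1 ?addr0.
    by rewrite mnm_divE mcoeffZ mcoeffX eqxx mulr1.
  move=> ga hga; rewrite mcoeffZ mcoeffX.
  case: eqP => [|_]; last by rewrite mulr0.
  move/small_mnmP => [_ gE].
  by case/eqP: hga; apply: val_inj.
rewrite big1 => [|ga _].
  by rewrite (memN_msupp_eq0 (msize_mdeg_ge (leq_trans hN (leq_trans hd (mnm_div_mdeg n))))).
rewrite mcoeffZ mcoeffX; case: eqP => [|_]; last by rewrite mulr0.
move/small_mnmP => [_ gE].
by move: hd; rewrite -gE leqNgt bmdeg.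
Qed.

Lemma mcoeff_mul_frob N (r a : R) al de : (msize r <= N)%N ->
  (r * a ^+ p)@_(small_mnm al + de *+ p) =
  \sum_(ga : 'X_{1..m < N}) r@_(small_mnm al + ga *+ p) *
     (if (ga <= de)%MM then a@_(de - ga) else 0) ^+ p.
Proof.
move=> hN; rewrite {1}(mpoly_small_expand hN) mulr_suml raddf_sum /=.
have lesub (ga : 'X_{1..m}) : (small_mnm al + ga *+ p <= small_mnm al + de *+ p)%MM
    = (ga <= de)%MM.
  apply/mnm_lepP/mnm_lepP => h i; have := h i; rewrite !mnmDE !mulmnE.
    by rewrite leq_add2l leq_pmul2r.
  by rewrite leq_add2l leq_pmul2r.
rewrite (bigD1 al) //= [X in _ + X]big1 ?addr0.
  rewrite mulr_suml raddf_sum /=; apply: eq_bigr => ga _.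
  rewrite -scalerAl mcoeffZ mcoeffXM lesub; congr (_ * _).
  case: ifP => hle; last by rewrite (frob0 charA).
  rewrite -mcoeff_frob; congr (_@__); apply/mnmP => i.
  by rewrite !mnmBE !mnmDE !mulmnE mnmBE subnDl mulnBl.
move=> be hbe; rewrite mulr_suml raddf_sum big1 //= => ga _.
rewrite -scalerAl mcoeffZ mcoeffXM; case: ifP => hle; last by rewrite mulr0.
rewrite mcoeff_frob_neq ?mulr0 // => k hk.
have : (small_mnm al + de *+ p = small_mnm be + (ga + k) *+ p)%MM.
  rewrite -(submK hle) hk; apply/mnmP => i.
  by rewrite !mnmDE !mulmnE mnmDE; lia.
by move/small_mnm_div => [aE]; rewrite aE eqxx in hbe.
Qed.

(** Flatness passes from [A] to [A[X]], which is free over [A[X^p]] on the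
    monomials with exponents below [p]: a relation over [A[X]] is a system of
    relations over [A] between coefficients. *)
Lemma frob_flat_mpoly : frob_flat A p -> frob_flat R p.
Proof.
move=> flatA K r a hr.
pose N := (\max_k maxn (msize (r k)) (msize (a k)))%N.
have hrN k : (msize (r k) <= N)%N.
  by apply: leq_trans (leq_bigmax k); apply: leq_maxl.
have haN k : (msize (a k) <= N)%N.
  by apply: leq_trans (leq_bigmax k); apply: leq_maxr.
pose FA := {ffun 'I_m -> 'I_p}; pose X := 'X_{1..m < N}.
pose sh k (ga de : 'X_{1..m}) := if (ga <= de)%MM then (a k)@_(de - ga) else 0.
pose co (x : FA * K * X) (j : FA * 'X_{1..m < N + N}) :=
  if x.1.1 == j.1 then sh x.1.2 x.2 j.2 else 0.
pose rr (x : FA * K * X) := (r x.1.2)@_(small_mnm x.1.1 + x.2 *+ p).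
have splitco (f : FA * K * X -> A) al (de : 'X_{1..m < N + N}) (q : nat) : (0 < q)%N ->
   \sum_x f x * co x (al, de) ^+ q = \sum_k \sum_ga f (al, k, ga) * sh k ga de ^+ q.
  move=> q0; rewrite sum_triple (bigD1 al) //= [X in _ + X]big1 ?addr0.
    by apply: eq_bigr => k _; apply: eq_bigr => ga _; rewrite /co eqxx.
  move=> be /negPf hbe; rewrite big1 // => k _; rewrite big1 // => ga _.
  by rewrite /co /= hbe expr0n; case: q q0 => // q _; rewrite mulr0.
have [|H [s [c [rE cE]]]] := @frob_flat_system A p charA flatA _
    (enum {: FA * 'X_{1..m < N + N}}) _ rr co.
  move=> [al de] _; rewrite splitco //.
  have := congr1 (mcoeff (small_mnm al + de *+ p)) hr.
  rewrite mcoeff0 raddf_sum /= => h; rewrite -[RHS]h; apply: eq_bigr => k _.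
  by rewrite (mcoeff_mul_frob _ _ _ (hrN k)).
pose C (x : FA * H) k : R := \sum_(ga : X) c x.2 (x.1, k, ga) *: 'X_[ga].
exists (FA * H)%type, (fun x => s x.2 *: 'X_[small_mnm x.1]), C; split.
  move=> k; rewrite {1}(mpoly_small_expand (hrN k)).
  rewrite -(pair_bigA _ (fun al h => s h *: 'X_[small_mnm al] * C (al, h) k ^+ p)) /=.
  apply: eq_bigr => al _.
  rewrite (eq_bigr (fun ga : X => \sum_h s h * c h (al, k, ga) ^+ p
     *: 'X_[small_mnm al + ga *+ p])); last first.
    by move=> ga _; rewrite -[_@__]/(rr (al, k, ga)) rE scaler_suml.
  rewrite exchange_big; apply: eq_bigr => h _.
  rewrite /C (frob_sum pchar_mpoly) mulr_sumr; apply: eq_bigr => ga _ /=.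
  by rewrite exprZn mpolyXn -scalerAl -scalerAr scalerA -mpolyXD.
move=> [al h]; apply/mpolyP => de; rewrite mcoeff0 raddf_sum /=.
rewrite (eq_bigr (fun k => \sum_(ga : X) c h (al, k, ga) * sh k ga de)); last first.
  move=> k _; rewrite /C mulr_suml raddf_sum; apply: eq_bigr => ga _ /=.
  by rewrite -scalerAl mcoeffZ mcoeffXM.
case: (ltnP (mdeg de) (N + N)) => hd.
  have := cE h (al, BMultinom hd); rewrite mem_enum => /(_ isT) E0.
  rewrite -[RHS]E0 -[RHS](eq_bigr _ (fun x _ => congr1 (fun y => _ * y) (expr1 _))).
  by rewrite splitco //; apply: eq_bigr => k _; apply: eq_bigr => ga _; rewrite expr1.
rewrite big1 // => k _; rewrite big1 // => ga _; rewrite /sh.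
case: ifP => hle; last by rewrite mulr0.
rewrite memN_msupp_eq0 ?mulr0 //; apply: msize_mdeg_ge.
apply: leq_trans (haN k) _; rewrite -(leq_add2r (mdeg ga)) -mdegD submK //.
apply: leq_trans hd; rewrite leq_add2l; exact: ltnW (bmdeg ga).
Qed.

End MPolyFrobenius.

(** * Hilbert's basis theorem *)

Section Span.
Variables (B : comNzRingType) (d : nat) (g : 'I_d -> B).

Lemma span_ideal : ideal (Defs.span g).
Proof.
split.
- by exists (fun=> 0); rewrite big1 // => i _; rewrite mul0r.
- move=> x y [c ->] [c' ->]; exists (fun i => c i + c' i).
  by rewrite -big_split; apply: eq_bigr => i _; rewrite mulrDl.
- move=> a x [c ->]; exists (fun i => a * c i).
  by rewrite mulr_sumr; apply: eq_bigr => i _; rewrite mulrA.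
Qed.

Lemma span_gen i : Defs.span g (g i).
Proof.
exists (fun j => (j == i)%:R); rewrite (bigD1 i) //= eqxx mul1r big1 ?addr0 //.
by move=> j /negPf->; rewrite mul0r.
Qed.

Lemma span_min (I : B -> Prop) x : ideal I -> (forall i, I (g i)) ->
  Defs.span g x -> I x.
Proof.
by move=> hI h [c ->]; apply: ideal_sum => // i _; apply: idealM.
Qed.

End Span.

Lemma noetherian_image (B C : comNzRingType) (f : {rmorphism B -> C}) :
  (forall y, exists x, f x = y) -> noetherian B -> noetherian C.
Proof.
move=> surj noethB I hI.
have [| d [g hg]] := noethB (fun x => I (f x)).
- split; first by rewrite rmorph0; apply: ideal0.
    by move=> x y hx hy; rewrite rmorphD; apply: idealD.
  by move=> a x hx; rewrite rmorphM; apply: idealM.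
exists d, (f \o g) => y; split.
  have [x <-] := surj y; move/hg => [c ->]; exists (f \o c).
  by rewrite rmorph_sum; apply: eq_bigr => i _; rewrite rmorphM.
by apply: span_min => // i; apply/hg; apply: span_gen.
Qed.

(** Hilbert's basis theorem: lift generators of the ideals of leading
    coefficients in each degree, up to the degree where these stabilize. *)
Lemma noetherian_poly (B : comNzRingType) : noetherian B -> noetherian {poly B}.
Proof.
move=> noethB I hI.
pose L n c := exists f : {poly B}, [/\ I f, (size f <= n.+1)%N & f`_n = c].
have hL n : ideal (L n).
  split.
  - by exists 0; rewrite size_poly0 coef0; split=> //; apply: ideal0.
  - move=> x y [f [If sf <-]] [h [Ih sh <-]]; exists (f + h).
    rewrite coefD; split=> //; first exact: idealD.
    by apply: leq_trans (size_polyD _ _) _; rewrite geq_max sf.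
  - move=> a x [f [If sf <-]]; exists (a%:P * f); rewrite coefCM; split=> //.
      exact: idealM.
    by rewrite mul_polyC; apply: leq_trans (size_scale_leq _ _) _.
have incL n c : L n c -> L n.+1 c.
  move=> [f [If sf <-]]; exists (f * 'X); rewrite coefMX; split=> //.
    exact: idealMr.
  by case: (eqVneq f 0) => [->|f0]; rewrite ?mul0r ?size_poly0 // size_mulX.
have [N hN] := acc noethB hL incL.
have lift n : exists dg : {d : nat & 'I_d -> {poly B}},
    (forall i, I (tagged dg i) /\ (size (tagged dg i) <= n.+1)%N) /\
    forall c, L n c -> Defs.span (fun i => (tagged dg i)`_n) c.
  have [d [g hg]] := noethB (L n) (hL n).
  have hgi i : L n (g i) by apply/hg; apply: span_gen.
  have [F hF] := choice hgi.
  exists (Tagged (fun d => 'I_d -> {poly B}) F); split=> /=.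
    by move=> i; case: (hF i).
  move=> c /hg [a ->]; exists a; apply: eq_bigr => i _; congr (_ * _).
  by case: (hF i).
have [F hF] := choice lift.
pose S := flatten [seq [seq tagged (F n) i | i <- enum 'I_(tag (F n))] | n <- iota 0 N.+1].
have memS n i : (n <= N)%N -> tagged (F n) i \in S.
  move=> hn; apply/flatten_mapP; exists n; first by rewrite mem_iota add0n ltnS.
  by apply: map_f; rewrite mem_enum.
have SI f : f \in S -> I f.
  move/flatten_mapP => [n _ /mapP[i _ ->]].
  by have [h _] := hF n; case: (h i).
pose G := Defs.span (fun i : 'I_(size S) => S`_i).
have hG : ideal G by apply: span_ideal.
have GS f : f \in S -> G f.
  move=> fS; have hi : (index f S < size S)%N by rewrite index_mem.
  by have := span_gen (fun i : 'I_(size S) => S`_i) (Ordinal hi); rewrite /= nth_index.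
exists (size S), (fun i : 'I_(size S) => S`_i) => f; split; last first.
  by apply: span_min => // i; apply: SI; apply: mem_nth.
move=> If; have : (size f <= size f)%N by [].
move: {2}(size f) => n; elim: n f If => [|n IH] f If.
  by rewrite leqn0 size_poly_eq0 => /eqP ->; apply: ideal0.
move=> sf; pose k := minn n N.
have hk : L k f`_n.
  have Ln : L n f`_n by exists f.
  rewrite /k; case: (leqP n N) => // _; exact: hN Ln.
have [hFk hc] := hF k; have {hc} [c fE] := hc _ hk.
pose h := \sum_i (c i)%:P * 'X^(n - k) * tagged (F k) i.
have Gh : G h.
  apply: ideal_sum => // i _; apply: idealM => //; apply: GS; apply: memS.
  exact: geq_minr.
have Ih : I h by apply: ideal_sum => // i _; apply: idealM => //; case: (hFk i).
apply: (idealBl hG _ Gh); apply: IH; first exact: idealB.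
apply/leq_sizeP => j; rewrite leq_eqVlt coefB /h coef_sum => /orP[/eqP <-|jn].
  rewrite fE; apply/eqP; rewrite subr_eq0; apply/eqP; apply: eq_bigr => i _.
  rewrite -mulrA coefCM coefXnM ltnNge leq_subr /= subKn //; exact: geq_minl.
rewrite (leq_sizeP _ _ sf) // sub0r big1 ?oppr0 // => i _.
rewrite -mulrA coefCM coefXnM; case: ltnP => hj; first by rewrite mulr0.
have [_ sF] := hFk i; rewrite (leq_sizeP _ _ sF) ?mulr0 //.
have := geq_minl n N; rewrite -/k => kn; lia.
Qed.

(** Adjoin one variable at a time: the polynomials in [m.+1] variables are the
    image of the univariate polynomials over those in [m] variables. *)
Lemma noetherian_mpoly (A : comNzRingType) (m : nat) :
  noetherian A -> noetherian {mpoly A[m]}.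
Proof.
move=> noethA; elim: m => [|m IH].
  apply: (@noetherian_image A _ (mpolyC 0 (R := A))) => // y.
  exists (mcoeff 0%MM y); exact/esym/nvar0_mpolyC.
pose f : {rmorphism {poly {mpoly A[m]}} -> {mpoly A[m.+1]}} :=
  (horner_eval 'X_ord_max \o map_poly (@mwiden m A)).
apply: (@noetherian_image _ _ f); last exact: noetherian_poly.
have fC c : f c%:P = mwiden c by rewrite /f /= map_polyC /horner_eval hornerC.
have fX : f 'X = 'X_ord_max by rewrite /f /= map_polyX /horner_eval hornerX.
have fXi (i : 'I_m.+1) : exists x, f x = 'X_i.
  case: (unliftP ord_max i) => [j ->|->]; last by exists 'X.
  exists ('X_j)%:P; rewrite fC mwidenX mnmwiden1; congr ('X_[U_(_)]).
  by apply: val_inj; rewrite [RHS]lift_max.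
have [g hg] := choice fXi.
move=> y; exists (\sum_(n <- msupp y) (y@_n)%:MP%:P * \prod_i g i ^+ n i).
rewrite rmorph_sum [RHS]mpolyE; apply: eq_bigr => n _.
rewrite rmorphM fC mwidenC mul_mpolyC; congr (_ *: _).
by rewrite rmorph_prod mpolyXE_id; apply: eq_bigr => i _; rewrite rmorphXn hg.
Qed.

(** * Submodules and quotient modules *)

Section Submodules.
Variables (R : comNzRingType) (V : lmodType R).

Definition submod (S : V -> Prop) :=
  S 0 /\ forall a x y, S x -> S y -> S (a *: x + y).

Lemma submod0 S : submod S -> S 0. Proof. by case. Qed.
Lemma submodD S x y : submod S -> S x -> S y -> S (x + y).
Proof. by move=> [_ h] hx hy; rewrite -[x]scale1r; apply: h. Qed.
Lemma submodZ S a x : submod S -> S x -> S (a *: x).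
Proof. by move=> [h0 h] hx; rewrite -[_ *: _]addr0; apply: h. Qed.
Lemma submodN S x : submod S -> S x -> S (- x).
Proof. by move=> hS hx; rewrite -scaleN1r; apply: submodZ. Qed.
Lemma submodB S x y : submod S -> S x -> S y -> S (x - y).
Proof. by move=> hS hx hy; apply: submodD => //; apply: submodN. Qed.
Lemma submod_sum S (I : Type) (s : seq I) (P : pred I) (F : I -> V) : submod S ->
  (forall i, P i -> S (F i)) -> S (\sum_(i <- s | P i) F i).
Proof.
move=> hS hF; elim/big_ind: _ => //; first exact: submod0.
by move=> x y; apply: submodD.
Qed.

End Submodules.

Lemma exists_linear (R : comNzRingType) (V W : lmodType R) (f : V -> W) :
  (forall a x y, f (a *: x + y) = a *: f x + f y) ->
  exists g : {linear V -> W}, forall x, g x = f x.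
Proof.
move=> hf.
pose ml := GRing.isLinear.Build R V W *:%R f hf.
pose g : {linear V -> W} := HB.pack f ml.
by exists g.
Qed.

Section SubmoduleType.
Variables (R : comNzRingType) (V : lmodType R) (S : V -> Prop).
Hypothesis hS : submod S.

Definition submod_pred : {pred V} := fun x => `[< S x >].

Let submod_pred_closed : GRing.submod_closed submod_pred.
Proof.
case: hS => h0 h; split; first exact/asboolP.
by move=> a x y /asboolP hx /asboolP hy; apply/asboolP; apply: h.
Qed.

HB.instance Definition _ := GRing.isSubmodClosed.Build R V submod_pred submod_pred_closed.

Record submod_type := SubmodType { submod_val : V; _ : submod_val \in submod_pred }.

HB.instance Definition _ := [isSub for submod_val].
HB.instance Definition _ := [Choice of submod_type by <:].
HB.instance Definition _ := [SubChoice_isSubLmodule of submod_type by <:].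

Lemma submod_embedding : exists (N : lmodType R) (i : {linear N -> V}),
  injective i /\ forall x, S x <-> exists y, x = i y.
Proof.
exists submod_type, (val : {linear submod_type -> V}); split; first exact: val_inj.
move=> x; split=> [hx|[y ->]]; last by apply/asboolP; exact: (valP y).
have hx' : x \in submod_pred by apply/asboolP.
by exists (SubmodType hx').
Qed.

End SubmoduleType.

Section QuotientModule.
Variables (R : comNzRingType) (V : lmodType R) (W : V -> Prop).
Hypothesis hW : submod W.
Local Open Scope quotient_scope.

Let cong (x y : V) := `[< W (x - y) >].

Let cong_equiv : equiv_class_of cong.
Proof.
split.
- by move=> x; apply/asboolP; rewrite subrr; apply: submod0.
- move=> x y; apply/asboolP/asboolP => h; rewrite -opprB; exact: submodN.
- move=> y x z /asboolP h1 /asboolP h2; apply/asboolP.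
  by rewrite -(subrK y x) -addrA; apply: submodD.
Qed.

Canonical cong_equiv_rel := EquivRelPack cong_equiv.

Definition quot_type := {eq_quot cong_equiv_rel}.
HB.instance Definition _ := Choice.on quot_type.
HB.instance Definition _ := EqQuotient.on quot_type.

Let pi (x : V) : quot_type := \pi_quot_type x.
Let rep (a : quot_type) : V := repr a.

Let pi_eq x y : pi x = pi y <-> W (x - y).
Proof.
split=> [h|h]; first by apply/asboolP; have /eqmodP := h.
by apply/eqmodP; apply/asboolP.
Qed.

Let repK a : pi (rep a) = a. Proof. exact: reprK. Qed.

Let pi_rep x : W (rep (pi x) - x). Proof. by apply/pi_eq; rewrite repK. Qed.

Let qadd a b := pi (rep a + rep b).
Let qopp a := pi (- rep a).
Let qscale r a := pi (r *: rep a).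

Let piD x y : qadd (pi x) (pi y) = pi (x + y).
Proof. by apply/pi_eq; rewrite opprD addrACA; apply: submodD. Qed.

Let piN x : qopp (pi x) = pi (- x).
Proof. by apply/pi_eq; rewrite -opprD; apply: submodN. Qed.

Let piZ r x : qscale r (pi x) = pi (r *: x).
Proof. by apply/pi_eq; rewrite -scalerBr; apply: submodZ. Qed.

Let qaddA : associative qadd.
Proof.
by move=> a b c; rewrite -[a]repK -[b]repK -[c]repK !piD addrA.
Qed.
Let qaddC : commutative qadd.
Proof. by move=> a b; rewrite /qadd addrC. Qed.
Let qadd0 : left_id (pi 0) qadd.
Proof. by move=> a; rewrite -[a]repK piD add0r. Qed.
Let qaddN : left_inverse (pi 0) qopp qadd.
Proof. by move=> a; rewrite -[a]repK piN piD addNr. Qed.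

HB.instance Definition _ := GRing.isZmodule.Build quot_type qaddA qaddC qadd0 qaddN.

Let qaddE (a b : quot_type) : a + b = qadd a b. Proof. by []. Qed.

Let qscaleA a b v : qscale a (qscale b v) = qscale (a * b) v.
Proof. by rewrite -[v]repK !piZ scalerA. Qed.
Let qscale1 : left_id 1 qscale.
Proof. by move=> v; rewrite -[v]repK piZ scale1r. Qed.
Let qscaleDr : right_distributive qscale +%R.
Proof.
by move=> a u v; rewrite -[u]repK -[v]repK !qaddE piD !piZ piD scalerDr.
Qed.
Let qscaleDl v : {morph qscale^~ v : a b / a + b}.
Proof.
by move=> a b; rewrite -[v]repK qaddE !piZ piD scalerDl.
Qed.

HB.instance Definition _ := GRing.Zmodule_isLmodule.Build R quot_type
  qscaleA qscale1 qscaleDr qscaleDl.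

Lemma quotient_module : exists (Q : lmodType R) (f : {linear V -> Q}),
  (forall y, exists x, f x = y) /\ forall x, f x = 0 <-> W x.
Proof.
have [|f hf] := @exists_linear R V quot_type pi.
  by move=> a x y; rewrite qaddE -[a *: pi x]/(qscale a (pi x)) piZ piD.
exists quot_type, f; split=> [y|x]; first by exists (rep y); rewrite hf repK.
by rewrite hf -[X in W X]subr0 -[0 : quot_type]/(pi 0); apply: pi_eq.
Qed.

End QuotientModule.

(** * Graded modules *)

Lemma big_superset (V : nmodType) (T : eqType) (s s' : seq T) (c : T -> V) :
  uniq s -> uniq s' -> {subset s <= s'} -> (forall n, n \notin s -> c n = 0) ->
  \sum_(n <- s') c n = \sum_(n <- s) c n.
Proof.
move=> us us' ss' c0; rewrite (bigID (mem s)) /= [X in _ + X]big1 ?addr0; last first.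
  by move=> n; apply: c0.
rewrite -big_filter; apply: perm_big; apply: uniq_perm => //.
  exact: filter_uniq.
by move=> n; rewrite mem_filter; case: (boolP (n \in s)) => //= /ss'.
Qed.

Section Components.
Variables (A : comNzRingType) (m : nat).
Local Notation R := {mpoly A[m]}.
Implicit Types M N : grmod A m.

Lemma gr_compN M n (x : M) : gr_comp n x -> gr_comp n (- x).
Proof. by move=> hx; rewrite -sub0r; apply: gr_compB => //; apply: gr_comp0. Qed.

Lemma gr_compD M n (x y : M) : gr_comp n x -> gr_comp n y -> gr_comp n (x + y).
Proof. by move=> hx hy; rewrite -[y]opprK; apply: gr_compB => //; apply: gr_compN. Qed.

Lemma gr_comp_sum M n (I : Type) (s : seq I) (P : pred I) (F : I -> M) :
  (forall i, P i -> gr_comp n (F i)) -> gr_comp n (\sum_(i <- s | P i) F i).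
Proof.
move=> h; elim/big_ind: _ => //; first exact: gr_comp0.
by move=> x y; apply: gr_compD.
Qed.

Definition decomposition M (x : M) (c : int -> M) :=
  (forall n, gr_comp n (c n)) /\
  exists s : seq int, [/\ uniq s, forall n, n \notin s -> c n = 0
    & x = \sum_(n <- s) c n].

Lemma decompositionD M (x y : M) c d : decomposition x c -> decomposition y d ->
  decomposition (x + y) (fun n => c n + d n).
Proof.
move=> [hc [s [us cs ->]]] [hd [t [ut dt ->]]]; split.
  by move=> n; apply: gr_compD.
exists (undup (s ++ t)); split; first exact: undup_uniq.
  move=> n; rewrite mem_undup mem_cat negb_or => /andP[hs ht].
  by rewrite cs // dt // addr0.
rewrite big_split; congr (_ + _); apply/esym; apply: big_superset => //.
- exact: undup_uniq.
- by move=> n hn; rewrite mem_undup mem_cat hn.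
- exact: undup_uniq.
- by move=> n hn; rewrite mem_undup mem_cat hn orbT.
Qed.

Lemma decompositionN M (x : M) c : decomposition x c ->
  decomposition (- x) (fun n => - c n).
Proof.
move=> [hc [s [us cs ->]]]; split; first by move=> n; apply: gr_compN.
by exists s; split=> // [n hn|]; rewrite ?sumrN // cs // oppr0.
Qed.

Lemma decomposition_homog M n (x : M) : gr_comp n x ->
  decomposition x (fun k => if k == n then x else 0).
Proof.
move=> hx; split; first by move=> k; case: eqP => [->|_] //; apply: gr_comp0.
exists [:: n]; split=> // [k|]; first by rewrite inE => /negPf->.
by rewrite big_seq1 eqxx.
Qed.

Lemma decomposition_exists M (x : M) : exists c, decomposition x c.
Proof.
have [s [c [hc ->]]] := gr_decomp x; elim: s => [|n s [d hd]].
  exists (fun _ => 0); rewrite big_nil; split; first by move=> n; apply: gr_comp0.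
  by exists [::]; rewrite big_nil.
rewrite big_cons; eexists; apply: decompositionD hd.
exact: (decomposition_homog (hc n)).
Qed.

Lemma decomposition0 M c : decomposition (0 : M) c -> forall n, c n = 0.
Proof.
move=> [hc [s [us cs E]]] n; case: (boolP (n \in s)) => [hn|]; last exact: cs.
exact: (gr_indep us hc (esym E)).
Qed.

Lemma decomposition_unique M (x : M) c d : decomposition x c -> decomposition x d ->
  forall n, c n = d n.
Proof.
move=> hc hd n; apply/eqP; rewrite -subr_eq0; apply/eqP.
have := decompositionD hc (decompositionN hd); rewrite subrr => h.
exact: (decomposition0 h).
Qed.

(** The homogeneous component of degree [n]. *)
Definition pr M (n : int) (x : M) : M := sval (cid (decomposition_exists x)) n.

Lemma pr_decomposition M (x : M) : decomposition x (fun n => pr n x).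
Proof. exact: (svalP (cid (decomposition_exists x))). Qed.

Lemma prE M (x : M) c n : decomposition x c -> pr n x = c n.
Proof. by move=> hc; apply: (decomposition_unique (pr_decomposition x) hc). Qed.

Lemma pr_comp M n (x : M) : gr_comp n (pr n x).
Proof. by case: (pr_decomposition x). Qed.

Lemma prD M n (x y : M) : pr n (x + y) = pr n x + pr n y.
Proof.
exact: (prE n (decompositionD (pr_decomposition x) (pr_decomposition y))).
Qed.

Lemma pr_homog M n k (x : M) : gr_comp n x -> pr k x = if k == n then x else 0.
Proof. by move=> hx; rewrite (prE k (decomposition_homog hx)). Qed.

Lemma pr_id M n (x : M) : gr_comp n x -> pr n x = x.
Proof. by move/(pr_homog n)=> ->; rewrite eqxx. Qed.

Lemma pr0 M n : pr n (0 : M) = 0.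
Proof. by rewrite (pr_homog n (gr_comp0 M n)) if_same. Qed.

Lemma pr_sum M n (I : Type) (s : seq I) (P : pred I) (F : I -> M) :
  pr n (\sum_(i <- s | P i) F i) = \sum_(i <- s | P i) pr n (F i).
Proof. exact: (big_morph _ (prD n) (pr0 M n)). Qed.

Lemma pr_support M (x : M) : exists s : seq int, [/\ uniq s,
  forall n, n \notin s -> pr n x = 0 & x = \sum_(n <- s) pr n x].
Proof. by case: (pr_decomposition x). Qed.

Lemma pr_hom M N (u : grhom M N) n (x : M) : pr n (u x) = u (pr n x).
Proof.
apply: (prE (c := fun n => u (pr n x))); split.
  by move=> k; apply: gr_funP; apply: pr_comp.
have [s [us hs xE]] := pr_support x; exists s; split=> //.
  by move=> k hk; rewrite hs // raddf0.
by rewrite {1}xE raddf_sum.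
Qed.

Lemma shift_pr M N (i : {linear N -> M}) (c : int) :
  (forall n x, gr_comp n x -> gr_comp (n + c) (i x)) ->
  forall n x, i (pr n x) = pr (n + c) (i x).
Proof.
move=> hi n x; have [s [us hs xE]] := pr_support x.
rewrite {2}xE linear_sum pr_sum.
rewrite (eq_bigr (fun k => if k == n then i (pr n x) else 0)); last first.
  move=> k _; rewrite (pr_homog _ (hi _ _ (pr_comp k x))) (inj_eq (addIr _)) eq_sym.
  by case: eqP => [->|].
case: (boolP (n \in s)) => hn.
  by rewrite (bigD1_seq n) //= eqxx big1 ?addr0 // => k /negPf->.
rewrite hs // raddf0 big_seq big1 // => k hk.
by case: eqP => // kn; rewrite kn (negPf hn) in hk.
Qed.

Lemma prZ M (d : nat) n (a : R) (x : M) : a \is d.-homog ->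
  pr n (a *: x) = a *: pr (n - d%:Z) x.
Proof.
move=> ha; apply: (prE (c := fun n => a *: pr (n - d%:Z) x)); split.
  by move=> k; rewrite -{1}(subrK d%:Z k) addrC; apply: gr_compZ => //; apply: pr_comp.
have [s [us hs xE]] := pr_support x.
exists [seq k + d%:Z | k <- s]; split.
- by rewrite map_inj_uniq // => i j; apply: addIr.
- move=> k hk; rewrite hs ?scaler0 //; apply: contra hk => hk.
  by apply/mapP; exists (k - d%:Z); rewrite ?subrK.
- rewrite big_map {1}xE scaler_sumr; apply: eq_bigr => k _.
  by rewrite addrK.
Qed.

(** Components of ring elements; they are indexed by all integers, as in
    [R_comp], so that degrees can be subtracted freely. *)
Definition prR (z : int) (a : R) : R := @pr (gr_R A m) z a.

Lemma R_comp_pr z a : R_comp z (prR z a).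
Proof. exact: (@pr_comp (gr_R A m)). Qed.

Lemma R_comp_scale M z n (a : R) (x : M) : R_comp z a -> gr_comp n x ->
  gr_comp (z + n) (a *: x).
Proof.
case: z => z /= ha hx; first exact: gr_compZ.
by rewrite ha scale0r; apply: gr_comp0.
Qed.

Lemma prR_sum z (I : Type) (s : seq I) (P : pred I) (F : I -> R) :
  prR z (\sum_(i <- s | P i) F i) = \sum_(i <- s | P i) prR z (F i).
Proof. exact: (@pr_sum (gr_R A m)). Qed.

Lemma prR_homog z k a : R_comp z a -> prR k a = if k == z then a else 0.
Proof. exact: (@pr_homog (gr_R A m)). Qed.

Lemma prR_id z a : R_comp z a -> prR z a = a.
Proof. exact: (@pr_id (gr_R A m)). Qed.

Lemma prR_support a : exists s : seq int, [/\ uniq s,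
  forall n, n \notin s -> prR n a = 0 & a = \sum_(n <- s) prR n a].
Proof. exact: (@pr_support (gr_R A m)). Qed.

Lemma pr_scale_homog M e n (a : R) (x : M) : gr_comp e x ->
  pr n (a *: x) = prR (n - e) a *: x.
Proof.
move=> hx; have [s [us hs aE]] := prR_support a.
rewrite {1}aE scaler_suml pr_sum.
rewrite (eq_bigr (fun k => if k == n - e then prR (n - e) a *: x else 0)); last first.
  move=> k _; rewrite (pr_homog n (R_comp_scale (R_comp_pr k a) hx)).
  by rewrite -subr_eq eq_sym; case: eqP => [->|].
case: (boolP (n - e \in s)) => hn; last first.
  rewrite hs // scale0r big_seq big1 // => k hk.
  by case: eqP.
rewrite (bigD1_seq (n - e)) //= eqxx big1 ?addr0 // => k /negPf->.
by [].
Qed.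

Lemma prR_mul_homog e n (a b : R) : R_comp e b -> prR n (a * b) = prR (n - e) a * b.
Proof. exact: (@pr_scale_homog (gr_R A m)). Qed.

(** One range of summation that serves for a whole finite family, after shifts
    of the degrees: this allows sums over the family and over the degrees to be
    exchanged. *)
Lemma prR_support_large (I : finType) (a : I -> R) (e : I -> int) :
  exists s : seq int, uniq s /\ forall i, a i = \sum_(n <- s) prR (n - e i) (a i).
Proof.
have [S hS] := choice (fun i => prR_support (a i)).
exists (undup (flatten [seq [seq n + e i | n <- S i] | i <- enum I])).
split; first exact: undup_uniq.
move=> i; have [us hs aE] := hS i.
rewrite (@big_superset _ _ [seq n + e i | n <- S i]).
- by rewrite big_map {1}aE; apply: eq_bigr => n _; rewrite addrK.
- by rewrite map_inj_uniq // => x y; apply: addIr.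
- exact: undup_uniq.
- move=> n hn; rewrite mem_undup; apply/flattenP.
  by exists [seq n + e i | n <- S i] => //; apply/mapP; exists i; rewrite ?mem_enum.
- move=> n hn; apply: hs; apply: contra hn => hn.
  by apply/mapP; exists (n - e i); rewrite ?subrK.
Qed.

Definition gr_submod M (S : M -> Prop) :=
  submod S /\ forall n x, S x -> S (pr n x).

Lemma gr_submodule M (S : M -> Prop) : gr_submod S ->
  exists (N : grmod A m) (i : grhom N M), [/\ injective i,
    forall x, S x <-> exists y, x = i y & forall n y, gr_comp n (i y) -> gr_comp n y].
Proof.
move=> [hS hpr]; have [N [i [inj_i imi]]] := submod_embedding hS.
pose c n (y : N) := gr_comp n (i y).
have c0 n : c n 0 by rewrite /c raddf0; apply: gr_comp0.
have cB n x y : c n x -> c n y -> c n (x - y).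
  by rewrite /c raddfB; apply: gr_compB.
have cZ (d : nat) n (a : R) x : a \is d.-homog -> c n x -> c (d%:Z + n) (a *: x).
  by rewrite /c linearZ; apply: gr_compZ.
have lift n (y : N) : exists z, pr n (i y) = i z.
  by apply/imi; apply: hpr; apply/imi; exists y.
have cdec (x : N) : exists (s : seq int) (d : int -> N),
    (forall n, c n (d n)) /\ x = \sum_(n <- s) d n.
  have [d hd] := choice (lift ^~ x).
  have [s [us hs xE]] := pr_support (i x).
  exists s, d; split; first by move=> n; rewrite /c -hd; apply: pr_comp.
  apply: inj_i; rewrite {1}xE raddf_sum; apply: eq_bigr => n _; exact: hd.
have cind (s : seq int) (d : int -> N) : uniq s -> (forall n, c n (d n)) ->
    \sum_(n <- s) d n = 0 -> forall n, n \in s -> d n = 0.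
  move=> us hd d0 n hn; apply: inj_i; rewrite raddf0.
  apply: (gr_indep us (c := i \o d)) hn => //=.
  by rewrite -raddf_sum d0 raddf0.
pose N' := GrMod c0 cB cZ cdec cind.
have iP n (x : N') : gr_comp n x -> gr_comp n (i x) by [].
by exists N', (@GrHom A m N' M i iP); split.
Qed.

(** The submodule [S] becomes the source of an injective morphism, so maps given
    only on [S], by any function [h], extend. *)
Lemma gr_injective_extend (E M : grmod A m) (S : M -> Prop) (h : M -> E) :
  gr_injective E -> gr_submod S ->
  (forall a x y, S x -> S y -> h (a *: x + y) = a *: h x + h y) ->
  (forall n x, S x -> gr_comp n x -> gr_comp n (h x)) ->
  exists g : grhom M E, forall x, S x -> g x = h x.
Proof.
move=> injE hS hlin hgr; have [N [i [inj_i imi icomp]]] := gr_submodule hS.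
have iS y : S (i y) by apply/imi; exists y.
have [|f hf] := @exists_linear R N E (fun y => h (i y)).
  by move=> a x y; rewrite linearP; apply: hlin.
have fP n (x : N) : gr_comp n x -> gr_comp n (f x).
  by move=> hx; rewrite hf; apply: hgr => //; apply: gr_funP.
have [g hg] := injE N M i (GrHom fP) inj_i.
exists g => x /imi[y ->]; by rewrite hg /= hf.
Qed.

(** Shifts turn maps of nonzero degree into morphisms, which have degree 0. *)
Lemma gr_shift M (c : int) : exists (N : grmod A m) (i : {linear N -> M})
  (j : {linear M -> N}), [/\ cancel i j, cancel j i &
    forall n x, gr_comp n x <-> gr_comp (n + c) (i x)].
Proof.
pose cm n (x : M) := gr_comp (n + c) x.
have c0 n : cm n 0 by apply: gr_comp0.
have cB n x y : cm n x -> cm n y -> cm n (x - y) by apply: gr_compB.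
have cZ (d : nat) n (a : R) x : a \is d.-homog -> cm n x -> cm (d%:Z + n) (a *: x).
  by rewrite /cm -addrA; apply: gr_compZ.
have cdec (x : M) : exists (s : seq int) (d : int -> M),
    (forall n, cm n (d n)) /\ x = \sum_(n <- s) d n.
  have [s [us hs xE]] := pr_support x.
  exists [seq n - c | n <- s], (fun n => pr (n + c) x); split.
    by move=> n; apply: pr_comp.
  by rewrite big_map {1}xE; apply: eq_bigr => n _; rewrite subrK.
have cind (s : seq int) (d : int -> M) : uniq s -> (forall n, cm n (d n)) ->
    \sum_(n <- s) d n = 0 -> forall n, n \in s -> d n = 0.
  move=> us hd d0 n hn.
  have := @gr_indep A m M [seq k + c | k <- s] (fun k => d (k - c)) _ _ _ (n + c).
  rewrite addrK; apply.
  - by rewrite map_inj_uniq // => x y; apply: addIr.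
  - by move=> k; rewrite -{1}(subrK c k); apply: hd.
  - by rewrite big_map -[RHS]d0; apply: eq_bigr => k _; rewrite addrK.
  - by apply/mapP; exists n.
by exists (GrMod c0 cB cZ cdec cind), idfun, idfun; split.
Qed.

End Components.

(** * Frobenius pullback of a module *)

Section FrobeniusPullback.
Variables (R : comNzRingType) (p : nat).
Hypotheses (charR : p \in [pchar R]) (flatR : frob_flat R p).

(** A Frobenius-semilinear map [phi : N -> N'] is a pullback when it exhibits
    [N'] as the base change of [N] along Frobenius.  The last clause is the
    injectivity of [R (x) N -> N'], in the form that flatness of Frobenius
    allows: relations between values of [phi] come from relations in [N]. *)
Record frob_pullback (N N' : lmodType R) (phi : N -> N') : Prop := {
  fp_semilinear : forall a x y, phi (a *: x + y) = a ^+ p *: phi x + phi y;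
  fp_gen : forall y, exists (I : finType) (r : I -> R) (x : I -> N),
    y = \sum_i r i *: phi (x i);
  fp_flat : forall (I : finType) (r : I -> R) (x : I -> N),
    \sum_i r i *: phi (x i) = 0 ->
    exists (H : finType) (s : H -> R) (c : H -> I -> R),
      (forall i, r i = \sum_h s h * c h i ^+ p) /\
      forall h, \sum_i c h i *: x i = 0
}.

Section Semilinear.
Variables (N N' : lmodType R) (phi : N -> N').
Hypothesis philin : forall a x y, phi (a *: x + y) = a ^+ p *: phi x + phi y.

Lemma semilinear0 : phi 0 = 0.
Proof.
have := philin 1 0 0; rewrite expr1n !scale1r addr0 => /eqP.
by rewrite -subr_eq subrr => /eqP.
Qed.

Lemma semilinearD x y : phi (x + y) = phi x + phi y.
Proof. by have := philin 1 x y; rewrite expr1n !scale1r. Qed.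

Lemma semilinearZ a x : phi (a *: x) = a ^+ p *: phi x.
Proof. by have := philin a x 0; rewrite !addr0 semilinear0 addr0. Qed.

Lemma semilinearN x : phi (- x) = - phi x.
Proof. by apply/eqP; rewrite -addr_eq0 -semilinearD addNr semilinear0. Qed.

Lemma semilinearB x y : phi (x - y) = phi x - phi y.
Proof. by rewrite semilinearD semilinearN. Qed.

Lemma semilinear_sum (I : Type) (s : seq I) (P : pred I) (F : I -> N) :
  phi (\sum_(i <- s | P i) F i) = \sum_(i <- s | P i) phi (F i).
Proof. exact: (big_morph _ semilinearD semilinear0). Qed.

(** Hence [p]-th powers of relations between the [x i] are relations between
    the [phi (x i)], as are their combinations. *)
Lemma semilinear_relation (I H : finType) (x : I -> N) (s : H -> R) (c : H -> I -> R) :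
  \sum_i (\sum_h s h * c h i ^+ p) *: phi (x i) =
  \sum_h s h *: phi (\sum_i c h i *: x i).
Proof.
rewrite (eq_bigr (fun i => \sum_h s h *: (c h i ^+ p *: phi (x i)))); last first.
  by move=> i _; rewrite scaler_suml; apply: eq_bigr => h _; rewrite scalerA.
rewrite exchange_big; apply: eq_bigr => h _.
rewrite semilinear_sum scaler_sumr; apply: eq_bigr => i _.
by rewrite semilinearZ.
Qed.

End Semilinear.

Section Existence.
Variable N : lmodType R.

Local Notation V := {freeg N / R}.

Let ev : V -> N := fglift (fun x : N => x).

Let evD x y : ev (x + y) = ev x + ev y.
Proof.
have h := lift_is_additive (fun x : N => x).
have ev0 : ev 0 = 0 by have := h 0 0; rewrite !subrr.
have evN z : ev (- z) = - ev z by have := h 0 z; rewrite !sub0r -/ev ev0 sub0r.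
by have := h x (- y); rewrite opprK -/ev evN opprK.
Qed.

Let ev_sum (I : Type) (s : seq I) (P : pred I) (F : I -> V) :
  ev (\sum_(i <- s | P i) F i) = \sum_(i <- s | P i) ev (F i).
Proof.
apply: (big_morph _ evD).
have := evD 0 0; rewrite addr0 => /eqP; by rewrite -subr_eq subrr => /eqP.
Qed.

Let evE (D : V) (ds : seq N) : uniq ds -> {subset dom D <= ds} ->
  ev D = \sum_(x <- ds) coeff x D *: x.
Proof.
move=> uds hds; rewrite -{1}(freeg_sumE D) ev_sum.
rewrite [RHS](big_superset (s := dom D)) //; first by apply: eq_bigr => x _; apply: liftU.
  exact: uniq_dom.
by move=> x hx; rewrite coeff_outdom // scale0r.
Qed.

(** Frobenius powers of relations between elements of [N]. *)
Let W (D : V) := exists (K : finType) (s : K -> R) (c : K -> V),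
  (forall k, ev (c k) = 0) /\
  forall x, coeff x D = \sum_k s k * coeff x (c k) ^+ p.

Let hW : submod W.
Proof.
split.
  exists void, (fun=> 0), (fun=> 0); split; first by case.
  by move=> x; rewrite coeff0 big_pred0 //; case.
move=> a D D' [K [s [c [h1 h2]]]] [K' [s' [c' [h1' h2']]]].
exists (K + K')%type, (fun k => match k with inl k => a * s k | inr k => s' k end),
  (fun k => match k with inl k => c k | inr k => c' k end).
split; first by case.
move=> x; rewrite coeffD coeffZ h2 h2' big_sumType /= mulr_sumr; congr (_ + _).
by apply: eq_bigr => k _; rewrite mulrA.
Qed.

(** The base change along Frobenius, as the quotient of the free module on
    [N] by the Frobenius powers of all relations. *)
Lemma frob_pullback_exists : exists (N' : lmodType R) (phi : N -> N'),
  frob_pullback phi.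
Proof.
have [N' [f [fsurj fker]]] := quotient_module hW.
have powb (b : bool) : b%:R ^+ p = b%:R :> R.
  by case: b; rewrite ?expr1n // (frob0 charR).
exists N', (fun x => f << x >>); split.
- move=> a x y; apply/eqP; rewrite -subr_eq0 -linearZ -linearD -linearB; apply/eqP/fker.
  exists 'I_1, (fun=> 1), (fun=> << a *: x + y >> - (a *: << x >> + << y >>)).
  split=> [_|z].
    have -> : a *: << x >> = << a *g x >> :> V.
      by apply/eqP/freeg_eqP => u; rewrite coeffZ !coeffU mul1r.
    have evB (D D' : V) : ev (D - D') = ev D - ev D'.
      exact: (lift_is_additive (fun x : N => x)).
    by rewrite evB evD /ev !liftU !scale1r subrr.
  rewrite big_ord1 mul1r !coeffB !coeffD !coeffZ !coeffU !mul1r.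
  by rewrite (frobB charR) (frobD charR) exprMn !powb.
- move=> y; have [D <-] := fsurj y.
  exists 'I_(size (dom D)), (fun i => coeff (tnth (in_tuple (dom D)) i) D),
    (fun i => tnth (in_tuple (dom D)) i).
  rewrite -{1}(freeg_sumE D) raddf_sum big_tnth; apply: eq_bigr => i _ /=.
  rewrite -linearZ; congr (f _); apply/eqP/freeg_eqP => u.
  by rewrite coeffZ !coeffU mul1r.
- move=> I r x hr.
  have : W (\sum_i r i *: << x i >>).
    by apply/fker; rewrite linear_sum -[RHS]hr; apply: eq_bigr => i _; apply: linearZ.
  move=> [K [s [c [c0 cE]]]].
  pose ds := undup (codom x ++ flatten [seq dom (c k) | k <- enum K]).
  pose a (z : I + K) (y : N) : R :=
    match z with inl i => (x i == y)%:R | inr k => - coeff y (c k) end.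
  pose rs (z : I + K) := match z with inl i => r i | inr k => s k end.
  have [|H [t [e [tE eE]]]] := @frob_flat_system R p charR flatR _ ds _ rs a.
    move=> y _; rewrite big_sumType /=.
    have := cE y; rewrite (raddf_sum (coeff y)) /= => h.
    rewrite (eq_bigr (fun i => coeff y (r i *: << x i >>))); last first.
      by move=> i _; rewrite powb coeffZ coeffU mul1r.
    rewrite h -big_split big1 //= => k _.
    by rewrite (frobN charR) mulrN subrr.
  exists H, t, (fun h i => e h (inl i)); split; first by move=> i; apply: (tE (inl i)).
  move=> h.
  transitivity (\sum_(y <- ds) (\sum_i e h (inl i) * (x i == y)%:R) *: y).
    rewrite (eq_bigr (fun y => \sum_i (e h (inl i) * (x i == y)%:R) *: y)); last first.
      by move=> y _; rewrite scaler_suml.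
    rewrite exchange_big; apply: eq_bigr => i _.
    have xi : x i \in ds by rewrite mem_undup mem_cat codom_f.
    rewrite (bigD1_seq (x i)) ?undup_uniq //= eqxx mulr1 big1 ?addr0 // => y.
    by rewrite eq_sym => /negPf->; rewrite mulr0 scale0r.
  rewrite big_seq (eq_bigr (fun y => \sum_k (e h (inr k) * coeff y (c k)) *: y)).
    rewrite -big_seq exchange_big big1 //= => k _.
    transitivity (e h (inr k) *: ev (c k)); last by rewrite c0 scaler0.
    rewrite (evE (ds := ds)) ?undup_uniq //.
      by rewrite scaler_sumr; apply: eq_bigr => y _; rewrite scalerA.
    move=> y hy; rewrite mem_undup mem_cat; apply/orP; right.
    by apply/flattenP; exists (dom (c k)) => //; apply: map_f; rewrite mem_enum.
  move=> y hy; rewrite -scaler_suml; congr (_ *: _).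
  have := eE h y hy; rewrite big_sumType /= => /eqP.
  rewrite addr_eq0 => /eqP ->; rewrite -sumrN; apply: eq_bigr => k _.
  by rewrite mulrN opprK.
Qed.

End Existence.

End FrobeniusPullback.

(** * Frobenius pullback of submodules and of graded modules *)

Section FrobeniusSpan.
Variables (R : comNzRingType) (p : nat).
Hypothesis charR : p \in [pchar R].

(** The submodule of [N'] spanned by the image under [phi] of [Z]; for a
    pullback this is the base change of the submodule [Z]. *)
Definition frob_span (N N' : lmodType R) (phi : N -> N') (Z : N -> Prop) (y : N') :=
  exists (I : finType) (r : I -> R) (x : I -> N),
    (forall i, Z (x i)) /\ y = \sum_i r i *: phi (x i).

Section OneMap.
Variables (N N' : lmodType R) (phi : N -> N').
Implicit Types Z : N -> Prop.

Lemma frob_span_submod Z : submod (frob_span phi Z).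
Proof.
split; first by exists void, (fun=> 0), (fun=> 0); split; [case|rewrite big_pred0 //; case].
move=> a y y' [I [r [x [hx ->]]]] [I' [r' [x' [hx' ->]]]].
exists (I + I')%type, (fun i => match i with inl i => a * r i | inr i => r' i end),
  (fun i => match i with inl i => x i | inr i => x' i end); split; first by case.
rewrite big_sumType /= scaler_sumr; congr (_ + _).
by apply: eq_bigr => i _; rewrite scalerA.
Qed.

Lemma frob_span_gen Z x : Z x -> frob_span phi Z (phi x).
Proof. by exists 'I_1, (fun=> 1), (fun=> x); split=> //; rewrite big_ord1 scale1r. Qed.

Lemma frob_span_min Z (S : N' -> Prop) : submod S -> (forall x, Z x -> S (phi x)) ->
  forall y, frob_span phi Z y -> S y.
Proof.
move=> hS h y [I [r [x [hx ->]]]]; apply: submod_sum => // i _.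
by apply: submodZ => //; apply: h.
Qed.

Lemma frob_span_sub Z1 Z2 y : (forall x, Z1 x -> Z2 x) ->
  frob_span phi Z1 y -> frob_span phi Z2 y.
Proof. by move=> h [I [r [x [hx ->]]]]; exists I, r, x; split=> // i; apply: h. Qed.

Lemma frob_span_all y : frob_pullback p phi -> frob_span phi (fun=> True) y.
Proof. by move=> h; have [I [r [x ->]]] := fp_gen h y; exists I, r, x. Qed.

Lemma frob_spanI Z1 Z2 y : frob_pullback p phi -> submod Z1 -> submod Z2 ->
  frob_span phi Z1 y -> frob_span phi Z2 y ->
  frob_span phi (fun x => Z1 x /\ Z2 x) y.
Proof.
move=> hphi hZ1 hZ2 [I [r [x [hx yE]]]] [J [t [w [hw yE']]]].
pose rs (z : I + J) := match z with inl i => r i | inr j => - t j end.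
pose xs (z : I + J) := match z with inl i => x i | inr j => w j end.
have [|H [s [c [rE cE]]]] := fp_flat hphi (r := rs) (x := xs).
  rewrite big_sumType /= -yE (eq_bigr (fun j => - (t j *: phi (w j)))).
    by rewrite sumrN -yE' subrr.
  by move=> j _; rewrite scaleNr.
exists H, s, (fun h => \sum_i c h (inl i) *: x i); split.
  move=> h; split; first by apply: submod_sum => // i _; apply: submodZ.
  have := cE h; rewrite big_sumType /= => /eqP; rewrite addr_eq0 => /eqP ->.
  by apply: submodN => //; apply: submod_sum => // i _; apply: submodZ.
rewrite yE -(semilinear_relation (fp_semilinear hphi)).
by apply: eq_bigr => i _; rewrite -(rE (inl i)).
Qed.

End OneMap.

(** Base change commutes with preimages: an equality [u' y = sum t_j psi (w j)]
    is a relation in [P'], and it comes from relations in [P]. *)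
Lemma frob_span_preim (N N' P P' : lmodType R) (phi : N -> N') (psi : P -> P')
    (u : {linear N -> P}) (u' : {linear N' -> P'}) (Q : P -> Prop) y :
  frob_pullback p phi -> frob_pullback p psi ->
  (forall x, u' (phi x) = psi (u x)) -> submod Q ->
  frob_span psi Q (u' y) -> frob_span phi (fun x => Q (u x)) y.
Proof.
move=> hphi hpsi hu hQ [J [t [w [hw uyE]]]].
have [I [r [x yE]]] := fp_gen hphi y.
pose rs (z : I + J) := match z with inl i => r i | inr j => - t j end.
pose xs (z : I + J) := match z with inl i => u (x i) | inr j => w j end.
have [|H [s [c [rE cE]]]] := fp_flat hpsi (r := rs) (x := xs).
  rewrite big_sumType /=.
  transitivity (u' y - \sum_j t j *: psi (w j)); last by rewrite uyE subrr.
  rewrite yE linear_sum -sumrN; congr (_ + _); apply: eq_bigr => i _.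
    by rewrite linearZ /= hu.
  by rewrite scaleNr.
exists H, s, (fun h => \sum_i c h (inl i) *: x i); split.
  move=> h; rewrite linear_sum.
  have := cE h; rewrite big_sumType /= => /eqP; rewrite addr_eq0 => /eqP E.
  rewrite (eq_bigr (fun i => c h (inl i) *: u (x i))); last first.
    by move=> i _; rewrite linearZ.
  rewrite E.
  by apply: submodN => //; apply: submod_sum => // i _; apply: submodZ.
rewrite yE -(semilinear_relation (fp_semilinear hphi)).
by apply: eq_bigr => i _; rewrite -(rE (inl i)).
Qed.

Lemma frob_span_ker (N N' P P' : lmodType R) (phi : N -> N') (psi : P -> P')
    (u : {linear N -> P}) (u' : {linear N' -> P'}) y :
  frob_pullback p phi -> frob_pullback p psi ->
  (forall x, u' (phi x) = psi (u x)) ->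
  u' y = 0 -> frob_span phi (fun x => u x = 0) y.
Proof.
move=> hphi hpsi hu uy; apply: (frob_span_preim hphi hpsi hu (Q := fun z => z = 0)).
  by split=> // a x z -> ->; rewrite scaler0 addr0.
rewrite uy; apply: submod0; exact: frob_span_submod.
Qed.

Definition tors (N : lmodType R) (s : seq R) (x : N) :=
  forall f, f \in s -> exists n, f ^+ n *: x = 0.

Lemma tors_submod (N : lmodType R) s : submod (@tors N s).
Proof.
split; first by move=> f _; exists 0%N; rewrite scaler0.
move=> a x y hx hy f hf; have [n hn] := hx f hf; have [k hk] := hy f hf.
exists (n + k)%N; rewrite scalerDr exprD.
rewrite -[in X in _ + X]scalerA hk scaler0 addr0.
by rewrite scalerA mulrC [f ^+ n * _]mulrC !mulrA -scalerA hn scaler0.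
Qed.

Lemma tors0 (N : lmodType R) s : tors s (0 : N).
Proof. exact: submod0 (tors_submod N s). Qed.

Lemma torsD (N : lmodType R) s (x y : N) : tors s x -> tors s y -> tors s (x + y).
Proof. exact: submodD (tors_submod N s). Qed.

Lemma torsB (N : lmodType R) s (x y : N) : tors s x -> tors s y -> tors s (x - y).
Proof. exact: submodB (tors_submod N s). Qed.

Lemma torsZ (N : lmodType R) s a (x : N) : tors s x -> tors s (a *: x).
Proof. exact: submodZ (tors_submod N s). Qed.

Lemma tors_hom (N P : lmodType R) s (u : {linear N -> P}) (x : N) :
  tors s x -> tors s (u x).
Proof.
by move=> h f hf; have [n hn] := h f hf; exists n; rewrite -linearZ /= hn raddf0.
Qed.

Lemma tors_semilinear (N P : lmodType R) s (phi : N -> P) (x : N) :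
  (forall a x y, phi (a *: x + y) = a ^+ p *: phi x + phi y) ->
  tors s x -> tors s (phi x).
Proof.
move=> hphi h f hf; have [n hn] := h f hf; exists (n * p)%N.
by rewrite exprM -(semilinearZ hphi) hn (semilinear0 hphi).
Qed.

(** Base change commutes with torsion: a relation [f ^ (n p) y = 0] comes from
    relations [f ^ n v = 0]. *)
Lemma frob_span_tors (N N' : lmodType R) (phi : N -> N') s y :
  frob_pullback p phi -> tors s y <-> frob_span phi (@tors N s) y.
Proof.
move=> hphi; split; last first.
  apply: frob_span_min; first exact: tors_submod.
  by move=> x; apply: tors_semilinear; apply: fp_semilinear hphi.
elim: s => [_|f s IH hy].
  by apply: frob_span_sub (frob_span_all y hphi) => x _ f.
have hf : frob_span phi (fun x => exists n, f ^+ n *: x = 0) y.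
  have [n hn] := hy f (mem_head _ _).
  have [I [r [x yE]]] := fp_gen hphi y.
  have [|H [t [c [rE cE]]]] := fp_flat hphi (r := r) (x := fun i => f ^+ n *: x i).
    transitivity (f ^+ (n * p) *: y); last first.
      rewrite -(subnK (leq_pmulr n (p_gt0 charR))) exprD -scalerA hn.
      by rewrite scaler0.
    rewrite yE scaler_sumr; apply: eq_bigr => i _.
    by rewrite (semilinearZ (fp_semilinear hphi)) -exprM !scalerA mulrC.
  exists H, t, (fun h => \sum_i c h i *: x i); split.
    move=> h; exists n; rewrite scaler_sumr -[RHS](cE h); apply: eq_bigr => i _.
    by rewrite !scalerA mulrC.
  rewrite yE -(semilinear_relation (fp_semilinear hphi)).
  by apply: eq_bigr => i _; rewrite -rE.
have hs : frob_span phi (@tors N s) y.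
  by apply: IH => g hg; apply: hy; rewrite in_cons hg orbT.
have hfsub : submod (fun x : N => exists n, f ^+ n *: x = 0).
  split; first by exists 0%N; rewrite scaler0.
  move=> a x z hx hz; have h := (@tors_submod N [:: f]).2 a x z.
  have [|||n hn] := h _ _ f; last by exists n.
  - by move=> g; rewrite inE => /eqP ->.
  - by move=> g; rewrite inE => /eqP ->.
  - by rewrite mem_head.
have := frob_spanI hphi hfsub (tors_submod N s) hf hs.
apply: frob_span_sub => x [h1 h2] g; rewrite in_cons => /orP[/eqP -> //|]; exact: h2.
Qed.

End FrobeniusSpan.

Section GradedPullback.
Variables (A : comNzRingType) (m p : nat).
Hypothesis charA : p \in [pchar A].
Local Notation R := {mpoly A[m]}.
Hypothesis flatR : frob_flat R p.
Let charR : p \in [pchar R] := pchar_mpoly m charA.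

Definition gr_semilinear (N N' : grmod A m) (phi : N -> N') :=
  (forall a x y, phi (a *: x + y) = a ^+ p *: phi x + phi y) /\
  forall n x, gr_comp n x -> gr_comp (p%:Z * n) (phi x).

Definition gr_frob_pullback (N N' : grmod A m) (phi : N -> N') :=
  frob_pullback p phi /\ forall n x, gr_comp n x -> gr_comp (p%:Z * n) (phi x).

(** The homogeneous components of a relation are relations: relations between
    homogeneous elements of [N] may be taken homogeneous. *)
Lemma relation_component (N : grmod A m) (N' : lmodType R) (phi : N -> N')
    (I : finType) (r : I -> R) (x : I -> N) (e : I -> int) n :
  frob_pullback p phi -> (forall i, gr_comp (e i) (x i)) ->
  \sum_i r i *: phi (x i) = 0 ->
  \sum_i prR (n - p%:Z * e i) (r i) *: phi (x i) = 0.
Proof.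
move=> hphi hx hr; have [H [s [c [rE cE]]]] := fp_flat hphi hr.
have hlin := fp_semilinear hphi.
have [S [uS hS]] := prR_support_large (fun hi : H * I => c hi.1 hi.2) (fun hi => e hi.2).
pose c' h k i := prR (k - e i) (c h i).
have cE' h k : \sum_i c' h k i *: x i = 0.
  have := congr1 (pr k) (cE h); rewrite pr0 pr_sum => E; rewrite -[RHS]E.
  by apply: eq_bigr => i _; rewrite (pr_scale_homog _ _ (hx i)).
have hc' h k i : R_comp (p%:Z * (k - e i)) (c' h k i ^+ p).
  rewrite /c'; have := R_comp_pr (k - e i) (c h i).
  case: (k - e i) => [d|d]; last first.
    move=> /= ->; rewrite (frob0 charR); exact: R_comp0.
  by rewrite -PoszM mulnC => hd; apply: dhomogMn.
rewrite (eq_bigr (fun i => \sum_h \sum_(k <- S)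
    (prR (n - p%:Z * k) (s h) * c' h k i ^+ p) *: phi (x i))); last first.
  move=> i _; rewrite rE prR_sum scaler_suml; apply: eq_bigr => h _.
  rewrite {1}(hS (h, i)) /= (frob_sum charR) mulr_sumr prR_sum scaler_suml.
  apply: eq_bigr => k _; congr (_ *: _).
  rewrite (prR_mul_homog _ _ (hc' h k i)); congr (prR _ _ * _).
  by rewrite mulrBr; ring.
rewrite exchange_big big1 //= => h _; rewrite exchange_big big1 //= => k _.
transitivity (prR (n - p%:Z * k) (s h) *: phi (\sum_i c' h k i *: x i)).
  rewrite (semilinear_sum hlin) scaler_sumr; apply: eq_bigr => i _.
  by rewrite (semilinearZ hlin) scalerA.
by rewrite cE' (semilinear0 hlin) scaler0.
Qed.

(** In a triple [(r, x, e)] the integer [e] is the degree of [x], which [x] does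
    not determine when it is 0. *)
Definition homog_expr (N : grmod A m) (N' : lmodType R) (phi : N -> N') n
    (l : seq (R * N * int)) (y : N') :=
  (forall t, t \in l -> R_comp (n - p%:Z * t.2) t.1.1 /\ gr_comp t.2 t.1.2) /\
  y = \sum_(t <- l) t.1.1 *: phi t.1.2.

Lemma relation_component_seq (N : grmod A m) (N' : lmodType R) (phi : N -> N')
    (l : seq (R * N * int)) n :
  frob_pullback p phi -> (forall t, t \in l -> gr_comp t.2 t.1.2) ->
  \sum_(t <- l) t.1.1 *: phi t.1.2 = 0 ->
  \sum_(t <- l) prR (n - p%:Z * t.2) t.1.1 *: phi t.1.2 = 0.
Proof.
move=> hphi hl; rewrite big_tnth => h; rewrite big_tnth.
apply: (relation_component n hphi (e := fun i => (tnth (in_tuple l) i).2) _ h).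
by move=> i; apply: hl; apply: mem_tnth.
Qed.

Lemma homog_expr_cat (N : grmod A m) (N' : lmodType R) (phi : N -> N') n l l' y y' :
  homog_expr phi n l y -> homog_expr phi n l' y' -> homog_expr phi n (l ++ l') (y + y').
Proof.
move=> [h1 ->] [h2 ->]; split; last by rewrite big_cat.
by move=> t; rewrite mem_cat => /orP[/h1|/h2].
Qed.

(** The pullback is graded by [deg (r * phi x) = deg r + p * deg x]; the
    components are independent by [relation_component]. *)
Lemma gr_frob_pullback_exists (N : grmod A m) :
  exists (N' : grmod A m) (phi : N -> N'), gr_frob_pullback phi.
Proof.
have [N' [phi hphi]] := frob_pullback_exists charR flatR N.
have hlin := fp_semilinear hphi.
pose c n (y : N') := exists l, homog_expr phi n l y.
have cD n x y : c n x -> c n y -> c n (x + y).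
  by move=> [l hl] [l' hl']; exists (l ++ l'); apply: homog_expr_cat.
have c0 n : c n 0 by exists [::]; split=> //; rewrite big_nil.
have cN n x : c n x -> c n (- x).
  move=> [l [hl ->]]; exists [seq (- t.1.1, t.1.2, t.2) | t <- l]; split.
    move=> t /mapP[t' /hl[h1 h2] ->]; split=> //=.
    by have := R_compB (@R_comp0 A m _) h1; rewrite sub0r.
  by rewrite big_map -sumrN; apply: eq_bigr => t _; rewrite scaleNr.
have cB n x y : c n x -> c n y -> c n (x - y) by move=> hx /cN; apply: cD.
have cZ (d : nat) n (a : R) x : a \is d.-homog -> c n x -> c (d%:Z + n) (a *: x).
  move=> ha [l [hl ->]]; exists [seq (a * t.1.1, t.1.2, t.2) | t <- l]; split.
    move=> t /mapP[t' /hl[h1 h2] ->]; split=> //=.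
    by rewrite -addrA; apply: R_compZ.
  by rewrite big_map scaler_sumr; apply: eq_bigr => t _; rewrite scalerA.
have cdec (y : N') : exists (s : seq int) (d : int -> N'),
    (forall n, c n (d n)) /\ y = \sum_(n <- s) d n.
  have [I [r [x ->]]] := fp_gen hphi y.
  have [S hS] := choice (fun i => prR_support (r i)).
  have [T hT] := choice (fun i => pr_support (x i)).
  pose term i (de : int * int) := prR de.1 (r i) *: phi (pr de.2 (x i)).
  pose l := flatten [seq [seq (i, de) | de <- [seq (d, e) | d <- S i, e <- T i]] | i <- enum I].
  exists (undup [seq t.2.1 + p%:Z * t.2.2 | t <- l]),
    (fun n => \sum_(t <- l | t.2.1 + p%:Z * t.2.2 == n) term t.1 t.2); split.
    move=> n; elim/big_ind: _ => //; first by move=> u v; apply: cD.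
    move=> t /eqP ht; exists [:: (prR t.2.1 (r t.1), pr t.2.2 (x t.1), t.2.2)].
    split; last by rewrite big_seq1.
    move=> u; rewrite inE => /eqP -> /=; rewrite -ht addrK.
    by split; [apply: R_comp_pr|apply: pr_comp].
  transitivity (\sum_(t <- l) term t.1 t.2).
    rewrite /l big_flatten big_map big_enum /=; apply: eq_bigr => i _.
    have [_ _ rE] := hS i; have [_ _ xE] := hT i.
    rewrite big_map big_allpairs {1}rE scaler_suml; apply: eq_bigr => d _.
    by rewrite {1}xE (semilinear_sum hlin) scaler_sumr.
  rewrite [RHS](exchange_big_dep xpredT) //= big_seq [RHS]big_seq.
  apply: eq_bigr => t ht.
  rewrite (big_rem (t.2.1 + p%:Z * t.2.2)) /= ?eqxx; last first.
    by rewrite mem_undup; apply/mapP; exists t.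
  rewrite big_seq_cond big1 ?addr0 // => k /andP[hk /eqP kE].
  by move: hk; rewrite -kE mem_rem_uniq ?undup_uniq // inE eqxx.
have cind (s : seq int) (d : int -> N') : uniq s -> (forall n, c n (d n)) ->
    \sum_(n <- s) d n = 0 -> forall n, n \in s -> d n = 0.
  move=> us hd d0 n hn; have [l hl] := choice hd.
  have : \sum_(t <- flatten [seq l k | k <- s]) prR (n - p%:Z * t.2) t.1.1 *: phi t.1.2 = 0.
    apply: relation_component_seq => // [t /flattenP[_ /mapP[k _ ->] ht]|].
      by have [h1 _] := hl k; case: (h1 t ht).
    rewrite big_flatten big_map -[RHS]d0; apply: eq_bigr => k _.
    by have [_ <-] := hl k.
  rewrite big_flatten big_map (eq_bigr (fun k => if k == n then d n else 0)).
    by rewrite (bigD1_seq n) //= eqxx big1 ?addr0 // => k /negPf->.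
  move=> k _; have [h1 h2] := hl k.
  rewrite big_seq (eq_bigr (fun t => if k == n then t.1.1 *: phi t.1.2 else 0)).
    by rewrite -big_seq; case: eqP => [<-|_]; [rewrite -h2|rewrite big1].
  move=> t /h1[ht _]; rewrite (prR_homog _ ht) (inj_eq (addIr _)) eq_sym.
  by case: ifP; rewrite // scale0r.
exists (GrMod c0 cB cZ cdec cind), phi; split=> // n x hx.
exists [:: (1, x, n)]; split; last by rewrite big_seq1 scale1r.
move=> t; rewrite inE => /eqP -> /=; rewrite subrr; split=> //.
exact: dhomog1.
Qed.

Lemma homog_exprP (N N' : grmod A m) (phi : N -> N') n y :
  gr_frob_pullback phi -> gr_comp n y -> exists l, homog_expr phi n l y.
Proof.
move=> [hphi hdeg] hy; rewrite -(pr_id hy) {hy}.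
have hlin := fp_semilinear hphi.
have [I [r [x ->]]] := fp_gen hphi y; rewrite pr_sum.
pose Q y := exists l, homog_expr phi n l y.
have Q0 : Q 0 by exists [::]; split=> //; rewrite big_nil.
have QD u v : Q u -> Q v -> Q (u + v).
  by move=> [l hl] [l' hl']; exists (l ++ l'); apply: homog_expr_cat.
apply: (big_ind Q) => // i _.
have [T [_ _ xE]] := pr_support (x i).
rewrite {1}xE (semilinear_sum hlin) scaler_sumr pr_sum.
apply: (big_ind Q) => // k _.
rewrite (pr_scale_homog n _ (hdeg k _ (pr_comp k (x i)))).
exists [:: (prR (n - p%:Z * k) (r i), pr k (x i), k)]; split; last by rewrite big_seq1.
move=> t; rewrite inE => /eqP -> /=; split; first exact: R_comp_pr.
exact: pr_comp.
Qed.

(** The universal property of the pullback; the extension is well defined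
    because relations between values of [phi] come from relations in [N]. *)
Lemma gr_frob_pullback_extend (N N' Q : grmod A m) (phi : N -> N') (psi : N -> Q) :
  gr_frob_pullback phi -> gr_semilinear psi ->
  exists u : grhom N' Q, forall x, u (phi x) = psi x.
Proof.
move=> hgr [psilin psideg]; have [hphi hdeg] := hgr.
have philin := fp_semilinear hphi.
have wd (I : finType) (r : I -> R) (x : I -> N) :
    \sum_i r i *: phi (x i) = 0 -> \sum_i r i *: psi (x i) = 0.
  move=> h; have [H [s [c [rE cE]]]] := fp_flat hphi h.
  rewrite (eq_bigr (fun i => (\sum_h s h * c h i ^+ p) *: psi (x i))); last first.
    by move=> i _; rewrite rE.
  rewrite (semilinear_relation psilin) big1 // => h' _.
  by rewrite cE (semilinear0 psilin) scaler0.
have ex (y : N') : exists z, exists (I : finType) (r : I -> R) (x : I -> N),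
    y = \sum_i r i *: phi (x i) /\ z = \sum_i r i *: psi (x i).
  have [I [r [x ->]]] := fp_gen hphi y.
  by exists (\sum_i r i *: psi (x i)), I, r, x.
have [f hf] := choice ex.
have fE (I : finType) (r : I -> R) (x : I -> N) y :
    y = \sum_i r i *: phi (x i) -> f y = \sum_i r i *: psi (x i).
  move=> yE; have [J [t [w [yE' ->]]]] := hf y.
  pose rs (z : I + J) := match z with inl i => r i | inr j => - t j end.
  pose xs (z : I + J) := match z with inl i => x i | inr j => w j end.
  have := wd (I + J)%type rs xs; rewrite !big_sumType /= => h.
  have sumN (V : lmodType R) (g : N -> V) :
      \sum_j - t j *: g (w j) = - \sum_j t j *: g (w j).
    by rewrite -sumrN; apply: eq_bigr => j _; rewrite scaleNr.
  apply/eqP; rewrite eq_sym -subr_eq0 -sumN h // sumN -yE -yE'.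
  by rewrite subrr.
have [|u hu] := @exists_linear R N' Q f.
  move=> a y y'; have [I [r [x [yE ->]]]] := hf y; have [J [t [w [yE' ->]]]] := hf y'.
  pose rs (z : I + J) := match z with inl i => a * r i | inr j => t j end.
  pose xs (z : I + J) := match z with inl i => x i | inr j => w j end.
  rewrite (fE (I + J)%type rs xs).
    rewrite big_sumType /= scaler_sumr; congr (_ + _).
    by apply: eq_bigr => i _; rewrite scalerA.
  rewrite big_sumType /= {1}yE {1}yE' scaler_sumr; congr (_ + _).
  by apply: eq_bigr => i _; rewrite scalerA.
have uphi x : u (phi x) = psi x.
  rewrite hu (fE 'I_1 (fun=> 1) (fun=> x)) ?big_ord1 ?scale1r //.
have uP n y : gr_comp n y -> gr_comp n (u y).
  move=> /(homog_exprP hgr)[l [hl ->]]; rewrite linear_sum big_seq.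
  apply: gr_comp_sum => t ht; rewrite linearZ /= uphi.
  have [h1 h2] := hl t ht; rewrite -(subrK (p%:Z * t.2) n).
  by apply: R_comp_scale h1 _; apply: psideg.
by exists (GrHom uP).
Qed.

End GradedPullback.

(** * Flasque modules *)

Section Flasque.
Variables (A : comNzRingType) (m : nat).
Local Notation R := {mpoly A[m]}.

Definition homogeneous (f : R) := exists d : nat, f \is d.-homog.

Definition all_homogeneous (s : seq R) := forall f, f \in s -> homogeneous f.

Lemma homogeneousX (f : R) n : homogeneous f -> homogeneous (f ^+ n).
Proof. by move=> [d hd]; exists (d * n)%N; apply: dhomogMn. Qed.

Lemma ftors_submod (V : lmodType R) (f : R) :
  submod (fun x : V => exists e, f ^+ e *: x = 0).
Proof.
suff -> : (fun x : V => exists e, f ^+ e *: x = 0) = tors [:: f].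
  exact: tors_submod.
apply/funext => x; apply/propext; split=> [h g|h]; last by apply: h; rewrite mem_head.
by rewrite inE => /eqP ->.
Qed.

(** The submodule [S] is flasque when, for all [s] and [f], the sections of [S]
    supported on [V(s)] map onto the sections over [D(f)] supported there. *)
Definition flasque (V : lmodType R) (S : V -> Prop) :=
  forall s f x, all_homogeneous s -> homogeneous f -> S x -> tors s x ->
  exists y, [/\ S y, tors s y & exists e, f ^+ e *: (x - f *: y) = 0].

Notation flasque_module V := (@flasque V (fun=> True)).

(** Lift one condition of support at a time: if [f ^ e] kills [w], then
    [f ^ e *: v] is a section of the kernel, which is divisible by [f ^ e] there
    up to [f]-torsion; this corrects [v]. *)
Lemma flasque_lift (V W : lmodType R) (u : {linear V -> W}) s w :
  flasque (fun v => u v = 0) -> all_homogeneous s -> (exists v, u v = w) ->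
  tors s w -> exists v, tors s v /\ u v = w.
Proof.
move=> flK hs [v0 uv0]; elim: s hs => [|f s IH] hs ht; first by exists v0.
have hs' : all_homogeneous s by move=> g hg; apply: hs; rewrite in_cons hg orbT.
have [v [tv uv]] : exists v, tors s v /\ u v = w.
  by apply: IH => // g hg; apply: ht; rewrite in_cons hg orbT.
have [e he] := ht f (mem_head _ _).
have [|||y [uy ty [k hk]]] := flK s (f ^+ e) (f ^+ e *: v) hs'.
- by apply: homogeneousX; apply: hs; apply: mem_head.
- by rewrite linearZ /= uv.
- exact: torsZ.
exists (v - y); split; last by rewrite linearB /= uv uy subr0.
move=> g; rewrite in_cons => /orP[/eqP -> {g}|]; last first.
  by apply: (torsB tv ty).
by exists (e * k + e)%N; rewrite exprD exprM -scalerA scalerBr.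
Qed.

Lemma flasque_image (V W : lmodType R) (u : {linear V -> W}) :
  flasque_module V -> flasque (fun v => u v = 0) -> flasque (fun w => exists v, u v = w).
Proof.
move=> flV flK s f w hs hf hw tw.
have [v [tv uv]] := flasque_lift flK hs hw tw.
have [y [_ ty [e he]]] := flV s f v hs hf I tv.
exists (u y); split; [by exists y|exact: tors_hom|exists e].
by rewrite -uv -linearZ -linearB -linearZ /= he raddf0.
Qed.

(** The kernels of all the differentials are flasque, by induction from the left
    end of the complex, so sections with support lift through each of them. *)
Lemma flasque_exact (C : nat -> lmodType R) (d : forall j, {linear C j -> C j.+1}) :
  (forall j, flasque_module (C j)) -> (forall x, d 0%N x = 0 -> x = 0) ->
  (forall j x, d j.+1 x = 0 <-> exists y, d j y = x) ->
  forall j s x, all_homogeneous s -> tors s x -> d j.+1 x = 0 ->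
  exists y, tors s y /\ d j y = x.
Proof.
move=> flC inj0 exd.
have flK j : flasque (fun x => d j x = 0).
  elim: j => [|j IH].
    move=> s f x hs hf /inj0 -> _; exists 0; split; first exact: raddf0.
      exact: tors0.
    by exists 0%N; rewrite scaler0 subrr scaler0.
  suff -> : (fun x => d j.+1 x = 0) = (fun x => exists y, d j y = x).
    exact: flasque_image.
  by apply/funext => x; apply/propext; apply: exd.
by move=> j s x hs tx /exd hx; apply: flasque_lift.
Qed.

Lemma flasque_prod (V W : lmodType R) :
  flasque_module V -> flasque_module W -> flasque_module (V * W)%type.
Proof.
move=> flV flW s f [x z] hs hf _ txz.
have [|y [_ ty [e he]]] := flV s f x hs hf I.
  by move=> g /txz[n hn]; exists n; have := congr1 fst hn.
have [|y' [_ ty' [e' he']]] := flW s f z hs hf I.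
  by move=> g /txz[n hn]; exists n; have := congr1 snd hn.
exists (y, y'); split=> // [g hg|].
  have [n hn] := ty g hg; have [n' hn'] := ty' g hg.
  exists (n + n')%N; congr (_, _); rewrite /= exprD.
    by rewrite mulrC -scalerA hn scaler0.
  by rewrite -scalerA hn' scaler0.
exists (e + e')%N; congr (_, _); rewrite /= exprD.
  by rewrite mulrC -scalerA he scaler0.
by rewrite -scalerA he' scaler0.
Qed.

Lemma flasque_pullback p (charA : p \in [pchar A]) (N N' : lmodType R) (phi : N -> N') :
  frob_pullback p phi -> flasque_module N -> flasque_module N'.
Proof.
move=> hphi flN s f y hs hf _ ty.
have charR := pchar_mpoly m charA; have hlin := fp_semilinear hphi.
pose Q (y : N') := exists y', tors s y' /\ exists e, f ^+ e *: (y - f *: y') = 0.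
suff : Q y by move=> [y' [h1 h2]]; exists y'.
have hQ : submod Q.
  split.
    exists 0; split; first exact: tors0.
    by exists 0%N; rewrite scaler0 subrr scaler0.
  move=> a z w [z' [tz hz]] [w' [tw hw]]; exists (a *: z' + w'); split.
    exact: (tors_submod N' s).2.
  have := (ftors_submod N' f).2 a _ _ hz hw.
  by rewrite scalerBr scalerDr opprD addrACA !scalerA [a * f]mulrC.
move/(frob_span_tors charR s y hphi): ty; apply: frob_span_min => // x tx.
have [x' [_ tx' [e he]]] := flN s f x hs hf I tx.
exists (f ^+ p.-1 *: phi x'); split.
  by apply: torsZ; exact: (tors_semilinear hlin).
exists (e * p)%N; rewrite scalerA -exprS prednK ?(p_gt0 charA) //.
by rewrite exprM -(semilinearZ hlin) -(semilinearB hlin) -(semilinearZ hlin) he (semilinear0 hlin).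
Qed.

Lemma tors_pr (M : grmod A m) s n (x : M) : all_homogeneous s -> tors s x -> tors s (pr n x).
Proof.
move=> hs tx f hf; have [d hd] := hs f hf; have [e he] := tx f hf; exists e.
have := prZ (n + (d * e)%N%:Z) x (dhomogMn e hd).
by rewrite he pr0 addrK.
Qed.

Lemma gr_submod_span k (L : 'I_k -> R) (dL : 'I_k -> nat) :
  (forall i, L i \is (dL i).-homog) -> @gr_submod A m (gr_R A m) (Defs.span L).
Proof.
move=> hL; split; first split.
- by apply: ideal0; apply: span_ideal.
- by move=> a x y hx hy; apply: idealD; [exact: span_ideal| |exact: hy];
     apply: idealM; [exact: span_ideal|].
- move=> n x [c ->]; exists (fun i => prR (n - (dL i)%:Z) (c i)).
  rewrite -[LHS]/(prR n _) prR_sum; apply: eq_bigr => i _.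
  by apply: prR_mul_homog; apply: hL.
Qed.

Hypothesis noethR : noetherian R.

(** Adjoin to [J] high powers of the members of [s], one after the other. *)
Lemma torsion_separation_seq (J : R -> Prop) b (s : seq R) : ideal J ->
  (forall g, g \in s -> exists n, J (g ^+ n * b)) ->
  exists K, [/\ ideal K, forall x, J x -> K x,
    forall g, g \in s -> exists n, K (g ^+ n) & forall c, K (c * b) -> J (c * b)].
Proof.
move=> hJ; elim: s => [|g s IH] hs; first by exists J; split.
have [|K [hK JK Ks Kb]] := IH.
  by move=> h hh; apply: hs; rewrite in_cons hh orbT.
have [N hN] := hs g (mem_head _ _).
have [n hn] := torsion_separation noethR hK (JK _ hN).
exists (adjoin K (g ^+ n)); split.
- exact: adjoin_ideal.
- by move=> x /JK; apply: adjoin_sub.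
- move=> h; rewrite in_cons => /orP[/eqP ->|/Ks[k hk]].
    by exists n; apply: adjoin_gen.
  by exists k; apply: adjoin_sub.
- by move=> c [w /hn]; apply: Kb.
Qed.

(** For [e] large, [f ^ e.+1 |-> f ^ e *: x] defines a map that vanishes on high
    powers of the members of [s], on the ideal generated by all these elements;
    the image of 1 under an extension to the ring is the element sought. *)
Lemma injective_flasque_homog (E : grmod A m) s f n (x : E) :
  gr_injective E -> all_homogeneous s -> homogeneous f -> gr_comp n x -> tors s x ->
  exists y : E, tors s y /\ exists e, f ^+ e *: (x - f *: y) = 0.
Proof.
move=> injE hs [d hd] hx tx.
have [||e he] := acc noethR (I := fun k a => a *: (f ^+ k *: x) = 0).
- move=> k; split; first by rewrite scale0r.
    by move=> a b ha hb; rewrite scalerDl ha hb addr0.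
  by move=> a b hb; rewrite -scalerA hb scaler0.
- move=> k a ha; have -> : a *: (f ^+ k.+1 *: x) = f *: (a *: (f ^+ k *: x)).
    by rewrite exprS !scalerA; congr (_ *: _); ring.
  by rewrite ha scaler0.
(* if [c * b] is in [J] then [c] kills [f ^ e *: x], by the choice of [e] *)
pose b := f ^+ e.+1.
pose J c := exists a, a *: (f ^+ e *: x) = 0 /\ c = a * b.
have hJ : ideal J.
  split.
  - by exists 0; rewrite scale0r mul0r.
  - move=> c c' [a [ha ->]] [a' [ha' ->]]; exists (a + a').
    by rewrite scalerDl ha ha' addr0 mulrDl.
  - by move=> c c' [a [ha ->]]; exists (c * a); rewrite -scalerA ha scaler0 mulrA.
have [|K [hK JK Ks Kb]] := @torsion_separation_seq J b s hJ.
  move=> g hg; have [k hk] := tx g hg; exists k, (g ^+ k); split=> //.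
  by rewrite scalerA mulrC -scalerA hk scaler0.
have [k hk] : exists k : R -> nat, forall g, g \in s -> K (g ^+ k g).
  suff h g : exists n, g \in s -> K (g ^+ n) by have [k hk] := choice h; exists k.
  by case: (boolP (g \in s)) => [/Ks[l hl]|_]; [exists l|exists 0%N].
pose L (i : 'I_(size s).+1) : R :=
  if unlift ord0 i is Some j then s`_j ^+ k s`_j else b.
have L0 : L ord0 = b by rewrite /L unlift_none.
have LS j : L (fintype.lift ord0 j) = s`_j ^+ k s`_j by rewrite /L liftK.
have [dL hL] : exists dL : 'I_(size s).+1 -> nat,
    forall i, L i \is (dL i).-homog /\ (i = ord0 -> dL i = (d * e.+1)%N).
  suff h i : exists dl : nat, L i \is dl.-homog /\ (i = ord0 -> dl = (d * e.+1)%N).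
    by have [dL hL] := choice h; exists dL.
  case: (unliftP ord0 i) => [j ->|->].
    have [dj hj] := homogeneousX (k s`_j) (hs _ (mem_nth 0 (ltn_ord j))).
    by exists dj; rewrite LS.
  by exists (d * e.+1)%N; rewrite L0; split=> //; apply: dhomogMn.
have sumL (c : 'I_(size s).+1 -> R) :
    \sum_i c i * L i = c ord0 * b + \sum_j c (fintype.lift ord0 j) * L (fintype.lift ord0 j).
  by rewrite big_ord_recl L0.
have wd (c c' : 'I_(size s).+1 -> R) : \sum_i c i * L i = \sum_i c' i * L i ->
    c ord0 *: (f ^+ e *: x) = c' ord0 *: (f ^+ e *: x).
  rewrite !sumL => hcc.
  have [|a [ha hab]] := Kb (c ord0 - c' ord0).
    have -> : (c ord0 - c' ord0) * b =
        \sum_j (c' (fintype.lift ord0 j) - c (fintype.lift ord0 j)) * L (fintype.lift ord0 j).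
      rewrite (eq_bigr (fun j => c' (fintype.lift ord0 j) * L (fintype.lift ord0 j)
         - c (fintype.lift ord0 j) * L (fintype.lift ord0 j))) => [|j _]; last by rewrite mulrBl.
      rewrite sumrB mulrBl.
      have -> : c ord0 * b = c' ord0 * b + \sum_j c' (fintype.lift ord0 j) * L (fintype.lift ord0 j)
          - \sum_j c (fintype.lift ord0 j) * L (fintype.lift ord0 j).
        by rewrite -hcc addrK.
      by rewrite addrAC [c' ord0 * b + _]addrC addrK.
    apply: ideal_sum => // j _; apply: idealM => //; rewrite LS.
    by apply: hk; apply: mem_nth.
  apply/eqP; rewrite -subr_eq0 -scalerBl; apply/eqP.
  have h0 : (c ord0 - c' ord0 - a) *: (f ^+ e *: x) = 0.
    apply: (he e.+1); rewrite /= scalerA mulrBl.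
    by rewrite -/b hab subrr scale0r.
  by move: h0; rewrite [(_ - a) *: _]scalerBl ha subr0.
have [c0 hc0] : exists c0 : R -> R, forall z, Defs.span L z ->
    exists c, z = \sum_i c i * L i /\ c0 z = c ord0.
  suff h z : exists a, Defs.span L z ->
      exists c, z = \sum_i c i * L i /\ a = c ord0.
    by have [c0 hc0] := choice h; exists c0.
  case: (pselect (Defs.span L z)) => [[c zE]|nz].
    by exists (c ord0) => _; exists c.
  by exists 0.
have c0E c z : z = \sum_i c i * L i -> c0 z *: (f ^+ e *: x) = c ord0 *: (f ^+ e *: x).
  move=> zE; have [|c' [zE' ->]] := hc0 z; first by exists c.
  by apply: wd; rewrite -zE -zE'.
have [Sh [i [j [ij ji hSh]]]] := gr_shift (gr_R A m) (d%:Z - n).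
have Spr : @gr_submod A m (gr_R A m) (Defs.span L).
  exact: (gr_submod_span (fun l => (hL l).1)).
have [|||g hg] := @gr_injective_extend A m E Sh (fun y => Defs.span L (i y))
    (fun y => c0 (i y) *: (f ^+ e *: x)) injE.
- split; first split.
  + by rewrite raddf0; exact: (ideal0 (span_ideal L)).
  + by move=> a y z hy hz; rewrite linearP; apply: Spr.1.2.
  + move=> l y hy; rewrite (shift_pr (i := i) (c := d%:Z - n)); first exact: Spr.2.
    by move=> q z; rewrite hSh.
- move=> a y z hy hz; have [c [yE ->]] := hc0 _ hy; have [c' [zE ->]] := hc0 _ hz.
  have iE : i (a *: y + z) = \sum_l (a * c l + c' l) * L l.
    rewrite linearP yE zE -[a *: _]/(a * _) mulr_sumr -big_split.
    by apply: eq_bigr => l _; rewrite /= mulrDl mulrA.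
  by rewrite (c0E _ _ iE) scalerDl [a *: (_ *: _)]scalerA.
- move=> q y hy; rewrite hSh => qy; have [c [yE _]] := hc0 _ hy.
  rewrite (c0E (fun l => prR (q + (d%:Z - n) - (dL l)%:Z) (c l))).
    have qE : (q + (d%:Z - n) - (dL ord0)%:Z) + ((d * e)%N%:Z + n) = q.
      by rewrite (hL ord0).2 // mulnS PoszD; ring.
    rewrite -{1}qE; apply: R_comp_scale; first exact: R_comp_pr.
    by apply: gr_compZ => //; apply: dhomogMn.
  rewrite -(prR_id qy) yE prR_sum; apply: eq_bigr => l _.
  by apply: prR_mul_homog; case: (hL l).
have gj (a : R) : a *: g (j 1) = g (j a).
  by rewrite -linearZ -linearZ /GRing.scale /= mulr1.
have gL (l : 'I_(size s).+1) : g (j (L l)) = (l == ord0)%:R *: (f ^+ e *: x).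
  have lE : L l = \sum_i (i == l)%:R * L i.
    by rewrite (bigD1 l) //= eqxx mul1r big1 ?addr0 // => q /negPf->; rewrite mul0r.
  rewrite hg ji; first by rewrite (c0E (fun q => (q == l)%:R) _ lE) eq_sym.
  by exists (fun q => (q == l)%:R).
exists (g (j 1)); split.
  move=> h hh; exists (k h).
  have hi : (index h s < size s)%N by rewrite index_mem.
  have := gL (fintype.lift ord0 (Ordinal hi)); rewrite LS /= nth_index // => E1.
  by rewrite gj E1 scale0r.
exists e; rewrite scalerBr scalerA -exprSr gj -/b -L0 gL eqxx scale1r.
by rewrite subrr.
Qed.

Lemma injective_flasque (E : grmod A m) : gr_injective E -> flasque_module E.
Proof.
move=> injE s f x hs hf _ tx.
pose Q (x : E) := exists y, tors s y /\ exists e, f ^+ e *: (x - f *: y) = 0.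
suff : Q x by move=> [y [h1 h2]]; exists y.
have [S [_ _ ->]] := pr_support x.
apply: (big_ind Q).
- exists 0; split; first exact: tors0.
  by exists 0%N; rewrite scaler0 subrr scaler0.
- move=> u v [y [ty hy]] [z [tz hz]]; exists (y + z); split.
    exact: torsD.
  have := submodD (ftors_submod E f) hy hz.
  by rewrite scalerDr opprD addrACA.
- move=> n _; apply: injective_flasque_homog (pr_comp n x) _ => //.
  exact: tors_pr.
Qed.

End Flasque.

(** * Cohomology with supports and Frobenius pullback *)

Section Complexes.
Variables (A : comNzRingType) (m p : nat).
Hypothesis charA : p \in [pchar A].
Local Notation R := {mpoly A[m]}.
Let charR : p \in [pchar R] := pchar_mpoly m charA.

(** The complexes of graded modules that arise from [gr_resolution] and from the
    pullback of its terms, which need not be injective. *)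
Record gcomplex := GComplex {
  gob :> nat -> grmod A m;
  gd : forall j, grhom (gob j) (gob j.+1);
  gdd : forall j x, gd j.+1 (gd j x) = 0
}.

Section Cohomology.
Variables (C : gcomplex) (s'' s' : seq R).

(** The cohomology of sections with support in [V(s'')], modulo sections with
    support in [V(s')], for an arbitrary complex. *)
Definition cocyc i (x : C i) := tors s'' x /\ tors s' (gd C i x).

Definition bound_from i : C i -> Prop :=
  match i with
  | 0 => fun x => x = 0
  | j.+1 => fun x => exists y : C j, tors s'' y /\ x = gd C j y
  end.

Definition cobound i (x : C i) :=
  exists a b, [/\ tors s' a, bound_from b & x = a + b].

Lemma bound_from_submod i : submod (@bound_from i).
Proof.
case: i => [|i] /=.
  by split=> // a x y -> ->; rewrite scaler0 addr0.
split; first by exists 0; rewrite raddf0; split=> //; apply: tors0.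
move=> a x y [u [tu ->]] [v [tv ->]]; exists (a *: u + v); rewrite linearP.
by split=> //; apply: (tors_submod _ s'').2.
Qed.

Lemma cobound_submod i : submod (@cobound i).
Proof.
split.
  by exists 0, 0; rewrite addr0; split=> //; [apply: tors0|apply: submod0 (bound_from_submod i)].
move=> a x y [u [v [tu bv ->]]] [u' [v' [tu' bv' ->]]].
exists (a *: u + u'), (a *: v + v'); split.
- exact: (tors_submod _ s').2.
- exact: (bound_from_submod i).2.
- by rewrite scalerDr addrACA.
Qed.

Lemma cocyc_submod i : submod (@cocyc i).
Proof.
split; first by split; rewrite ?raddf0; apply: tors0.
move=> a x y [tx dx] [ty dy]; split; first exact: (tors_submod _ s'').2.
by rewrite linearP; apply: (tors_submod _ s').2.
Qed.

Lemma bound_from_gd i x : @bound_from i x -> gd C i x = 0.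
Proof. by case: i x => [x ->|i x [y [_ ->]]]; rewrite ?raddf0 // gdd. Qed.

Hypotheses (hs'' : all_homogeneous s'') (hs' : all_homogeneous s').

Lemma bound_from_pr i n x : @bound_from i x -> bound_from (pr n x).
Proof.
case: i x => [x ->|i x [y [ty ->]]] /=; first by rewrite pr0.
by exists (pr n y); rewrite pr_hom; split=> //; apply: tors_pr.
Qed.

Lemma cobound_pr i n x : @cobound i x -> cobound (pr n x).
Proof.
move=> [a [b [ta bb ->]]]; exists (pr n a), (pr n b); rewrite prD.
by split=> //; [apply: tors_pr|apply: bound_from_pr].
Qed.

Lemma cocyc_pr i n x : @cocyc i x -> cocyc (pr n x).
Proof.
by move=> [tx dx]; split; [apply: tors_pr|rewrite -pr_hom; apply: tors_pr].
Qed.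

End Cohomology.

Definition cpx_pullback (C C' : gcomplex) (phi : forall j, C j -> C' j) :=
  (forall j, gr_frob_pullback p (phi j)) /\
  forall j x, gd C' j (phi j x) = phi j.+1 (gd C j x).

Section PullbackCohomology.
Variables (C C' : gcomplex) (phi : forall j, C j -> C' j).
Arguments phi : clear implicits.
Hypothesis hphi : cpx_pullback phi.
Let hp j : frob_pullback p (phi j) := (hphi.1 j).1.
Let hd := hphi.2.

Lemma bound_from_pullback s i y :
  bound_from s y <-> frob_span (phi i) (@bound_from C s i) y.
Proof.
split; last first.
  apply: frob_span_min; first exact: bound_from_submod.
  case: i {y} => [|i] x /=; first by move=> ->; apply: semilinear0 (fp_semilinear (hp 0%N)).
  move=> [u [tu ->]]; exists (phi i u); rewrite hd; split=> //.
  exact: (tors_semilinear (fp_semilinear (hp i))).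
case: i y => [y ->|i y [u [tu ->]]] /=; first exact: submod0 (frob_span_submod _ _).
have /(frob_span_tors charR s u (hp i)) [I [r [x [tx ->]]]] := tu.
exists I, r, (fun k => gd C i (x k)); split; first by move=> k; exists (x k).
rewrite linear_sum; apply: eq_bigr => k _; rewrite linearZ /=.
by rewrite hd.
Qed.

Lemma cobound_pullback s'' s' i y :
  cobound s'' s' y <-> frob_span (phi i) (@cobound C s'' s' i) y.
Proof.
split; last first.
  apply: frob_span_min; first exact: cobound_submod.
  move=> x [a [b [ta bb ->]]]; exists (phi i a), (phi i b).
  split; last exact: (semilinearD (fp_semilinear (hp i))).
    exact: (tors_semilinear (fp_semilinear (hp i))).
  by apply/bound_from_pullback; apply: frob_span_gen.
move=> [a [b [/(frob_span_tors charR s' a (hp i)) ha /bound_from_pullback hb ->]]].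
apply: submodD; first exact: frob_span_submod.
  apply: frob_span_sub ha => x tx; exists x, 0; rewrite addr0; split=> //.
  exact: submod0 (bound_from_submod C s'' i).
apply: frob_span_sub hb => x bx; exists 0, x; rewrite add0r; split=> //.
exact: tors0.
Qed.

Lemma gd_pullback i (Q : C i.+1 -> Prop) y : submod Q ->
  frob_span (phi i.+1) Q (gd C' i y) <->
  frob_span (phi i) (fun x => Q (gd C i x)) y.
Proof.
move=> hQ; split; first exact: (frob_span_preim (hp i) (hp i.+1) (@hd i) hQ).
move=> [I [r [x [hx ->]]]]; rewrite linear_sum.
apply: submod_sum => [|k _]; first exact: frob_span_submod.
rewrite linearZ /= hd; apply: submodZ; first exact: frob_span_submod.
exact: frob_span_gen.
Qed.

Lemma frob_span_and i (Z1 Z2 : C i -> Prop) y : submod Z1 -> submod Z2 ->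
  (frob_span (phi i) Z1 y /\ frob_span (phi i) Z2 y) <->
  frob_span (phi i) (fun x => Z1 x /\ Z2 x) y.
Proof.
move=> h1 h2; split; first by case; apply: frob_spanI.
by move=> h; split; apply: frob_span_sub h => x [].
Qed.

Lemma submod_preim i (Q : C i.+1 -> Prop) : submod Q -> submod (fun x => Q (gd C i x)).
Proof.
move=> hQ; split; first by rewrite raddf0; apply: submod0.
by move=> a x z hx hz; rewrite linearP; apply: hQ.2.
Qed.

Lemma cocyc_pullback s'' s' i y :
  cocyc s'' s' y <-> frob_span (phi i) (@cocyc C s'' s' i) y.
Proof.
rewrite /cocyc -frob_span_and; last first.
- exact: submod_preim (tors_submod _ _).
- exact: tors_submod.
rewrite -gd_pullback; last exact: tors_submod.
by rewrite -(frob_span_tors charR s'' y (hp i)) -(frob_span_tors charR s' _ (hp i.+1)).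
Qed.

End PullbackCohomology.

Section Comparison.
Variables (C' C : gcomplex) (psi : forall j, grhom (C' j) (C j)).

(** The cone of [psi] is exact, even after taking sections with support.  Its
    term in degree [i.+1] is [C' i.+1 * C i]; the second clause is exactness in
    degree 0, where the cone is [C' 0]. *)
Definition acyclic_cone :=
  (forall j x, gd C j (psi j x) = psi j.+1 (gd C' j x)) /\
  (forall x, gd C' 0 x = 0 -> psi 0%N x = 0 -> x = 0) /\
  forall s, all_homogeneous s -> forall i (x : C' i.+1) (y : C i),
    tors s x -> tors s y -> gd C' i.+1 x = 0 -> psi i.+1 x = gd C i y ->
    exists u b, [/\ tors s u, bound_from s b, x = gd C' i u & y = psi i u - b].

Definition iso_on i (Z' B' : C' i -> Prop) (Z B : C i -> Prop) :=
  [/\ forall x, Z' x -> Z (psi i x), forall x, B' x -> B (psi i x),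
      forall z, Z z -> exists z', Z' z' /\ B (z - psi i z')
    & forall z', Z' z' -> B (psi i z') -> B' z'].

Hypothesis hpsi : acyclic_cone.

Lemma psi_bound_from s i x : bound_from s x -> bound_from s (psi i x).
Proof.
case: i x => [x ->|i x [y [ty ->]]] /=; first exact: raddf0.
by exists (psi i y); rewrite hpsi.1; split=> //; apply: tors_hom.
Qed.

Lemma cone_bound_from s i (x : C' i) : all_homogeneous s ->
  tors s x -> gd C' i x = 0 -> bound_from s (psi i x) -> bound_from s x.
Proof.
move=> hs; case: i x => [|i] x /=; first by move=> _; apply: hpsi.2.1.
move=> tx dx [y [ty E]].
by have [u [b [tu _ -> _]]] := hpsi.2.2 s hs i x y tx ty dx E; exists u.
Qed.

Lemma bound_from_incl s s' (D : gcomplex) i (x : D i) :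
  (forall (N : grmod A m) (x : N), tors s x -> tors s' x) ->
  bound_from s x -> bound_from s' x.
Proof.
by move=> h; case: i x => [|i] x //= [y [ty ->]]; exists y; split=> //; apply: h.
Qed.

(** The argument of the five lemma: compare first the boundaries, by exactness of
    the cone with support [s'], then the cochains, by exactness with support
    [s''].  Absolute cohomology is the case where [s'] contains 1. *)
Lemma iso_relative s'' s' i : all_homogeneous s'' -> all_homogeneous s' ->
  (forall (N : grmod A m) (x : N), tors s' x -> tors s'' x) ->
  iso_on (@cocyc C' s'' s' i) (@cobound C' s'' s' i)
         (@cocyc C s'' s' i) (@cobound C s'' s' i).
Proof.
move=> hs'' hs' incl; split.
- by move=> x [tx dx]; split; [|rewrite hpsi.1]; apply: tors_hom.
- move=> x [a [b [ta bb ->]]]; exists (psi i a), (psi i b); rewrite raddfD.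
  by split=> //; [apply: tors_hom|apply: psi_bound_from].
- move=> x [tx dx].
  have [||u [v [tu bv E1 E2]]] := hpsi.2.2 s' hs' i.+1 0 (gd C i x) (@tors0 R (C' i.+2) s') dx.
  + exact: raddf0.
  + by rewrite gdd raddf0.
  move: bv => /= [w [tw vE]].
  have [|||z' [b [tz bb uE xE]]] := hpsi.2.2 s'' hs'' i u (x + w) (incl _ _ tu).
  + by apply: torsD => //; apply: incl.
  + by rewrite -E1.
  + by rewrite raddfD /= -vE E2 subrK.
  exists z'; split; first by split=> //; rewrite -uE.
  exists (- w), (- b); split.
  + by rewrite -sub0r; apply: torsB => //; apply: tors0.
  + exact: submodN (bound_from_submod _ _ _) bb.
  + have -> : x = psi i z' - b - w by rewrite -xE addrK.
    by rewrite [psi i z' - b]addrC addrAC addrK addrC.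
- move=> z [tz dz] [a [b [ta bb E]]].
  have [||u [c [tu bc uE aE]]] := hpsi.2.2 s' hs' i (gd C' i z) a dz ta.
  + exact: gdd.
  + by rewrite -hpsi.1 E raddfD /= (bound_from_gd bb) addr0.
  exists u, (z - u); split=> //; last by rewrite addrC subrK.
  apply: cone_bound_from => //.
  + by apply: torsB => //; apply: incl.
  + by rewrite raddfB /= -uE subrr.
  + rewrite raddfB /= E aE.
    have -> : psi i u - c + b - psi i u = b - c.
      by rewrite addrAC [psi i u - c]addrC addrK addrC.
    apply: submodB => //; first exact: bound_from_submod.
    exact: (bound_from_incl incl bc).
Qed.

End Comparison.
End Complexes.

(** * Frobenius pullback of an injective resolution *)

Section Resolutions.
Variables (A : comNzRingType) (m p : nat).
Hypothesis charA : p \in [pchar A].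
Local Notation R := {mpoly A[m]}.
Hypotheses (flatR : frob_flat R p) (noethR : noetherian R).
Let charR : p \in [pchar R] := pchar_mpoly m charA.

Definition grhom_comp (M N P : grmod A m) (v : grhom N P) (u : grhom M N) : grhom M P :=
  @GrHom A m M P (v \o u) (fun n x hx => gr_funP v (gr_funP u hx)).

(** Injectivity for maps [u] that are not injective: [f] factors through the
    image of [u]. *)
Lemma gr_injective_along (E N P : grmod A m) (u : grhom N P) (f : grhom N E) :
  gr_injective E -> (forall x, u x = 0 -> f x = 0) ->
  exists g : grhom P E, forall x, g (u x) = f x.
Proof.
move=> injE ker.
have wd x y : u x = u y -> f x = f y.
  move=> /eqP; rewrite -subr_eq0 -raddfB => /eqP /ker; rewrite raddfB => /eqP.
  by rewrite subr_eq0 => /eqP.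
have [h hh] : exists h : P -> E, forall x, h (u x) = f x.
  suff ex y : exists z, forall x, u x = y -> f x = z.
    by have [h hh] := choice ex; exists h => x; apply/esym/hh.
  case: (pselect (exists x, u x = y)) => [[x <-]|n]; first by exists (f x) => z; apply: wd.
  by exists 0 => x hx; case: n; exists x.
have [|||g hg] := @gr_injective_extend A m E P (fun y => exists x, u x = y) h injE.
- split; first split; first by exists 0; rewrite raddf0.
    by move=> a _ _ [x <-] [y <-]; exists (a *: x + y); rewrite linearP.
  by move=> n _ [x <-]; exists (pr n x); rewrite pr_hom.
- by move=> a _ _ [x <-] [y <-]; rewrite -linearP !hh linearP.
- move=> n _ [x <-] hx; rewrite hh -(wd (pr n x)); first exact/gr_funP/pr_comp.
  by rewrite -pr_hom pr_id.
by exists g => x; rewrite hg; [apply: hh|exists x].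
Qed.

Definition res_complex (M : grmod A m) (E : gr_resolution M) : gcomplex A m.
Proof.
exists (res_obj E) (res_d E) => j x.
by apply/res_exactS; exists x.
Defined.

(** By flatness, the pullback of [E] is again a resolution of [M].  Injectivity of
    [E] gives a map from it to [E] over the identity of [M], whose cone is then
    exact; its terms are flasque, so it stays exact with supports. *)
Lemma resolution_pullback (M : grmod A m) (phiM : M -> M) (E : gr_resolution M) :
  gr_frob_pullback p phiM ->
  exists (C' : gcomplex A m) (phi : forall j, res_complex E j -> C' j)
    (psi : forall j, grhom (C' j) (res_complex E j)),
    @cpx_pullback A m p (res_complex E) C' phi /\ acyclic_cone psi.
Proof.
move=> hM.
have ex j : exists Q : {N' : grmod A m & E j -> N'}, gr_frob_pullback p (projT2 Q).
  have [N' [phi hphi]] := gr_frob_pullback_exists charA flatR (E j).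
  by exists (existT _ N' phi).
pose Q j := sval (cid (ex j)); have hQ j := svalP (cid (ex j)).
pose F j := projT1 (Q j); pose phi j : E j -> F j := projT2 (Q j).
have hphi j : gr_frob_pullback p (phi j) by apply: hQ.
have hlin j := fp_semilinear (hphi j).1.
have exd j : exists u : grhom (F j) (F j.+1), forall x, u (phi j x) = phi j.+1 (res_d E j x).
  apply: (gr_frob_pullback_extend (hphi j)); split.
    by move=> a x y; rewrite linearP (hlin j.+1).
  by move=> n x hx; apply: (hphi j.+1).2; apply: gr_funP.
pose dF j := sval (cid (exd j)).
have dFE j x : dF j (phi j x) = phi j.+1 (res_d E j x) := svalP (cid (exd j)) x.
have [aF aFE] : exists u : grhom M (F 0%N), forall x, u (phiM x) = phi 0%N (res_aug E x).
  apply: (gr_frob_pullback_extend hM); split.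
    by move=> a x y; rewrite linearP (hlin 0%N).
  by move=> n x hx; apply: (hphi 0%N).2; apply: gr_funP.
have dF_aF x : dF 0%N (aF x) = 0.
  have [I [r [w ->]]] := fp_gen hM.1 x.
  rewrite !linear_sum big1 // => i _; rewrite !linearZ /= aFE dFE.
  have -> : res_d E 0 (res_aug E (w i)) = 0 by apply/res_exact0; exists (w i).
  by rewrite (semilinear0 (hlin 1%N)) scaler0.
have dFdF j x : dF j.+1 (dF j x) = 0.
  have [I [r [w ->]]] := fp_gen (hphi j).1 x.
  rewrite !linear_sum big1 // => i _; rewrite !linearZ /= !dFE.
  have -> : res_d E j.+1 (res_d E j (w i)) = 0 by apply/res_exactS; exists (w i).
  by rewrite (semilinear0 (hlin j.+2)) scaler0.
have aF_inj x : aF x = 0 -> x = 0.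
  move/(frob_span_ker hM.1 (hphi 0%N).1 aFE).
  apply: (frob_span_min (S := fun z => z = 0)) => [|w]; first by split=> // a y z -> ->; rewrite scaler0 addr0.
  move=> hw; rewrite (_ : w = 0) ?(semilinear0 (fp_semilinear hM.1)) //.
  by apply: (@res_aug_inj _ _ _ E); rewrite hw raddf0.
have imsub (N P : grmod A m) (u : grhom N P) : submod (fun y => exists x, u x = y).
  split; first by exists 0; rewrite raddf0.
  by move=> a _ _ [x <-] [y <-]; exists (a *: x + y); rewrite linearP.
have dF0_ex y : dF 0%N y = 0 -> exists x, aF x = y.
  move/(frob_span_ker (hphi 0%N).1 (hphi 1%N).1 (dFE 0%N)).
  apply: (frob_span_min (S := fun y => exists x, aF x = y)) => [|w /res_exact0[x ->]]; first exact: imsub.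
  by exists (phiM x).
have dFS_ex j y : dF j.+1 y = 0 -> exists x, dF j x = y.
  move/(frob_span_ker (hphi j.+1).1 (hphi j.+2).1 (dFE j.+1)).
  apply: (frob_span_min (S := fun y => exists x, dF j x = y)) => [|w /res_exactS[x ->]]; first exact: imsub.
  by exists (phi j x).
(* the next map of the chain exists because the previous one respects cocycles *)
pose T j := {f : grhom (F j) (E j) | forall x, dF j x = 0 -> res_d E j (f x) = 0}.
have [t0 ht0] : exists t : T 0%N, forall x, sval t (aF x) = res_aug E x.
  have [|f hf] := @gr_injective_along (E 0%N) M (F 0%N) aF (res_aug E) (@res_injective _ _ _ E 0).
    by move=> x /aF_inj ->; rewrite raddf0.
  suff kf x : dF 0%N x = 0 -> res_d E 0 (f x) = 0 by exists (exist _ f kf).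
  by move=> /dF0_ex[w <-]; apply/res_exact0; exists w; rewrite hf.
have exnext j (t : T j) : exists t' : T j.+1,
    forall x, sval t' (dF j x) = res_d E j (sval t x).
  have [|f hf] := @gr_injective_along (E j.+1) (F j) (F j.+1) (dF j)
      (grhom_comp (res_d E j) (sval t)) (@res_injective _ _ _ E j.+1).
    by move=> x /(svalP t).
  suff kf x : dF j.+1 x = 0 -> res_d E j.+1 (f x) = 0 by exists (exist _ f kf).
  by move=> /dFS_ex[w <-]; apply/res_exactS; exists (sval t w); rewrite hf.
pose next j t := sval (cid (exnext j t)).
have nextE j t x : sval (next j t) (dF j x) = res_d E j (sval t x).
  exact: (svalP (cid (exnext j t)) x).
pose fix tt j : T j := match j with 0 => t0 | j'.+1 => next j' (tt j') end.
pose psi j : grhom (F j) (E j) := sval (tt j).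
have psid j x : res_d E j (psi j x) = psi j.+1 (dF j x) by rewrite /psi /= nextE.
have psi_aF x : psi 0%N (aF x) = res_aug E x by apply: ht0.
exists (@GComplex A m F dF dFdF), phi, psi; split; first by split.
split=> //; split=> /=.
  move=> x /dF0_ex[w <-]; rewrite psi_aF => hw.
  suff -> : w = 0 by rewrite raddf0.
  by apply: (@res_aug_inj _ _ _ E); rewrite hw raddf0.
move=> s hs i x y tx ty dx E1.
(* the cone of [psi], an exact complex of flasque modules *)
pose C (j : nat) : lmodType R :=
  match j with 0 => F 0%N : lmodType R | k.+1 => (F k.+1 * E k)%type : lmodType R end.
have [del0 hdel0] : exists u : {linear C 0%N -> C 1%N}, forall x, u x = (dF 0%N x, psi 0%N x).
  by apply: exists_linear => a u v; congr (_, _); apply: linearP.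
have exdel j : exists u : {linear C j.+1 -> C j.+2},
    forall z, u z = (dF j.+1 z.1, psi j.+1 z.1 - res_d E j z.2).
  apply: exists_linear => a [u u'] [v v']; congr (_, _); first exact: linearP.
  have e1 := linearP (psi j.+1) a u v; have e2 := linearP (res_d E j) a u' v'.
  transitivity (psi j.+1 (a *: u + v) - res_d E j (a *: u' + v')) => //.
  by rewrite e1 e2 /= opprD addrACA -scalerBr.
pose delS j := sval (cid (exdel j)).
have hdelS j z : delS j z = (dF j.+1 z.1, psi j.+1 z.1 - res_d E j z.2).
  exact: (svalP (cid (exdel j)) z).
pose del j : {linear C j -> C j.+1} :=
  match j return {linear C j -> C j.+1} with 0 => del0 | k.+1 => delS k end.
have flF j : @flasque A m (F j) (fun=> True).
  by apply: (flasque_pullback charA (hphi j).1); apply: injective_flasque => //; apply: res_injective.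
have flC j : @flasque A m (C j) (fun=> True).
  case: j => [|j]; first exact: flF.
  by apply: flasque_prod => //; apply: injective_flasque => //; apply: res_injective.
have inj0 z : del 0%N z = 0 -> z = 0.
  rewrite /= hdel0 => -[/dF0_ex[w <-]]; rewrite psi_aF => hw.
  suff -> : w = 0 by rewrite raddf0.
  by apply: (@res_aug_inj _ _ _ E); rewrite hw raddf0.
have exC j z : del j.+1 z = 0 <-> exists w, del j w = z.
  case: j z => [|j] [u v] /=; rewrite hdelS /=; split.
  - move=> [/dFS_ex[w wu] /eqP]; rewrite subr_eq0 -wu -psid => /eqP h.
    have /res_exact0[k hk] : res_d E 0 (psi 0%N w - v) = 0.
      by rewrite raddfB /= h subrr.
    exists (w - aF k); rewrite hdel0 !raddfB /= dF_aF subr0 wu psi_aF -hk.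
    by rewrite opprB addrC subrK.
  - move=> [w]; rewrite hdel0 => -[<- <-].
    by rewrite dFdF psid subrr.
  - move=> [/dFS_ex[w wu] /eqP]; rewrite subr_eq0 -wu -psid => /eqP h.
    have /res_exactS[k hk] : res_d E j.+1 (psi j.+1 w - v) = 0.
      by rewrite raddfB /= h subrr.
    exists (w, k); rewrite hdelS /= wu -hk.
    by rewrite opprB addrC subrK.
  - move=> [w]; rewrite hdelS => -[<- <-].
    rewrite dFdF raddfB /= psid (_ : res_d E j.+1 (res_d E j w.2) = 0) ?subr0 ?subrr //.
    by apply/res_exactS; exists w.2.
have [||w [tw hw]] := flasque_exact flC inj0 exC (j := i) (s := s) (x := (x, y)) hs.
- move=> f hf; have [n hn] := tx f hf; have [k hk] := ty f hf.
  exists (n + k)%N; congr (_, _); rewrite /= exprD.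
    by rewrite mulrC -scalerA hn scaler0.
  by rewrite -scalerA hk scaler0.
- by rewrite /= hdelS /= dx E1 subrr.
case: i x y w tw hw {tx ty dx E1} => [|i] x y.
  move=> w tw; rewrite /= hdel0 => -[<- <-].
  by exists w, 0; rewrite subr0.
move=> [w v] tw; rewrite /= hdelS => -[<- <-]; exists w, (res_d E i v); split=> //.
  by move=> f /tw[n hn]; exists n; have := congr1 fst hn.
exists v; split=> // f /tw[n hn]; exists n; exact: (congr1 snd hn).
Qed.

End Resolutions.

(** * Values of Lyubeznik functors *)

Section LyubeznikSteps.
Variables (A : comNzRingType) (m p : nat).
Hypothesis charA : p \in [pchar A].
Local Notation R := {mpoly A[m]}.
Hypotheses (flatR : frob_flat R p) (noethR : noetherian R).
Let charR : p \in [pchar R] := pchar_mpoly m charA.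

(** The properties of a subquotient [Z / B] of the term in degree [i] of a complex
    through which it inherits the Frobenius structure of the complex. *)
Record natural_subquotient i (Z B : forall C : gcomplex A m, C i -> Prop) : Prop := {
  ns_Z : forall C, submod (@Z C);
  ns_B : forall C, submod (@B C);
  ns_pr : forall C n x, @Z C x -> @Z C (pr n x);
  ns_Z_pullback : forall (C C' : gcomplex A m) (phi : forall j, C j -> C' j),
    cpx_pullback p phi -> forall y, @Z C' y <-> frob_span (phi i) (@Z C) y;
  ns_B_pullback : forall (C C' : gcomplex A m) (phi : forall j, C j -> C' j),
    cpx_pullback p phi -> forall y, @B C' y <-> frob_span (phi i) (@B C) y;
  ns_iso : forall (C' C : gcomplex A m) (psi : forall j, grhom (C' j) (C j)),
    acyclic_cone psi -> iso_on psi (@Z C') (@B C') (@Z C) (@B C)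
}.

(** The structure map of [N] sends the class of [x] to that of [psi (phi x)],
    where [phi : E -> F(E)] and [psi : F(E) -> E].  It makes [N] its own
    pullback because [Z (F E) / B (F E)] is the pullback of [Z E / B E], and
    [psi] identifies it with [Z E / B E] again. *)
Lemma natural_subquotient_pullback (M N : grmod A m) (phiM : M -> M)
    (E : gr_resolution M) i (Z B : forall C : gcomplex A m, C i -> Prop) :
  gr_frob_pullback p phiM -> natural_subquotient Z B ->
  @is_subquotient A m (E i) N (@Z (res_complex E)) (@B (res_complex E)) ->
  exists phiN : N -> N, gr_frob_pullback p phiN.
Proof.
move=> hM ns [q [qlin qsurj qker qdeg]].
have [C' [phi [psi [hphi hpsi]]]] := resolution_pullback charA flatR noethR E hM.
have [psiZ psiB surj inj] := ns_iso ns hpsi.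
have subZ := ns_Z ns (res_complex E); have subB := ns_B ns (res_complex E).
have hp := (hphi.1 i).1; have hlin := fp_semilinear hp.
have BZ x : B (res_complex E) x -> Z (res_complex E) x -> q x = 0 by move=> hb hz; apply/qker.
have q0 : q 0 = 0 by apply/qker; apply: submod0.
have qD x y : Z (res_complex E) x -> Z (res_complex E) y -> q (x + y) = q x + q y.
  by move=> hx hy; have := qlin 1 x y hx hy; rewrite !scale1r.
have qZ a x : Z (res_complex E) x -> q (a *: x) = a *: q x.
  by move=> hx; have := qlin a x 0 hx (submod0 subZ); rewrite q0 !addr0.
have qB x y : Z (res_complex E) x -> Z (res_complex E) y -> q (x - y) = q x - q y.
  move=> hx hy; rewrite qD //; last exact: (submodN subZ hy).
  congr (_ + _).
  by rewrite -scaleN1r qZ // scaleN1r.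
have qsum (I : finType) (F : I -> E i) : (forall k, Z (res_complex E) (F k)) ->
    q (\sum_k F k) = \sum_k q (F k) /\ Z (res_complex E) (\sum_k F k).
  move=> hF; apply: (big_ind2 (fun x y => q x = y /\ Z (res_complex E) x)) => //.
    by split=> //; apply: submod0.
  by move=> x y u v [<- hx] [<- hu]; rewrite qD //; split=> //; apply: submodD.
pose Phi x := psi i (phi i x).
have Philin a x y : Phi (a *: x + y) = a ^+ p *: Phi x + Phi y.
  by rewrite /Phi hlin linearP.
have PhiZ x : Z (res_complex E) x -> Z (res_complex E) (Phi x).
  by move=> hx; apply: psiZ; apply/(ns_Z_pullback ns hphi); apply: frob_span_gen.
have PhiB x : B (res_complex E) x -> B (res_complex E) (Phi x).
  by move=> hx; apply: psiB; apply/(ns_B_pullback ns hphi); apply: frob_span_gen.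
have [f hf] := choice qsurj.
pose phiN n := q (Phi (f n)).
have phiNE x : Z (res_complex E) x -> phiN (q x) = q (Phi x).
  move=> hx; have [hZ hq] := hf (q x).
  have hB := semilinearB Philin (f (q x)) x.
  apply/eqP; rewrite -subr_eq0 /phiN -(qB _ _ (PhiZ _ hZ) (PhiZ _ hx)) -hB; apply/eqP.
  have hZ' : Z (res_complex E) (f (q x) - x) by apply: submodB.
  apply: BZ; last exact: PhiZ.
  by apply: PhiB; apply/qker => //; rewrite qB // hq subrr.
exists phiN; split; last first.
  move=> n y hy; have [x [hx xy]] := qsurj y.
  have hpr k : Z (res_complex E) (pr k x) by apply: (ns_pr ns).
  have yE : y = q (pr n x).
    have [s [us hs xE]] := pr_support x.
    have dec : decomposition (q x) (fun k => q (pr k x)).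
      split; first by move=> k; apply: qdeg => //; apply: pr_comp.
      exists s; split=> //; first by move=> k hk; rewrite hs.
      rewrite {1}xE.
      suff [] : q (\sum_(k <- s) pr k x) = \sum_(k <- s) q (pr k x) /\
        Z (res_complex E) (\sum_(k <- s) pr k x) by [].
      apply: (big_ind2 (fun x y => q x = y /\ Z (res_complex E) x)) => //.
        by split=> //; apply: submod0.
      by move=> u v u' v' [<- hu] [<- hu']; rewrite qD //; split=> //; apply: submodD.
    by rewrite -(prE n dec) xy pr_id.
  rewrite yE phiNE //; apply: qdeg; first exact: PhiZ.
  by apply: gr_funP; apply: (hphi.1 i).2; apply: pr_comp.
split.
- move=> a y z; have [x [hx <-]] := qsurj y; have [w [hw <-]] := qsurj z.
  rewrite -qlin // !phiNE //; last by apply: submodD => //; apply: submodZ.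
  by rewrite Philin qlin //; apply: PhiZ.
- move=> y; have [z [hz <-]] := qsurj y.
  have [z' [hz' hB]] := surj z hz.
  have /(ns_Z_pullback ns hphi)[I [r [x [hx zE]]]] := hz'.
  exists I, r, (fun k => q (x k)).
  have -> : q z = q (psi i z').
    apply/eqP; rewrite -subr_eq0 -qB //; last exact: psiZ.
    by apply/eqP; apply: BZ => //; apply: submodB => //; apply: psiZ.
  rewrite zE linear_sum.
  have [|-> _] := qsum I (fun k => psi i (r k *: phi i (x k))).
    by move=> k; rewrite linearZ; apply: submodZ => //; apply: PhiZ.
  by apply: eq_bigr => k _; rewrite linearZ /= qZ ?phiNE //; apply: PhiZ.
- move=> I r y hr.
  pose x k := f (y k); have hx k : Z (res_complex E) (x k) by case: (hf (y k)).
  have qx k : q (x k) = y k by case: (hf (y k)).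
  pose w := \sum_k r k *: phi i (x k).
  have Zw : Z C' w.
    by apply/(ns_Z_pullback ns hphi); exists I, r, x.
  have psiw : psi i w = \sum_k r k *: Phi (x k).
    by rewrite /w linear_sum; apply: eq_bigr => k _; rewrite linearZ.
  have : B (res_complex E) (psi i w).
    apply/qker; first exact: psiZ.
    rewrite psiw; have [|-> _] := qsum I (fun k => r k *: Phi (x k)).
      by move=> k; apply: submodZ => //; apply: PhiZ.
    rewrite -[RHS]hr; apply: eq_bigr => k _; rewrite qZ; last exact: PhiZ.
    by rewrite -phiNE // qx.
  move/(inj w Zw)/(ns_B_pullback ns hphi) => [J [t [b [hb wE]]]].
  pose rs (z : I + J) := match z with inl k => r k | inr j => - t j end.
  pose xs (z : I + J) := match z with inl k => x k | inr j => b j end.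
  have [|H [s [c [rE cE]]]] := fp_flat hp (r := rs) (x := xs).
    rewrite big_sumType /= -/w wE -big_split big1 //= => j _.
    by rewrite scaleNr subrr.
  exists H, s, (fun h k => c h (inl k)); split; first by move=> k; rewrite -(rE (inl k)).
  move=> h; have [|qs Zs] := qsum I (fun k => c h (inl k) *: x k).
    by move=> k; apply: submodZ.
  transitivity (q (\sum_k c h (inl k) *: x k)).
    by rewrite qs; apply: eq_bigr => k _; rewrite qZ // qx.
  apply: BZ => //; have := cE h; rewrite big_sumType /= => /eqP.
  rewrite addr_eq0 => /eqP ->; apply: submodN => //.
  by apply: submod_sum => // j _; apply: submodZ.
Qed.

Section Steps.
Variables (s'' s' z : seq R) (i : nat).
Hypotheses (hs'' : all_homogeneous s'') (hs' : all_homogeneous s').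
Hypotheses (hz : all_homogeneous z).
Hypothesis incl : forall (N : grmod A m) (x : N), tors s' x -> tors s'' x.
Hypothesis zincl : forall (N : grmod A m) s (x : N), tors z x -> tors s x.

Lemma cocyc_incl t'' t' u'' u' (C : gcomplex A m) j (x : C j) :
  (forall (N : grmod A m) (x : N), tors t'' x -> tors u'' x) ->
  (forall (N : grmod A m) (x : N), tors t' x -> tors u' x) ->
  cocyc t'' t' x -> cocyc u'' u' x.
Proof. by move=> h1 h2 [tx dx]; split; [apply: h1|apply: h2]. Qed.

Lemma cobound_incl t'' t' u'' u' (C : gcomplex A m) j (x : C j) :
  (forall (N : grmod A m) (x : N), tors t'' x -> tors u'' x) ->
  (forall (N : grmod A m) (x : N), tors t' x -> tors u' x) ->
  cobound t'' t' x -> cobound u'' u' x.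
Proof.
move=> h1 h2 [a [b [ta bb ->]]]; exists a, b; split=> //; first exact: h2.
exact: bound_from_incl bb.
Qed.

Lemma natural_relative t'' t' : all_homogeneous t'' -> all_homogeneous t' ->
  (forall (N : grmod A m) (x : N), tors t' x -> tors t'' x) ->
  natural_subquotient (fun C => @cocyc A m C t'' t' i) (fun C => @cobound A m C t'' t' i).
Proof.
move=> h'' h' hincl; split.
- by move=> C; apply: cocyc_submod.
- by move=> C; apply: cobound_submod.
- by move=> C n x; apply: cocyc_pr.
- by move=> C C' phi hphi y; exact: (cocyc_pullback charA hphi).
- by move=> C C' phi hphi y; exact: (cobound_pullback charA hphi).
- by move=> C' C psi hpsi; apply: iso_relative.
Qed.

(** The kernel of the map from [Z1 / B1] to [Z2 / B2]: an element of [Z1] lifts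
    along [psi], and the lift dies in [Z2 / B2] because [psi] is injective
    there. *)
Lemma natural_kernel (Z1 B1 Z2 B2 : forall C : gcomplex A m, C i -> Prop) :
  natural_subquotient Z1 B1 -> natural_subquotient Z2 B2 ->
  (forall C x, Z1 C x -> Z2 C x) -> (forall C x, B1 C x -> B2 C x) ->
  (forall C n x, B2 C x -> B2 C (pr n x)) ->
  natural_subquotient (fun C x => Z1 C x /\ B2 C x) B1.
Proof.
move=> n1 n2 Z12 B12 prB2; split.
- move=> C; split; first by split; [exact: submod0 (ns_Z n1 C)|exact: submod0 (ns_B n2 C)].
  by move=> a x y [hx bx] [hy b_y]; split; [apply: (ns_Z n1 C).2|apply: (ns_B n2 C).2].
- by move=> C; apply: ns_B n1 C.
- by move=> C n x [hx bx]; split; [apply: (ns_pr n1)|apply: prB2].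
- move=> C C' phi hphi y; rewrite (ns_Z_pullback n1 hphi) (ns_B_pullback n2 hphi).
  exact: (frob_span_and hphi _ (ns_Z n1 C) (ns_B n2 C)).
- by move=> C C' phi hphi y; apply: (ns_B_pullback n1 hphi).
- move=> C' C psi hpsi.
  have [psiZ1 psiB1 surj1 inj1] := ns_iso n1 hpsi.
  have [psiZ2 psiB2 surj2 inj2] := ns_iso n2 hpsi.
  split=> //.
  + by move=> x [hx bx]; split; [apply: psiZ1|apply: psiB2].
  + move=> x [hx bx]; have [x' [hx' hB]] := surj1 x hx.
    exists x'; split=> //; split=> //; apply: inj2; first exact: Z12.
    rewrite -(subKr x (psi i x')); apply: submodB => //; first exact: ns_B n2 C.
    exact: B12.
  + by move=> x [hx _]; apply: inj1.
Qed.

(** The kernel of the connecting map, which is induced by the differential. *)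
Lemma natural_connecting :
  natural_subquotient
    (fun C x => @cocyc A m C s'' s' i x /\ @cobound A m C s' z i.+1 (gd C i x))
    (fun C => @cobound A m C s'' s' i).
Proof.
have n1 := natural_relative hs'' hs' incl.
have hsub C : submod (@cobound A m C s' z i.+1) by apply: cobound_submod.
split.
- move=> C; split.
    by split; [exact: submod0 (ns_Z n1 C)|rewrite raddf0; exact: submod0 (hsub C)].
  move=> a x y [hx bx] [hy b_y]; split; first exact: (ns_Z n1 C).2.
  by rewrite linearP; apply: (hsub C).2.
- by move=> C; apply: ns_B n1 C.
- move=> C n x [hx bx]; split; first exact: (ns_pr n1).
  by rewrite -pr_hom; apply: cobound_pr.
- move=> C C' phi hphi y; rewrite (ns_Z_pullback n1 hphi).
  rewrite (cobound_pullback charA hphi) (gd_pullback hphi) //.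
  exact: (frob_span_and hphi _ (ns_Z n1 C) (submod_preim (hsub C))).
- by move=> C C' phi hphi y; apply: (ns_B_pullback n1 hphi).
- move=> C' C psi hpsi.
  have [psiZ1 psiB1 surj1 inj1] := ns_iso n1 hpsi.
  have [psiZ2 psiB2 _ inj2] := iso_relative hpsi i.+1 hs' hz (fun N x => @zincl N s' x).
  split=> //.
  + move=> x [hx bx]; split; first exact: psiZ1.
    by rewrite hpsi.1; apply: psiB2.
  + move=> x [hx bx]; have [x' [hx' hB]] := surj1 x hx.
    exists x'; split=> //; split=> //; apply: inj2.
      case: hx' => tx' dx'; split=> //; rewrite gdd; exact: tors0.
    rewrite -hpsi.1 -(subKr x (psi i x')) raddfB /=; apply: submodB => //.
    have [a [b [ta bb ->]]] := hB.
    rewrite raddfD /= (bound_from_gd bb) addr0.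
    by exists 0, (gd C i a); rewrite add0r; split=> //; [exact: tors0|exists a].
  + by move=> x [hx _]; apply: inj1.
Qed.

End Steps.

(** If no power of [f] kills [x], a prime containing the annihilator of [x]
    avoids [f], and lies in the support of [x]. *)
Lemma Gam_tors (Y : spec R -> Prop) : homog_closed Y ->
  exists s, all_homogeneous s /\
    @Gam A m Y = (fun (N : grmod A m) (x : N) => tors s x).
Proof.
move=> [s [hs hY]]; exists s; split; first by move=> f /hs.
apply: functional_extensionality_dep => N; apply/funext => x; apply/propext; split.
  move=> hx f fs; apply: contrapT => nf.
  pose ann (a : R) := a *: x = 0.
  have [||||P [hP annP hPf]] := @prime_avoid R noethR ann (fun g => exists n, g = f ^+ n).
  - split; rewrite /ann; first by rewrite scale0r.
      by move=> a b ha hb; rewrite scalerDl ha hb addr0.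
    by move=> a b hb; rewrite -scalerA hb scaler0.
  - by exists 0%N; rewrite expr0.
  - by move=> _ _ [n ->] [k ->]; exists (n + k)%N; rewrite exprD.
  - by move=> g hg [n gE]; apply: nf; exists n; rewrite -gE.
  have /hY/(_ f fs) Pf : Y (Spec hP) by apply: hx => a; apply: annP.
  by apply: (hPf f Pf); exists 1%N; rewrite expr1.
move=> tx P hP; apply/hY => f fs; have [n hn] := tx f fs.
exact: (prime_exp (spec_prime P) (hP _ hn)).
Qed.

(** The zero functor as sections with empty support, so that absolute cohomology
    is a case of relative cohomology. *)
Lemma Zero_tors :
  @Zero A m = (fun (N : grmod A m) (x : N) => tors [:: 1] x).
Proof.
apply: functional_extensionality_dep => N; apply/funext => x; apply/propext; split.
  by move=> -> f _; exists 0%N; rewrite scaler0.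
by move=> /(_ 1 (mem_head _ _)) [n]; rewrite expr1n scale1r.
Qed.

Lemma Gam_mono (Y' Y'' : spec R -> Prop) (N : grmod A m) (x : N) :
  (forall P, Y' P -> Y'' P) -> Gam Y' x -> Gam Y'' x.
Proof. by move=> h hx P /hx /h. Qed.

Lemma step_pullback t (M N : grmod A m) (phiM : M -> M) :
  gr_frob_pullback p phiM -> lyubeznik_step_ok t -> step_value t M N ->
  exists phiN : N -> N, gr_frob_pullback p phiN.
Proof.
move=> hM.
have h1 : all_homogeneous [:: 1 : R].
  by move=> f; rewrite inE => /eqP ->; exists 0%N; apply: dhomog1.
have zincl (K : grmod A m) s (x : K) : tors [:: 1] x -> tors s x.
  move=> /(_ 1 (mem_head _ _)) [n]; rewrite expr1n scale1r => ->; exact: tors0.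
have prep (Y' Y'' : spec R -> Prop) : nested_homog_closed Y' Y'' ->
  exists s' s'', [/\ all_homogeneous s', all_homogeneous s'',
    @Gam A m Y' = (fun (K : grmod A m) (x : K) => tors s' x),
    @Gam A m Y'' = (fun (K : grmod A m) (x : K) => tors s'' x)
    & forall (K : grmod A m) (x : K), tors s' x -> tors s'' x].
  move=> [/Gam_tors[s' [hs' E']] /Gam_tors[s'' [hs'' E'']] Y'Y''].
  exists s', s''; split=> // K x.
  have e' : Gam Y' x = tors s' x by rewrite E'.
  have e'' : Gam Y'' x = tors s'' x by rewrite E''.
  by rewrite -e' -e''; apply: Gam_mono.
case: t => [Y i|Y' Y'' i|Y' Y'' i|Y' Y'' i] /= ok [E].
- move=> [Y' [Y'' [[/prep[s' [s'' [hs' hs'' -> -> incl]]] _] hq]]].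
  exact: (natural_subquotient_pullback hM (natural_relative i hs'' hs' incl) hq).
- have [s' [s'' [hs' hs'' -> -> incl]]] := prep _ _ ok; rewrite Zero_tors => hq.
  apply: (natural_subquotient_pullback hM _ hq).
  apply: (natural_kernel (natural_relative i hs' h1 (fun K x => @zincl K s' x))
    (natural_relative i hs'' h1 (fun K x => @zincl K s'' x))).
  + by move=> C x; apply: cocyc_incl.
  + by move=> C x; apply: cobound_incl.
  + by move=> C n x; apply: cobound_pr.
- have [s' [s'' [hs' hs'' -> -> incl]]] := prep _ _ ok; rewrite Zero_tors => hq.
  apply: (natural_subquotient_pullback hM _ hq).
  apply: (natural_kernel (natural_relative i hs'' h1 (fun K x => @zincl K s'' x))
    (natural_relative i hs'' hs' incl)).
  + by move=> C x; apply: cocyc_incl => // K y; apply: zincl.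
  + by move=> C x; apply: cobound_incl => // K y; apply: zincl.
  + by move=> C n x; apply: cobound_pr.
- have [s' [s'' [hs' hs'' -> -> incl]]] := prep _ _ ok; rewrite Zero_tors => hq.
  apply: (natural_subquotient_pullback hM _ hq).
  exact: (natural_connecting i hs'' hs' h1 incl zincl).
Qed.

(** The ring [R], with [x |-> x ^ p], is its own pullback because Frobenius is
    flat; the property then passes through the composite. *)
Lemma functor_pullback T (M : grmod A m) :
  foldr (fun t Q => lyubeznik_step_ok t /\ Q) True T ->
  functor_value T (gr_R A m) M -> exists phi : M -> M, gr_frob_pullback p phi.
Proof.
elim: T M => [|t T IH] M /=.
  move=> _ ->; exists (fun x : R => x ^+ p); split; first split.
  - by move=> a x y; rewrite (frobD charR) -[a *: x]/(a * x) exprMn.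
  - move=> y; exists 'I_1, (fun=> y), (fun=> 1); rewrite big_ord1 expr1n.
    by rewrite -[RHS]/(y * 1) mulr1.
  - by move=> I r x hr; apply: flatR.
  - case=> n x; last by move=> /= ->; rewrite (frob0 charR); apply: R_comp0.
    by move=> hx; rewrite -PoszM mulnC; apply: dhomogMn.
move=> [ok okT] [K [hK hstep]]; have [phi hphi] := IH K okT hK.
exact: (step_pullback hphi ok hstep).
Qed.

End LyubeznikSteps.

(** * Degrees of the nonzero components *)

Section NonzeroComponents.
Variables (A : comNzRingType) (m p : nat).
Hypothesis charA : p \in [pchar A].
Local Notation R := {mpoly A[m]}.
Let charR : p \in [pchar R] := pchar_mpoly m charA.
Let p0 : (0 < p)%N := p_gt0 charA.

Lemma prR0 (c : R) : prR 0 c = (c@_0)%:MP.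
Proof.
have [s [us hs cE]] := prR_support c.
have h0 : prR 0 c \is 0.-homog := R_comp_pr 0 c.
apply/mpolyP => n; rewrite mcoeffC; case: eqP => [->|n0]; last first.
  rewrite mulr0; apply: (dhomog_nemf_coeff h0) => /=.
  by rewrite mdeg_eq0; apply/eqP.
rewrite mulr1 {2}cE raddf_sum /=.
rewrite (eq_bigr (fun k => if k == 0 then (prR 0 c)@_0 else 0)); last first.
  move=> k _; case: eqP => [->//|k0].
  have := R_comp_pr k c; case: k k0 => [k|k] k0 /= hk; last by rewrite hk mcoeff0.
  by apply: (dhomog_nemf_coeff hk); rewrite /= mdeg0; apply/eqP => h; apply: k0; rewrite -h.
case: (boolP (0 \in s)) => h0s.
  by rewrite (bigD1_seq 0) //= big1 ?addr0 // => k /negPf->.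
by rewrite hs // mcoeff0 big1 // => k _; case: eqP.
Qed.

Lemma small_mnm_mdeg al : (mdeg (@small_mnm m p al) <= m * p.-1)%N.
Proof.
rewrite mdegE -[X in (_ <= X * _)%N]card_ord -sum_nat_const.
apply: leq_sum => i _; rewrite mnmE; have := ltn_ord (al i).
by move: p0; lia.
Qed.

Lemma small_mnm_exists d : (d <= m * p.-1)%N ->
  exists al, mdeg (@small_mnm m p al) = d.
Proof.
have ex k q : (q <= k * p.-1)%N -> exists f : nat -> nat,
    (forall i, f i < p)%N /\ (\sum_(i < k) f i = q)%N.
  elim: k q => [|k IH] q.
    rewrite mul0n leqn0 => /eqP ->; exists (fun=> 0%N); split=> //.
    by rewrite big_ord0.
  rewrite mulSn => hq; have [|f [hf sf]] := IH (q - minn q p.-1)%N.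
    by move: hq; set w := (k * p.-1)%N; rewrite /minn; case: ifP; lia.
  exists (fun i => if (i < k)%N then f i else minn q p.-1); split.
    move=> i; case: ifP => // _; apply: leq_ltn_trans (geq_minr _ _) _.
    by rewrite prednK.
  rewrite big_ord_recr /= ltnn -[RHS](subnK (geq_minl q p.-1)) -sf; congr (_ + _)%N.
  by apply: eq_bigr => i _; rewrite ltn_ord.
move=> /ex[f [hf sf]]; exists [ffun i : 'I_m => Ordinal (hf i)].
by rewrite mdegE -sf; apply: eq_bigr => i _; rewrite mnmE ffunE.
Qed.

(** Every element of [M] is a combination of elements [X^al phi (y)] with all
    exponents in [al] below [p], as the other powers of the variables can be
    moved inside [phi].  Conversely, [X^al phi (y) = 0] forces [y = 0]: the
    coefficient of [X^al] in a combination of [p]-th powers of elements that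
    annihilate [y] is a combination of [p]-th powers of elements of [A] that
    annihilate [y]. *)
Lemma comp_neq0_pullback (M : grmod A m) (phi : M -> M) n : gr_frob_pullback p phi ->
  comp_neq0 M n <-> exists j : int,
    comp_neq0 M j /\ p%:Z * j <= n <= p%:Z * j + (m * p.-1)%N%:Z.
Proof.
move=> hgr; have [hphi hdeg] := hgr; have hlin := fp_semilinear hphi; split.
  move=> [x [hx x0]]; have [l [hl xE]] := homog_exprP hgr hx.
  have [t [tl t0]] : exists t, t \in l /\ t.1.1 *: phi t.1.2 <> 0.
    apply: contrapT => h; apply: x0; rewrite xE big_seq big1 // => t tl.
    by apply: contrapT => t0; apply: h; exists t.
  case: t tl t0 => [[r y] e] /= /hl /= [hr hy] ry0.
  have [d dE] : exists d : nat, n - p%:Z * e = d%:Z.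
    by case: (n - p%:Z * e) hr => [d _|d /= r0]; [exists d|case: ry0; rewrite r0 scale0r].
  rewrite dE /= in hr.
  have [g [gr g0]] : exists g, g \in msupp r /\ 'X_[g] *: phi y <> 0.
    apply: contrapT => h; apply: ry0; rewrite {1}(mpolyE r) scaler_suml.
    rewrite big_seq big1 // => g gr; rewrite -mul_mpolyC -scalerA.
    suff -> : 'X_[g] *: phi y = 0 by rewrite scaler0.
    by apply: contrapT => g0; apply: h; exists g.
  have gd : mdeg g = d by apply: (dhomogP _ _ _ hr).
  pose al := mnm_mod charA g; pose be := mnm_div p g.
  have gE : (small_mnm al + be *+ p)%MM = g by apply: mnm_divE.
  have gphi : 'X_[g] *: phi y = 'X_[small_mnm al] *: phi ('X_[be] *: y).
    by rewrite (semilinearZ hlin) mpolyXn scalerA -mpolyXD gE.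
  have hdg : (mdeg (small_mnm al) + mdeg be * p)%N = d by rewrite -mdegMn -mdegD gE.
  exists ((mdeg be)%:Z + e); split.
    exists ('X_[be] *: y); split; first by apply: gr_compZ => //; rewrite dhomogX.
    by move=> h; apply: g0; rewrite gphi h (semilinear0 hlin) scaler0.
  have := small_mnm_mdeg al; move: hdg dE; rewrite mulrDr.
  set u := mdeg (small_mnm al); set v := mdeg be; set w := (m * p.-1)%N.
  by set pe := p%:Z * e; rewrite -PoszM mulnC; set vp := (p * v)%N; lia.
move=> [j [[y [hy y0]] /andP[h1 h2]]].
have [d dE] : exists d : nat, n - p%:Z * j = d%:Z.
  by exists (absz (n - p%:Z * j)%R); rewrite gez0_abs // subr_ge0.
have [|al hal] := @small_mnm_exists d.
  by move: h1 h2 dE; set pj := p%:Z * j; set w := (m * p.-1)%N; lia.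
exists ('X_[small_mnm al] *: phi y); split.
  rewrite -(subrK (p%:Z * j) n) dE; apply: gr_compZ; first by rewrite dhomogX /= hal.
  exact: hdeg.
move=> h; apply: y0.
have [|H [s [c [sE cE]]]] := fp_flat hphi (I := 'I_1) (r := fun=> 'X_[small_mnm al])
    (x := fun=> y); first by rewrite big_ord1.
pose ann (a : A) := a%:MP_[m] *: y = 0.
have hann : ideal ann.
  split; rewrite /ann.
  - by rewrite mpolyC0 scale0r.
  - by move=> a b ha hb; rewrite mpolyCD scalerDl ha hb addr0.
  - by move=> a b hb; rewrite mpolyCM -scalerA hb scaler0.
have c0 h' : ann (c h' ord0)@_0.
  have := congr1 (pr j) (cE h'); rewrite big_ord1 pr0 (pr_scale_homog _ _ hy) subrr.
  by rewrite prR0.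
have : ann 1.
  have := congr1 (mcoeff (small_mnm al + 0 *+ p)%MM) (sE ord0).
  have -> : (small_mnm al + 0 *+ p = small_mnm al)%MM.
    by apply/mnmP => i; rewrite mnmDE mulmnE mnm0E mul0n addn0.
  rewrite mcoeffX eqxx => E.
  suff : ann (\sum_h s h * c h ord0 ^+ p)@_(small_mnm al) by rewrite -E.
  rewrite raddf_sum; apply: ideal_sum => // h' _ /=.
  have := mcoeff_mul_frob charA (c h' ord0) al 0 (leqnn (msize (s h'))).
  have -> : (small_mnm al + 0 *+ p = small_mnm al)%MM.
    by apply/mnmP => i; rewrite mnmDE mulmnE mnm0E mul0n addn0.
  move=> ->; apply: ideal_sum => // ga _; apply: idealM => //.
  rewrite -(prednK p0) exprS; apply: idealMr => //.
  by case: ifP => _; [rewrite sub0m|exact: ideal0].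
by rewrite /ann mpolyC1 scale1r.
Qed.

End NonzeroComponents.

Section Degrees.
Variables (S : int -> Prop) (m p : int).
Hypotheses (hm : 1 <= m) (hp : 2 <= p).
Hypothesis hS : forall n, S n <-> exists j, S j /\ p * j <= n <= p * j + m * (p - 1).

(** The intervals attached to consecutive [j] overlap or touch, as
    [p <= m (p - 1) + 1]. *)
Lemma degrees_interval a b : a <= b -> (forall j, a <= j <= b -> S j) ->
  forall n, p * a <= n <= p * b + m * (p - 1) -> S n.
Proof.
move=> ab h n /andP[h1 h2]; apply/hS.
case: (lerP (p * b) n) => hb.
  by exists b; split; [apply: h; rewrite ab lexx|rewrite hb].
exists (n %/ p)%Z; have hdiv := divz_eq n p.
have hmod0 : 0 <= (n %% p)%Z by apply: modz_ge0; lia.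
have hmod1 : (n %% p)%Z < p by apply: ltz_pmod; lia.
by split; [apply: h|]; nia.
Qed.

Lemma degrees_grow (a b : nat -> int) :
  (forall k, a k <= b k) ->
  (forall k, p * a k <= a k.+1) -> (forall k, b k.+1 <= p * b k + m * (p - 1)) ->
  (forall j, a 0%N <= j <= b 0%N -> S j) ->
  forall k j, a k <= j <= b k -> S j.
Proof.
move=> ab ha hb h0; elim=> [//|k IH] j /andP[h1 h2].
apply: (degrees_interval (ab k) IH); apply/andP; split.
  exact: le_trans (ha k) h1.
exact: le_trans h2 (hb k).
Qed.

Lemma degrees_below : S (- m) -> forall n, n <= - m -> S n.
Proof.
move=> h n hn.
apply: (@degrees_grow (fun k => - m - k%:Z) (fun=> - m) _ _ _ _ (absz (- m - n)%R)); try nia.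
by move=> j hj; have -> : j = - m by lia.
Qed.

Lemma degrees_above : S 0 -> forall n, 0 <= n -> S n.
Proof.
move=> h n hn.
apply: (@degrees_grow (fun=> 0) (fun k => k%:Z) _ _ _ _ (absz (n)%R)); try nia.
by move=> j hj; have -> : j = 0 by lia.
Qed.

(** The interval attached to such a [j] contains [j - 1] and [j + 1]. *)
Lemma degrees_all j : - m < j < 0 -> S j -> forall n, S n.
Proof.
move=> hj h n.
apply: (@degrees_grow (fun k => j - k%:Z) (fun k => j + k%:Z) _ _ _ _ (absz (n - j)%R)); try nia.
by move=> i hi; have -> : i = j by lia.
Qed.

(** A degree [r < -m] comes from some [j] that is closer to [-m], or beyond it
    but negative. *)
Lemma degrees_low r : r <= - m -> S r -> forall n, n <= - m -> S n.
Proof.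
move=> hr; have [k kE] : exists k : nat, k%:Z = - m - r by exists (absz (- m - r)%R); lia.
elim/ltn_ind: k r kE hr => k IH r kE hr Sr.
case: (eqVneq r (- m)) => [rm|rm]; first by rewrite rm in Sr; apply: degrees_below.
have /hS[j [Sj /andP[h1 h2]]] := Sr.
case: (ltrP j (- m)) => hj.
  have hk : (`|- m - j| < k)%N by nia.
  by apply: (IH _ hk j) => //; lia.
case: (eqVneq j (- m)) => [jm|jm]; first by rewrite jm in Sj; apply: degrees_below.
have j0 : j < 0 by nia.
by move=> n _; apply: (degrees_all _ Sj); lia.
Qed.

(** A degree [r > 0] comes from some [j < r] with [j > -m]. *)
Lemma degrees_high r : 0 <= r -> S r -> forall n, 0 <= n -> S n.
Proof.
move=> hr; have [k kE] : exists k : nat, k%:Z = r by exists (absz (r)%R); lia.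
elim/ltn_ind: k r kE hr => k IH r kE hr Sr.
case: (eqVneq r 0) => [r0|r0]; first by rewrite r0 in Sr; apply: degrees_above.
have /hS[j [Sj /andP[h1 h2]]] := Sr.
case: (ltrP j 0) => hj.
  have jm : - m < j by nia.
  by move=> n _; apply: (degrees_all _ Sj); lia.
have hk : (`|j| < k)%N by nia.
by apply: (IH _ hk j) => //; lia.
Qed.

End Degrees.

Lemma infinitely_many_unbounded (Q : int -> Prop) :
  (forall k : nat, exists n, k%:Z <= `|n| /\ Q n) -> infinitely_many Q.
Proof.
move=> h s; have [n [hn Qn]] := h (\sum_(k <- s) (absz (k)%R)).+1.
exists n; split=> //; apply/negP => ns.
move: hn; rewrite (big_rem n ns) /=; lia.
Qed.

Theorem theorem1p6 (p : nat) (k : fieldType) (hk : p \in [pchar k])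
    (A : comNzRingType) (iota : {rmorphism k -> A}) (hA : regular_ring A)
    (m : nat) (hm : (1 <= m)%N)
    (T : seq (lyubeznik_step A m)) (hT : graded_lyubeznik_functor T)
    (M : grmod A m) (hM : functor_value T (gr_R A m) M) :
  [/\ [<-> infinitely_many (fun n : int => n < 0 /\ comp_neq0 M n);
           exists r : int, forall n : int, n <= r -> comp_neq0 M n;
           forall n : int, n <= - m%:Z -> comp_neq0 M n;
           exists r : int, r <= - m%:Z /\ comp_neq0 M r],
      [<-> infinitely_many (fun n : int => 0 < n /\ comp_neq0 M n);
           exists r : int, forall n : int, r <= n -> comp_neq0 M n;
           forall n : int, 0 <= n -> comp_neq0 M n;
           exists n : int, 0 <= n /\ comp_neq0 M n]
    & (2 <= m)%N ->
      (exists t : int, - m%:Z < t < 0 /\ comp_neq0 M t) <->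
      (forall n : int, comp_neq0 M n)].
Proof.
have charA : p \in [pchar A] := rmorph_pchar iota hk.
have flatR : frob_flat {mpoly A[m]} p.
  exact: frob_flat_mpoly charA (frob_flat_regular charA hA).
have noethR := @noetherian_mpoly A m hA.1.
have [phi hphi] := functor_pullback charA flatR noethR hT.2 hM.
have p2 : (2 <= p)%N := prime_gt1 (pcharf_prime charA).
have hS n : comp_neq0 M n <-> exists j : int,
    comp_neq0 M j /\ p%:Z * j <= n <= p%:Z * j + m%:Z * (p%:Z - 1).
  have -> : m%:Z * (p%:Z - 1) = (m * p.-1)%N%:Z.
    by rewrite PoszM; congr (_ * _); lia.
  exact: (comp_neq0_pullback charA n hphi).
have hm' : 1 <= m%:Z by [].
have hp' : 2 <= p%:Z by [].
have low := degrees_low hm' hp' hS; have high := degrees_high hm' hp' hS.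
have all_ := degrees_all hm' hp' hS.
split.
- tfae.
  + move=> inf; exists (- m%:Z).
    have [r [hr [r0 Sr]]] := inf [seq - (i%:Z) | i <- seq.iota 0 m].
    apply: (low r) => //; rewrite leNgt; apply/negP => h.
    case/mapP: hr; exists (absz (r)%R); last by lia.
    by rewrite mem_iota; lia.
  + move=> [r hr]; apply: (low (Num.min r (- m%:Z))); first by rewrite ge_min lexx orbT.
    by apply: hr; rewrite ge_min lexx.
  + by move=> h; exists (- m%:Z); split=> //; apply: h.
  + move=> [r [hr Sr]]; apply: infinitely_many_unbounded => i.
    exists (- m%:Z - i%:Z); split; [lia|split; [lia|]].
    by apply: (low r) => //; lia.
- tfae.
  + by move=> /(_ [::]) [r [_ [r0 Sr]]]; exists 0; apply: (high r) => //; lia.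
  + move=> [r hr]; apply: (high (Num.max r 0)); first by rewrite le_max lexx orbT.
    by apply: hr; rewrite le_max lexx.
  + by move=> h; exists 0; split=> //; apply: h.
  + move=> [r [hr Sr]]; apply: infinitely_many_unbounded => i.
    exists (1 + i%:Z); split; [lia|split; [lia|]].
    by apply: (high r) => //; lia.
- move=> m2; split=> [[t [ht St]]|h]; first exact: all_ ht St.
  by exists (- 1); split; [lia|apply: h].
Qed.
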